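(* Let $(S_i)$ and $(\tilde S_\ell)$ be independent simple random walks on $\mathbb{Z}^4$ started at the origin. With $g_{n,\alpha}(i)$, $\tilde g_{m,\alpha}(\ell)$ and $\hat g_{n,\alpha}$ as defined in the context, set $$Y_{n,m}:=\sum_{i=1}^n\sum_{\ell=1}^m g_{n,\alpha}(i)\,G(S_i,\tilde S_\ell)\,\tilde g_{m,\alpha}(\ell),\qquad \underline Y_{n,m}:=\hat g_{n,\alpha}\,\hat g_{m,\alpha}\sum_{i=1}^n\sum_{\ell=1}^m G(S_i,\tilde S_\ell).$$ (i) There is $C<\infty$ such that $E[Y_{n,m}]\le C\sqrt{nm}$ for all $m,n\in\mathbb{N}$. (ii) For any $\epsilon>0$ and $\alpha>4$ there is $C=C(\epsilon,\alpha)<\infty$ such that for all integers $n\ge2$ and $m$ with $n^\epsilon\le m\le n$, $$E[Y_{n,m}]\le C\sqrt{nm}\,(\log n)^{-2},\qquad E\big[(Y_{n,m}-\underline Y_{n,m})^2\big]\le C\,nm\,(\log n)^{-\alpha/2}.$$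
   Context: Simple random walk on $\mathbb{Z}^4$: i.i.d. increments uniform on the $8$ nearest neighbours of the origin; $G(x,y):=\sum_{i=0}^\infty P^x(S_i=y)$ is its Green's function. For integers $a<b$ let $\mathcal{R}(a,b]:=\{S_i: a<i\le b\}$ and $\mathcal R_b:=\mathcal R(0,b]$. Let $\hat P^x$ be the law of a further independent simple random walk $(\hat S_k)$ started at $x$, and $\hat\tau_A:=\inf\{k\ge1:\hat S_k\in A\}$ its first positive hitting time of $A$. Fix $\alpha>0$ and put $n_\alpha:=\lceil n(\log n)^{-\alpha}\rceil$ (so $n_{2\alpha}=\lceil n(\log n)^{-2\alpha}\rceil$). For integers $i\in[n_{2\alpha},n-n_{2\alpha}]$ define $$g_{n,\alpha}(i):=1_{\{S_i\notin\mathcal R(i,i+n_{2\alpha}]\}}\ \hat P^{S_i}\big(\hat\tau_{\mathcal R(i-n_{2\alpha},\,i+n_{2\alpha}]}=\infty\big),$$ and $g_{n,\alpha}(i):=1$ for all other $i\in[0,n]$ (in particular all $i$ if $n=1$). $\tilde g_{m,\alpha}(\ell)$ is defined in the same way with $(\tilde S_\ell)$ and $m$ in place of $(S_i)$ and $n$. For $n\ge2$ the deterministic number $\hat g_{n,\alpha}$ is $$\hat g_{n,\alpha}:=E\big[1_{\{S_{n_{2\alpha}}\notin\mathcal R(n_{2\alpha},2n_{2\alpha}]\}}\ \hat P^{S_{n_{2\alpha}}}(\hat\tau_{\mathcal R_{2n_{2\alpha}}}=\infty)\big],$$ which equals $E[g_{n,\alpha}(i)]$ for any $i\in[n_{2\alpha},n-n_{2\alpha}]$.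 *)

(* Defs.v *)
From HB Require Import structures.
From mathcomp Require Export all_boot all_order all_algebra finmap.
From mathcomp Require Export all_classical all_reals all_analysis.
Export Order.TTheory GRing.Theory Num.Theory numFieldNormedType.Exports.

#[export] Set Implicit Arguments.
#[export] Unset Strict Implicit.
#[export] Unset Printing Implicit Defensive.

Local Open Scope classical_set_scope.
Local Open Scope ring_scope.
Local Open Scope ereal_scope.

Notation Z4 := 'rV[int]_4.

Definition nearest_neighbor (e : Z4) : bool := (\sum_(k < 4) `|e ord0 k| == 1)%R.

(** Z^4 carries the discrete sigma-algebra: random variables with values in Z^4
    are maps whose preimages of arbitrary subsets are measurable. *)

Definition Z4_random_variable d (T : measurableType d) (X : T -> Z4) : Prop :=
  forall A : set Z4, measurable (X @^-1` A).

Definition mutually_independent d (T : measurableType d) (R : realType)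
    (P : probability T R) (X : nat -> T -> Z4) : Prop :=
  forall (J : {fset nat}) (A : nat -> set Z4),
    P (\bigcap_(j in [set` J]) (X j @^-1` A j))
    = \prod_(j <- J) P (X j @^-1` A j).

Definition increment T (S : nat -> T -> Z4) (i : nat) (w : T) : Z4 :=
  (S i.+1 w - S i w)%R.

Record simple_random_walk d (T : measurableType d) (R : realType)
    (P : probability T R) (x : Z4) (S : nat -> T -> Z4) : Prop := {
  srw_start : forall w, S 0%N w = x ;
  srw_measurable : forall i, Z4_random_variable (S i) ;
  srw_uniform : forall i (e : Z4),
    P (increment S i @^-1` [set e])
    = (if nearest_neighbor e then 8^-1 else 0)%R%:E ;
  srw_independent : mutually_independent P (increment S)
}.

Definition process_sigma_algebra T (X : nat -> T -> Z4) : set (set T) :=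
  <<s [set B | exists i (A : set Z4), B = X i @^-1` A] >>.

Definition independent_processes d (T : measurableType d) (R : realType)
    (P : probability T R) (X Y : nat -> T -> Z4) : Prop :=
  forall A B, process_sigma_algebra X A -> process_sigma_algebra Y B ->
    P (A `&` B) = P A * P B.

(** [walk_range s a b] is R(a, b]. *)
Definition walk_range (s : nat -> Z4) (a b : nat) : set Z4 :=
  [set s i | i in [set i : nat | (a < i <= b)%N]].

(** First positive hitting time; [+oo] when [A] is never hit, because
    [ereal_inf set0 = +oo]. *)
Definition hitting_time (R : realType) (s : nat -> Z4) (A : set Z4) : \bar R :=
  ereal_inf [set k%:R%:E | k in [set k : nat | (1 <= k)%N /\ A (s k)]].

(** Below, [W] is a simple random walk started at the origin under the
    probability [Q]; P^x is the law of [fun k => x + W k]. *)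

Definition green d (T : measurableType d) (R : realType) (Q : probability T R)
    (W : nat -> T -> Z4) (x y : Z4) : \bar R :=
  \sum_(0 <= i <oo) Q [set w | (x + W i w)%R = y].

Definition escape d (T : measurableType d) (R : realType) (Q : probability T R)
    (W : nat -> T -> Z4) (x : Z4) (A : set Z4) : \bar R :=
  Q [set w | hitting_time R (fun k => (x + W k w)%R) A = +oo].

(** [cutoff alpha n] is n_alpha (only meaningful for [2 <= n]). *)
Definition cutoff (R : realType) (alpha : R) (n : nat) : nat :=
  `|Num.ceil (n%:R * (ln n%:R) `^ (- alpha))%R|%N.

(** Used with [r <= i] only, so the subtraction [i - r] is never truncated. *)
Definition local_escape d (T : measurableType d) (R : realType)
    (Q : probability T R) (W : nat -> T -> Z4) (r : nat) (s : nat -> Z4)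
    (i : nat) : \bar R :=
  (\1_(~` walk_range s i (i + r)) (s i))%:E
  * escape Q W (s i) (walk_range s (i - r) (i + r)).

Definition g d (T : measurableType d) (R : realType) (Q : probability T R)
    (W : nat -> T -> Z4) (alpha : R) (n : nat) (s : nat -> Z4) (i : nat) : \bar R :=
  let r := cutoff (2 * alpha)%R n in
  if [&& (2 <= n)%N, (r <= i)%N & (i + r <= n)%N] then local_escape Q W r s i
  else 1.

(** The expectation is over the walk [S] under [P]; with centre [r] and radius
    [r] the set in the escape probability is R(0, 2r]. *)
Definition ghat d (T : measurableType d) d' (T' : measurableType d')
    (R : realType) (P : probability T R) (S : nat -> T -> Z4)
    (Q : probability T' R) (W : nat -> T' -> Z4) (alpha : R) (n : nat) : \bar R :=
  let r := cutoff (2 * alpha)%R n in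
  \int[P]_w local_escape Q W r (S ^~ w) r.

Definition Ysum d (T : measurableType d) (R : realType) (Q : probability T R)
    (W : nat -> T -> Z4) (alpha : R) (n m : nat) (s s' : nat -> Z4) : \bar R :=
  \sum_(1 <= i < n.+1) \sum_(1 <= l < m.+1)
    g Q W alpha n s i * green Q W (s i) (s' l) * g Q W alpha m s' l.

Definition Ybar d (T : measurableType d) d' (T' : measurableType d')
    (R : realType) (P : probability T R) (S : nat -> T -> Z4)
    (Q : probability T' R) (W : nat -> T' -> Z4) (alpha : R) (n m : nat)
    (s s' : nat -> Z4) : \bar R :=
  ghat P S Q W alpha n * ghat P S Q W alpha m
  * \sum_(1 <= i < n.+1) \sum_(1 <= l < m.+1) green Q W (s i) (s' l).

(* Main.v *)
(** Expectations of functions of finitely many steps are averages over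
    nearest-neighbour paths, and the heat kernel on Z^4 has an explicit formula,
    which gives p_k(x) <= 4/((k+1)(k+2)); part (i) follows by summation, because
    E G(S_i, S'_l) = sum_{k >= i+l} p_k(0).

    Write G_T for the sum of the first T heat kernels and
    F(x) = sum_l c_l G_T(x - S'_l) with 0 <= c_l <= 1. To bound the second moment of
    sum_i (g(i) - ghat) F(S_i), replace F(S_i) by F(S_{i-r}), r = n_{2 alpha}.
    Terms at distance at least 2r are then orthogonal, since g depends on the
    increments in a window of radius r, and the others contribute at most
    r sum_i E F(S_i)^2. The replacement costs a Dirichlet energy,
    E |F(S_N + Z) - F(S_N)|^2 <= 2 sup p_N <F, (I - P^r) F> for an independent
    r-step increment Z; as (I - P^r) G = I + P + ... + P^{r-1}, this energy is a sum
    of heat kernels p_{k+j}(S'_l - S'_l'). Altogether the second moment is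
    O(r m (log n)^3), and r is of order n (log n)^{-2 alpha}.

    The first bound of (ii) follows from the second moment and ghat <= C / log n.
    For the latter, the last-exit decomposition gives E[g D] <= 3, where D sums the
    Green function along the walk; D has mean at least c log n and variance
    O(log n), so Chebyshev's inequality concludes. *)

Require Import Defs.
From mathcomp Require Import ring lra zify measurable_realfun.

Local Open Scope classical_set_scope.
Local Open Scope ring_scope.

(** * Averages over nearest-neighbour paths *)

(** The obstacle is that g(i) and F(S_i) depend on the same increments. The lag r is the smallest
    one that puts the argument of F at the start of the window of g(i), and the Dirichlet energy is
    the price of this lag. The truncation T makes the Green function finitely supported, so that
    sums over Z^4 become sums over finite lists. The second moment bounds do not depend on T, which
    tends to infinity only at the end, under averages over finitely many paths. The form
    4/((k+1)(k+2)) matters because it telescopes: a Green function restricted to times from a on is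
    at most 4/(a+1). Of the three logarithms, one comes from pairs of times of the walk that carries
    the c_l, two from the sum over i, by a weighted Cauchy-Schwarz inequality against an energy
    decaying like (i-r)^(-2). The second moment is thus of order n m (log n)^(3 - 2 alpha). For
    alpha > 4 this exponent is at most -alpha/2, and also at most -4, whose square root is the (log
    n)^(-2) of the first bound. The condition m >= n^epsilon enters through log m >= epsilon log
    n. *)

Definition unit_vector (k : 'I_4) : Z4 := \row_(j < 4) (j == k)%:R.

Definition steps : seq Z4 :=
  [seq unit_vector k | k <- enum 'I_4] ++ [seq - unit_vector k | k <- enum 'I_4].

Definition displacement (s : seq Z4) : Z4 := \sum_(x <- s) x.

Definition walk (s : seq Z4) (i : nat) : Z4 := displacement (take i s).

Lemma cvg_sumr (R : realType) (I : Type) (r : seq I) (P : pred I)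
    (u : nat -> I -> R) (l : I -> R) :
  (forall i, u k i @[k --> \oo] --> l i) ->
  \sum_(i <- r | P i) u k i @[k --> \oo] --> \sum_(i <- r | P i) l i.
Proof.
move=> ul; elim: r => [|i r IH].
  by rewrite big_nil; under eq_fun do rewrite big_nil; exact: cvg_cst.
rewrite big_cons; under eq_fun do rewrite big_cons.
by case: ifP => // _; apply: cvgD.
Qed.

(* A path is coded by the list of its increments. *)
Section PathMean.
Variable R : realType.
Implicit Types (f g : seq Z4 -> R) (x y : Z4).

Fixpoint pathE (n : nat) f : R :=
  if n is n'.+1 then 8^-1 * \sum_(e <- steps) pathE n' (fun s => f (e :: s))
  else f [::].

Lemma size_steps : size steps = 8%N.
Proof. by rewrite size_cat !size_map -enumT size_enum_ord. Qed.

Lemma eq_pathE n f g : (forall s, size s = n -> f s = g s) -> pathE n f = pathE n g.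
Proof.
elim: n f g => [|n IH] f g fg /=; first exact: fg.
by congr (_ * _); apply: eq_bigr => e _; apply: IH => s ss; apply: fg => /=; rewrite ss.
Qed.

Lemma ler_pathE n f g : (forall s, size s = n -> f s <= g s) -> pathE n f <= pathE n g.
Proof.
elim: n f g => [|n IH] f g fg /=; first exact: fg.
rewrite ler_pM2l ?invr_gt0//; apply: ler_sum => e _.
by apply: IH => s ss; apply: fg => /=; rewrite ss.
Qed.

Lemma pathED n f g : pathE n (fun s => f s + g s) = pathE n f + pathE n g.
Proof.
by elim: n f g => [//|n IH] f g /=; rewrite -mulrDr -big_split; under eq_bigr do rewrite IH.
Qed.

Lemma pathEZl n (c : R) f : pathE n (fun s => c * f s) = c * pathE n f.
Proof.
elim: n f => [//|n IH] f /=.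
by under eq_bigr do rewrite IH; rewrite -mulr_sumr mulrCA.
Qed.

Lemma pathEZr n (c : R) f : pathE n (fun s => f s * c) = pathE n f * c.
Proof. by rewrite mulrC -pathEZl; apply: eq_pathE => s _; rewrite mulrC. Qed.

Lemma pathEN n f : pathE n (fun s => - f s) = - pathE n f.
Proof. by rewrite -mulN1r -pathEZl; apply: eq_pathE => s _; rewrite mulN1r. Qed.

Lemma pathEB n f g : pathE n (fun s => f s - g s) = pathE n f - pathE n g.
Proof. by rewrite pathED pathEN. Qed.

Lemma pathE_cst n (c : R) : pathE n (fun=> c) = c.
Proof.
elim: n => [//|n IH] /=; rewrite IH big_const_seq count_predT size_steps iter_addr_0.
by rewrite -[c *+ _]mulr_natl mulKf// pnatr_eq0.
Qed.

Lemma pathE_sum n (I : Type) (r : seq I) (P : pred I) (F : I -> seq Z4 -> R) :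
  pathE n (fun s => \sum_(i <- r | P i) F i s) = \sum_(i <- r | P i) pathE n (F i).
Proof.
elim: r => [|i r IH].
  by rewrite big_nil -[RHS](pathE_cst n); apply: eq_pathE => s _; rewrite big_nil.
rewrite big_cons; case: ifP => Pi; rewrite -IH -?pathED; apply: eq_pathE => s _;
  by rewrite big_cons Pi.
Qed.

Lemma pathE_ge0 n f : (forall s, size s = n -> 0 <= f s) -> 0 <= pathE n f.
Proof. by move=> f0; rewrite -(pathE_cst n 0); exact: ler_pathE. Qed.

Lemma pathE_cat n m f :
  pathE (n + m) f = pathE n (fun s => pathE m (fun t => f (s ++ t))).
Proof. by elim: n f => [//|n IH] f; rewrite addSn /=; under eq_bigr do rewrite IH. Qed.

Lemma pathE_swap n m (F : seq Z4 -> seq Z4 -> R) :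
  pathE n (fun s => pathE m (F s)) = pathE m (fun t => pathE n (F^~ t)).
Proof.
elim: n F => [//|n IH] F /=.
under eq_bigr do rewrite IH.
by rewrite -pathE_sum -pathEZl.
Qed.

Lemma pathE_sqr n f : pathE n f ^+ 2 <= pathE n (fun s => f s ^+ 2).
Proof.
rewrite -subr_ge0; set c := pathE n f.
suff -> : pathE n (fun s => f s ^+ 2) - c ^+ 2 = pathE n (fun s => (f s - c) ^+ 2).
  by apply: pathE_ge0 => s _; exact: sqr_ge0.
rewrite (_ : (fun s => (f s - c) ^+ 2) = (fun s => f s ^+ 2 + (- 2 * c) * f s + c ^+ 2)).
  by rewrite !pathED pathE_cst pathEZl -/c; ring.
by apply/funext => s; ring.
Qed.

Lemma cvg_pathE n (F : nat -> seq Z4 -> R) f :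
  (forall s, F k s @[k --> \oo] --> f s) -> pathE n (F k) @[k --> \oo] --> pathE n f.
Proof.
elim: n F f => [|n IH] F f cF /=; first exact: cF.
apply: cvgMl_tmp; apply: cvg_sumr => e; apply: IH => s; exact: cF.
Qed.

Lemma displacement_cons x s : displacement (x :: s) = x + displacement s.
Proof. by rewrite /displacement big_cons. Qed.

Lemma displacement_cat s t : displacement (s ++ t) = displacement s + displacement t.
Proof. by rewrite /displacement big_cat. Qed.

Lemma walk_catl s t i : (i <= size s)%N -> walk (s ++ t) i = walk s i.
Proof.
move=> si; rewrite /walk take_cat; case: ltnP => // si'.
by have -> : i = size s; [lia|rewrite subnn take0 cats0 take_size].
Qed.

Lemma walk_catr s t i : walk (s ++ t) (size s + i) = displacement s + walk t i.
Proof. by rewrite /walk take_cat ltnNge leq_addr /= addKn displacement_cat. Qed.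

Lemma walk_size s : walk s (size s) = displacement s.
Proof. by rewrite /walk take_size. Qed.

Lemma walk0 s : walk s 0 = 0.
Proof. by rewrite /walk take0 /displacement big_nil. Qed.

Lemma pathE_walk n i (f : Z4 -> R) : (i <= n)%N ->
  pathE n (fun s => f (walk s i)) = pathE i (fun s => f (displacement s)).
Proof.
move=> leim; rewrite -(subnKC leim) pathE_cat; apply: eq_pathE => s ss.
rewrite -[RHS](pathE_cst (n - i)); apply: eq_pathE => t _.
by rewrite walk_catl ?ss// -ss walk_size.
Qed.

Lemma pathE_increment n i j (f : Z4 -> R) : (i + j <= n)%N ->
  pathE n (fun s => f (walk s (i + j) - walk s i)) =
  pathE j (fun s => f (displacement s)).
Proof.
move=> leim; rewrite -(subnKC leim) -addnA pathE_cat.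
rewrite -[RHS](pathE_cst i); apply: eq_pathE => s ss.
rewrite -(@pathE_walk (j + (n - (i + j))))  ?leq_addr//; apply: eq_pathE => t _.
by rewrite -ss walk_catr walk_catl// walk_size addrC addKr.
Qed.

End PathMean.

(** * The heat kernel of Z^4 *)

Lemma leq_bin_half (n i : nat) : ('C(n, i) <= 'C(n, n./2))%N.
Proof.
have up : forall k i, (i + k = n./2)%N -> ('C(n, i) <= 'C(n, n./2))%N.
  elim=> [|k IH] j jk; first by rewrite -jk addn0.
  apply: leq_trans (IH j.+1 _); last by lia.
  rewrite -(@leq_pmul2l j.+1)// mul_bin_left leq_pmul2r ?bin_gt0; lia.
have [lein|ltni] := leqP i n; last by rewrite bin_small.
have [lei|lti] := leqP i n./2; first exact: (up (n./2 - i)%N i ltac:(lia)).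
rewrite -bin_sub//; apply: (up (n./2 - (n - i))%N); lia.
Qed.

Lemma central_binS m : (m.+1 ^ 2 * 'C(m.+1.*2, m.+1) = m.+1.*2 * m.*2.+1 * 'C(m.*2, m))%N.
Proof.
have e1 := mul_bin_diag m.+1.*2 m; have e2 := mul_bin_diag m.*2.+1 m.
have e3 : 'C(m.*2.+1, m) = 'C(m.*2.+1, m.+1) by rewrite -bin_sub; [congr binomial|]; lia.
rewrite /= in e1 e2; rewrite e3 in e1; nia.
Qed.

(** Consecutive left sides have ratio 16 (2m+1)(2m+3)/(2m+2)^2 <= 16. *)
Lemma central_bin_ub m : ('C(m.*2, m) ^ 2 * m.*2.+1 <= 16 ^ m)%N.
Proof.
elim: m => // m IH; rewrite [(16 ^ _)%N]expnS.
have e := central_binS m; set a := 'C(m.*2, m) in IH e; set b := 'C(_, _) in e *.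
set P := (16 ^ m)%N in IH *.
have e2 : (m.+1 * b = 2 * m.*2.+1 * a)%N by apply/eqP; rewrite -(@eqn_pmul2l m.+1)//; apply/eqP;
  nia.
rewrite -(@leq_pmul2l (m.+1 ^ 2))//.
have -> : (m.+1 ^ 2 * (b ^ 2 * m.+1.*2.+1) = 4 * (a ^ 2 * m.*2.+1) * (m.*2.+1 * m.+1.*2.+1))%N.
  by rewrite mulnA -expnMn e2; lia.
have -> : (m.+1 ^ 2 * (16 * P) = 4 * P * (4 * m.+1 ^ 2))%N by lia.
by apply: leq_mul; [rewrite leq_mul2l IH|nia].
Qed.

Lemma central_bin_lb m : (16 ^ m <= 'C(m.*2, m) ^ 2 * (2 * m.*2.+1))%N.
Proof.
(* The induction runs on the sharper factor 4m, for m >= 1: with 2(2m+1) the consecutive ratios are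
   below 16 and the bound does not propagate. *)
case: m => // m; suff : (16 ^ m.+1 <= 'C(m.+1.*2, m.+1) ^ 2 * (4 * m.+1))%N.
  by move=> /leq_trans; apply; rewrite leq_mul2l; lia.
elim: m => // m IH; rewrite [(16 ^ _)%N]expnS.
have e := central_binS m.+1; set a := 'C(m.+1.*2, m.+1) in IH e; set b := 'C(_, _) in e *.
set P := (16 ^ m.+1)%N in IH *.
have e2 : (m.+2 * b = 2 * m.+1.*2.+1 * a)%N by apply/eqP; rewrite -(@eqn_pmul2l m.+2)//;
  apply/eqP; nia.
rewrite -(@leq_pmul2l (m.+2 ^ 2 * m.+1))//.
have -> : (m.+2 ^ 2 * m.+1 * (b ^ 2 * (4 * m.+2)) = (a ^ 2 * (4 * m.+1)) * (4 * m.+2 * m.+1.*2.+1 ^ 2))%N.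
  transitivity ((m.+2 * b) ^ 2 * (4 * m.+1 * m.+2))%N; first by lia.
  by rewrite e2; lia.
have -> : (m.+2 ^ 2 * m.+1 * (16 * P) = P * (16 * m.+2 ^ 2 * m.+1))%N by lia.
by apply: leq_mul => //; nia.
Qed.

(** Only the middle coefficient matters; for odd [n] it is half of the central coefficient of
    [n.+1]. *)
Lemma leq_bin_sqr n i : ('C(n, i) ^ 2 * n.+1 <= 4 ^ n)%N.
Proof.
have := leq_bin_half n i; rewrite -leq_sqr -(@leq_pmul2r n.+1)// => /leq_trans; apply.
have := central_bin_ub; rewrite -{1 3 4}(odd_double_half n); set m := n./2.
case: (odd n) => ub.
  2: by rewrite !add0n (_ : (4 ^ m.*2 = 16 ^ m)%N) ?ub// -muln2 mulnC expnM.
rewrite !add1n; have := ub m.+1; set b := 'C(m.+1.*2, _).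
have -> : b = (2 * 'C(m.*2.+1, m))%N.
  rewrite /b doubleS binS -[in X in (X + _)%N]bin_sub; last by lia.
  by rewrite (_ : m.*2.+1 - m.+1 = m)%N; lia.
have -> : (16 ^ m.+1 = 4 * 4 ^ m.*2.+1)%N by rewrite -!(expnM 4 2) -expnS; congr expn; lia.
set c := 'C(_, _); set Q := (4 ^ _)%N; nia.
Qed.

Lemma sum_pairs (V : nmodType) (a : nat -> V) k :
  \sum_(0 <= j < k.*2) a j = \sum_(0 <= j < k) (a j.*2 + a j.*2.+1).
Proof.
elim: k => [|k IH]; first by rewrite !big_nil.
by rewrite doubleS !big_nat_recr//= IH addrA.
Qed.

Section Transition.
Variable R : realType.
Implicit Types (u : int) (x y : Z4).

Fixpoint srw1 (n : nat) u : R :=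
  if n is n'.+1 then (srw1 n' (u - 1) + srw1 n' (u + 1)) / 2 else (u == 0)%:R.

Lemma srw1_eq0 n u : (forall i : nat, u <> i%:Z *+ 2 - n%:Z) -> srw1 n u = 0.
Proof.
elim: n u => [|n IH] u un /=.
  by case: eqP (un 0%N) => // ->; rewrite mul0rn subr0.
rewrite !IH ?addr0 ?mul0r// => i ui.
- by apply: (un i); lia.
- by apply: (un i.+1); lia.
Qed.

Lemma srw1_bin n (i : nat) : srw1 n (i%:Z *+ 2 - n%:Z) = 'C(n, i)%:R / 2 ^+ n.
Proof.
elim: n i => [|n IH] i /=.
  by rewrite subr0 expr0 divr1; case: i => [|i]; rewrite ?bin0//= bin_small.
case: i => [|i].
  rewrite srw1_eq0 ?add0r; last by move=> j; lia.
  have := IH 0%N; rewrite !bin0 !mul1r => IH0.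
  rewrite (_ : _ + 1 = 0%:Z *+ 2 - n%:Z) ?IH0; last by lia.
  by rewrite exprS invfM mulrC.
rewrite (_ : _ - 1 = i%:Z *+ 2 - n%:Z); last by lia.
rewrite (_ : _ + 1 = i.+1%:Z *+ 2 - n%:Z); last by lia.
by rewrite !IH binS natrD exprS invfM; ring.
Qed.

Lemma srw1_ge0 n u : 0 <= srw1 n u.
Proof. by elim: n u => [|n IH] u /=; rewrite ?ler0n// divr_ge0// addr_ge0. Qed.

(** Squared, because these kernels occur in pairs: in rotated coordinates a planar kernel is a
    product of two of them, hence at most 1/(n+1). *)
Lemma srw1_sqr_le n u : srw1 n u ^+ 2 <= n.+1%:R^-1.
Proof.
have [[i ->]|nu] := pselect (exists i : nat, u = i%:Z *+ 2 - n%:Z); last first.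
  by rewrite srw1_eq0 ?expr0n ?invr_ge0//= => i ui; apply: nu; exists i.
rewrite srw1_bin expr_div_n ler_pdivrMr ?exprn_gt0// mulrC ler_pdivlMr//.
by rewrite -exprM mulnC exprM -!natrX -natrM ler_nat leq_bin_sqr.
Qed.

Lemma srw1M_le n u v : srw1 n u * srw1 n v <= n.+1%:R^-1.
Proof. have := srw1_sqr_le n u; have := srw1_sqr_le n v; have := sqr_ge0 (srw1 n u - srw1 n v).
by move: (srw1 n u) (srw1 n v) (_^-1) => a b c; nra. Qed.

Lemma srw1_return_ge m : (2 * m.*2.+1%:R)^-1 <= srw1 m.*2 0 ^+ 2.
Proof.
rewrite (_ : srw1 _ 0 = srw1 m.*2 (m%:Z *+ 2 - m.*2%:Z)); last by congr srw1; lia.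
rewrite srw1_bin expr_div_n ler_pdivlMr ?exprn_gt0// mulrC ler_pdivrMr ?mulr_gt0//.
rewrite -exprM -muln2 -mulnA mulnC exprM -!natrX -!natrM ler_nat.
by have := central_bin_lb m; rewrite (_ : (2 ^ (2 * 2) = 16)%N)// -muln2.
Qed.

Definition heat (n : nat) x : R := pathE n (fun s => (displacement s == x)%:R).

Lemma heat_ge0 n x : 0 <= heat n x.
Proof. by apply: pathE_ge0 => s _; rewrite ler0n. Qed.

Lemma heat0 x : heat 0 x = (x == 0)%:R.
Proof. by rewrite /heat/= /displacement big_nil eq_sym. Qed.

Lemma heatD n k x : heat (n + k) x = pathE n (fun s => heat k (x - displacement s)).
Proof.
rewrite /heat pathE_cat; apply: eq_pathE => s _; apply: eq_pathE => t _.
by rewrite displacement_cat eq_sym addrC -subr_eq eq_sym.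
Qed.

Lemma sum_steps (V : nmodType) (f : Z4 -> V) :
  \sum_(e <- steps) f e = \sum_(k < 4) (f (unit_vector k) + f (- unit_vector k)).
Proof. by rewrite big_cat !big_map big_split -enumT !big_enum. Qed.

Lemma heatS n x :
  heat n.+1 x = 8^-1 * \sum_(k < 4) (heat n (x - unit_vector k) + heat n (x + unit_vector k)).
Proof.
rewrite -add1n heatD /= sum_steps; congr (_ * _); apply: eq_bigr => k _.
by rewrite !displacement_cons /displacement big_nil !addr0 opprK.
Qed.

Lemma heatN n x : heat n (- x) = heat n x.
Proof.
elim: n x => [|n IH] x; first by rewrite !heat0 oppr_eq0.
rewrite !heatS; congr (_ * _); apply: eq_bigr => k _.
by rewrite -opprD IH addrC -IH opprD !opprK.
Qed.

Lemma heatDr n k x : pathE n (fun s => heat k (x + displacement s)) = heat (n + k) x.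
Proof.
rewrite -heatN heatD; apply: eq_pathE => s _.
by rewrite -heatN opprD.
Qed.

(** Pascal's rule under the sum. With [j] the number of steps in the first coordinate plane, it
    conditions on the plane of one additional step. *)
Lemma sum_binS n (f : nat -> nat -> R) :
  \sum_(j < n.+2) 'C(n.+1, j)%:R * f j (n.+1 - j)%N =
  \sum_(j < n.+1) 'C(n, j)%:R * (f j.+1 (n - j)%N + f j (n - j).+1).
Proof.
under [RHS]eq_bigr do rewrite mulrDr; rewrite big_split/=.
rewrite big_ord_recl bin0 /= subn0.
under eq_bigr do rewrite /bump/= add1n binS natrD mulrDl subSS.
rewrite big_split/= addrA addrC; congr (_ + _).
rewrite big_ord_recr/= bin_small// mul0r addr0 [RHS]big_ord_recl bin0 subn0; congr (_ + _).
apply: eq_bigr => j _; rewrite ?/bump/= ?add1n; congr (_ * f _ _).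
by have := ltn_ord j; rewrite /bump; lia.
Qed.

Definition srw2 n (u v : int) : R := srw1 n u * srw1 n v.

Lemma srw2S n u v : srw2 n.+1 u v =
  (srw2 n (u - 1) (v - 1) + srw2 n (u + 1) (v + 1) +
   (srw2 n (u - 1) (v + 1) + srw2 n (u + 1) (v - 1))) / 4.
Proof. by rewrite /srw2/=; field. Qed.

Definition srw4 n (a b c d : int) : R :=
  2 ^- n * \sum_(j < n.+1) 'C(n, j)%:R * (srw2 j a b * srw2 (n - j) c d).

Lemma srw4S n a b c d : srw4 n.+1 a b c d = 8^-1 *
  ((srw4 n (a - 1) (b - 1) c d + srw4 n (a + 1) (b + 1) c d) +
   ((srw4 n (a - 1) (b + 1) c d + srw4 n (a + 1) (b - 1) c d) +
    ((srw4 n a b (c - 1) (d - 1) + srw4 n a b (c + 1) (d + 1)) +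
     (srw4 n a b (c - 1) (d + 1) + srw4 n a b (c + 1) (d - 1))))).
Proof.
rewrite /srw4 (sum_binS n (fun i j => srw2 i a b * srw2 j c d)) -!mulrDr -!big_split/=.
rewrite mulrCA exprSr invfM -mulrA; congr (_ * _).
rewrite !mulr_sumr; apply: eq_bigr => j _; by rewrite !srw2S; field.
Qed.

(* In the rotated coordinates [x0 + x1], [x0 - x1] a planar step is a pair of
   independent signs, so conditionally on the number [j] of steps in the first
   coordinate plane the walk is made of four independent walks on Z. *)
Lemma heat_rotated n x (c := fun k : nat => x ord0 (inord k)) :
  heat n x = srw4 n (c 0%N + c 1%N) (c 0%N - c 1%N) (c 2%N + c 3%N) (c 2%N - c 3%N).
Proof.
elim: n x @c => [|n IH] x c.
  rewrite heat0 /srw4 big_ord_recl big_ord0 expr0 invr1 !mul1r addr0 /srw2/= -!natrM !mulnb.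
  congr (_%:R); congr nat_of_bool; apply/eqP/idP => [x0|].
    by rewrite /c x0 !mxE.
  rewrite /= -!andbA => /and4P[/eqP h1 /eqP h2 /eqP h3 /eqP h4].
  apply/rowP => k; rewrite mxE -(inord_val k).
  by case: k => [[|[|[|[|//]]]] ?] /=; rewrite -/(c _); lia.
have cE (k : 'I_4) j : (j < 4)%N ->
    ((x - unit_vector k) ord0 (inord j) = c j - (j == k)%:R) *
    ((x + unit_vector k) ord0 (inord j) = c j + (j == k)%:R).
  by move=> j4; rewrite !mxE -val_eqE /= inordK.
rewrite heatS srw4S !big_ord_recl big_ord0; congr (_ * _).
rewrite !IH !cE//= [X in _ + (_ + (_ + X))]addr0.
by do !congr (_ + _); congr srw4; lia.
Qed.

(** The planar factors are at most 1/(j+1) and 1/(n-j+1), and C(n,j)/((j+1)(n-j+1)) =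
    C(n+2,j+1)/((n+1)(n+2)). The binomials sum to at most 2^(n+2), which against 2^(-n) leaves the
    4. *)
Lemma heat_ub n x : heat n x <= 4 / (n.+1 * n.+2)%:R.
Proof.
rewrite heat_rotated /srw4.
set a := _ + _; set b := _ - _; set c := _ + _; set d := _ - _.
apply: (@le_trans _ _ (2 ^- n * \sum_(j < n.+1) ('C(n.+2, j.+1)%:R / (n.+1 * n.+2)%:R))).
  rewrite ler_pM2l ?invr_gt0 ?exprn_gt0//; apply: ler_sum => j _.
  apply: (@le_trans _ _ ('C(n, j)%:R * (j.+1%:R^-1 * (n - j).+1%:R^-1))).
    by rewrite ler_wpM2l//; apply: ler_pM; rewrite ?srw1M_le ?mulr_ge0 ?srw1_ge0.
  rewrite -invfM -natrM ler_pdivlMr// -mulrAC ler_pdivrMr// -!natrM ler_nat.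
  have e1 := mul_bin_diag n.+2 j; have e2 := mul_bin_left n.+1 j.
  have e3 := mul_bin_down n.+1 j; have := ltn_ord j.
  move: e1 e2 e3 => /=; set p := 'C(n, j); set q := 'C(n.+1, j); set r := 'C(_, _).
  move=> e1 e2 e3 jn; rewrite subSn in e3; [nia|lia].
rewrite -mulr_suml mulrA ler_pM2r ?invr_gt0 ?ltr0n//.
rewrite mulrC ler_pdivrMr ?exprn_gt0// -natr_sum -[4]/(4%:R) -natrX -natrM ler_nat.
have -> : (4 * 2 ^ n = (1 + 1) ^ n.+2)%N by rewrite add1n !expnS; lia.
rewrite expnDn big_ord_recl addnC; apply: leq_trans (leq_addr _ _).
rewrite [leqRHS]big_ord_recr; apply: leq_trans (leq_addr _ _).
by apply: leq_sum => i _; rewrite !exp1n !muln1 lift0.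
Qed.

(** The computation of [heat_ub] reversed, keeping only the even numbers of steps in the first
    plane; the two planar factors lose a factor 2 each. *)
Lemma heat_return_lb n : (2 * (n.*2.+1 * n.*2.+2)%:R)^-1 <= heat n.*2 0.
Proof.
have -> : heat n.*2 0 = srw4 n.*2 0 0 0 0 by rewrite heat_rotated !mxE.
rewrite /srw4.
pose t j : R := 'C(n.*2, j)%:R * (srw2 j 0 0 * srw2 (n.*2 - j) 0 0).
have t0 j : 0 <= t j by rewrite !mulr_ge0// srw1_ge0.
apply: (@le_trans _ _ (2 ^- n.*2 * \sum_(j < n.+1) t j.*2)); last first.
  rewrite ler_pM2l ?invr_gt0 ?exprn_gt0//.
  rewrite -(big_mkord xpredT (fun j => t j.*2)) -[X in _ <= X](big_mkord xpredT t).
  have key k : \sum_(0 <= j < k.+1) t j.*2 <= \sum_(0 <= j < k.*2.+1) t j.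
    elim: k => [|k IH]; first by rewrite !big_nat1.
    rewrite big_nat_recr//= doubleS 2?[in leRHS]big_nat_recr//=.
    by rewrite -addrA lerD// lerDr.
  exact: key.
apply: (@le_trans _ _ (2 ^- n.*2 * \sum_(j < n.+1)
    ('C(n.*2.+2, j.*2.+1)%:R / (n.*2.+1 * n.*2.+2)%:R / 4))); last first.
  rewrite ler_pM2l ?invr_gt0 ?exprn_gt0//; apply: ler_sum => j _.
  apply: (@le_trans _ _ ('C(n.*2, j.*2)%:R *
     ((2 * j.*2.+1%:R)^-1 * (2 * (n - j).*2.+1%:R)^-1))); last first.
    rewrite ler_wpM2l// -doubleB; apply: ler_pM; rewrite ?invr_ge0 ?mulr_ge0//;
      by rewrite /srw2 -expr2 srw1_return_ge.
  have jn : (j <= n)%N by have := ltn_ord j.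
  have [N eN] : exists N, (n - j)%N = N by exists (n - j)%N.
  rewrite eN -!invfM -!natrM -mulrA -invfM -natrM ler_pdivlMr// -mulrAC ler_pdivrMr// -!natrM ler_nat.
  have e1 := mul_bin_diag n.*2.+2 j.*2; have e2 := mul_bin_down n.*2.+1 j.*2.
  move: e1 e2 => /=; set p := 'C(n.*2, j.*2); set q := 'C(n.*2.+1, j.*2); set r := 'C(_, _).
  by move=> e1 e2; rewrite (_ : n.*2.+1 - j.*2 = N.*2.+1)%N in e2; [nia|lia].
rewrite -!mulr_suml -natr_sum.
(* Pascal's rule splits each odd-indexed coefficient into two neighbours of the previous row, which
   is thereby summed completely. *)
have -> : (\sum_(j < n.+1) 'C(n.*2.+2, j.*2.+1) = 2 ^ n.*2.+1)%N.
  have -> : (2 ^ n.*2.+1 = (1 + 1) ^ n.*2.+1)%N by [].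
  rewrite expnDn -(big_mkord xpredT (fun j => 'C(n.*2.+2, j.*2.+1))).
  under [RHS]eq_bigr do rewrite !exp1n !muln1.
  rewrite -(big_mkord xpredT (binomial n.*2.+1)) -doubleS sum_pairs.
  by apply: eq_bigr => j _; rewrite [LHS]binS addnC.
rewrite natrX exprS invfM.
have : (2 : R) ^+ n.*2 != 0 by rewrite expf_neq0.
set u := 2 ^+ n.*2 => u0.
rewrite le_eqVlt; apply/orP; left; apply/eqP; field.
by rewrite u0 -[2]/(2%:R) -[1]/(1%:R) -!natrD !pnatr_eq0.
Qed.

End Transition.

(** * Summation, support and on-diagonal bounds of the heat kernel *)

Section HeatKernel.
Variable R : realType.
Implicit Types (x y z : Z4) (B : seq Z4) (f : Z4 -> R).
Local Notation heat := (@heat R).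

(** The uniform bound telescopes, and being uniform it allows the point to vary with [k]. *)
Lemma heat_sum_ub T a (x : nat -> Z4) :
  \sum_(0 <= k < T) heat (k + a) (x k) <= 4 / a.+1%:R.
Proof.
pose u k : R := - 4 / (k + a).+1%:R.
apply: (@le_trans _ _ (\sum_(0 <= k < T) (u k.+1 - u k))).
  apply: ler_sum_nat => k _; apply: le_trans (heat_ub _ _ _) _.
  rewrite le_eqVlt; apply/orP; left; apply/eqP; rewrite /u addSn natrM; field.
  by rewrite -!natrD nat1r !pnatr_eq0.
by rewrite telescope_sumr// /u add0n !mulNr opprK gerDr oppr_le0 divr_ge0.
Qed.

Lemma sum_mem_le B (g : Z4 -> R) z : uniq B -> 0 <= g z ->
  \sum_(x <- B) (z == x)%:R * g x <= g z.
Proof.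
move=> uB gz; have [zB|zB] := boolP (z \in B).
  rewrite (bigD1_seq z)//= eqxx mul1r big1 ?addr0// => x xz.
  by rewrite eq_sym (negPf xz) mul0r.
by rewrite big_seq big1// => x xB; case: eqP zB => [->|]; rewrite ?xB// mul0r.
Qed.

(* The sum over Z^4 is truncated to a finite list, which only costs an inequality. *)
Lemma heat_convolution_le k j y y' B : uniq B ->
  \sum_(x <- B) heat k (x - y) * heat j (x - y') <= heat (k + j) (y - y').
Proof.
move=> uB; rewrite -heatDr.
under eq_bigr do rewrite -pathEZr.
rewrite -pathE_sum; apply: ler_pathE => s _.
rewrite (eq_bigr (fun x => (y + displacement s == x)%:R * heat j (x - y'))) => [|x _]; last first.
  by rewrite eq_sym subr_eq eq_sym addrC.
apply: le_trans (@sum_mem_le B (fun x => heat j (x - y')) _ uB (heat_ge0 _ _ _)) _.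
by rewrite addrAC.
Qed.

Lemma pathE_support n : exists L : seq Z4, forall f g, {in L, f =1 g} ->
  pathE n (fun s => f (displacement s)) = pathE n (fun s => g (displacement s)).
Proof.
elim: n => [|n [L IH]].
  exists [:: 0] => f g fg /=; rewrite /displacement big_nil.
  by apply: fg; rewrite inE.
exists [seq e + x | e <- steps, x <- L] => f g fg /=; congr (_ * _).
rewrite !big_seq; apply: eq_bigr => e es.
under eq_pathE do rewrite displacement_cons.
rewrite (IH (fun x => f (e + x)) (fun x => g (e + x))) => [|x xL].
  by apply: eq_pathE => s _; rewrite displacement_cons.
by apply: fg; apply/allpairsP; exists (e, x).
Qed.

(** The expectation is a sum over any list [B] containing [L], so [B] can be enlarged to contain the
    support of another function as well. *)
Lemma heat_support n : exists2 L : seq Z4, (forall x, x \notin L -> heat n x = 0) &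
  forall B f, uniq B -> {subset L <= B} ->
    pathE n (fun s => f (displacement s)) = \sum_(x <- B) heat n x * f x.
Proof.
have [L HL] := pathE_support n; exists L => [x xL|B f uB LB].
  rewrite /heat (HL (fun z => (z == x)%:R) (fun=> 0)) ?pathE_cst// => z zL.
  by case: eqP xL => // <-; rewrite zL.
under [RHS]eq_bigr do rewrite -pathEZr; rewrite -pathE_sum.
apply: (HL f (fun z => \sum_(x <- B) (z == x)%:R * f x)) => z /LB zB.
rewrite (bigD1_seq z)//= eqxx mul1r big1 ?addr0// => x xz.
by rewrite eq_sym (negPf xz) mul0r.
Qed.

(** Cauchy-Schwarz, as 2ab <= a^2 + b^2, in the Chapman-Kolmogorov equation. *)
Lemma heat_double_le n x : heat (n + n) x <= heat (n + n) 0.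
Proof.
have [L _ HL] := heat_support n.
rewrite heatD (HL (undup L) (fun z => heat n (x - z))) ?undup_uniq//; last first.
  by move=> z; rewrite mem_undup.
apply: (@le_trans _ _ (2^-1 * (\sum_(z <- undup L) heat n (z - 0) * heat n (z - 0) +
    \sum_(z <- undup L) heat n (z - x) * heat n (z - x)))).
  rewrite -big_split mulr_sumr; apply: ler_sum => z _ /=.
  rewrite subr0 -[heat n (x - z)]heatN opprB.
  by have := sqr_ge0 (heat n z - heat n (z - x)); nra.
have h y : \sum_(z <- undup L) heat n (z - y) * heat n (z - y) <= heat (n + n) 0.
  by have := @heat_convolution_le n n y y _ (undup_uniq L); rewrite subrr.
have := h 0; have := h x; lra.
Qed.

Definition parity x : bool := odd (absz (\sum_(k < 4) x ord0 k)%R).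

Lemma parityD x k (c : bool) : parity (x + (-1) ^+ c *: unit_vector k) = ~~ parity x.
Proof.
rewrite /parity; set u := \sum_(j < 4) x ord0 j.
have -> : \sum_(j < 4) (x + (-1) ^+ c *: unit_vector k) ord0 j = u + (-1) ^+ c.
  under eq_bigr do rewrite !mxE; rewrite big_split/= -/u -mulr_sumr.
  rewrite (bigD1 k)//= eqxx big1 ?addr0 ?mulr1// => j jk.
  by rewrite (negPf jk).
by move: u => u; case: c; rewrite ?expr1 ?expr0; lia.
Qed.

Lemma heat_parity n x : odd n != parity x -> heat n x = 0.
Proof.
elim: n x => [|n IH] x.
  rewrite heat0; case: (x =P 0) => [->|//].
  by have -> : parity 0 = false by rewrite /parity big1 // => k _; rewrite mxE.
rewrite /= => nx; rewrite heatS big1 ?mulr0// => k _.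
have := parityD x k true; have := parityD x k false.
rewrite expr0 expr1 scale1r scaleN1r => p1 p2.
by rewrite !IH ?addr0// ?p1 ?p2; move: nx; case: odd; case: parity.
Qed.

Lemma heatS_le n x : odd n = false -> heat n.+1 x <= heat n 0.
Proof.
move=> on; rewrite heatS mulrC ler_pdivrMr//.
have h y : heat n y <= heat n 0.
  by rewrite -(odd_double_half n) on add0n -addnn heat_double_le.
rewrite (le_trans (ler_sum _ (G := fun=> heat n 0 + heat n 0) _))// => [k _|].
  by rewrite lerD.
by rewrite sumr_const card_ord -mulr2n -mulrnA mulr_natr.
Qed.

(** Returns to 0 happen at even times only, so a point of odd parity can be compared with 0 only
    after a shift by one step. *)
Lemma heat_le_return x :
  (forall n, heat n x <= heat n 0) \/ (forall n, heat n.+1 x <= heat n 0).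
Proof.
have [px|px] := boolP (parity x); [right|left] => n.
  have [on|on] := boolP (odd n); last by apply: heatS_le; exact: negbTE.
  by rewrite heat_parity ?heat_ge0//= on px.
have [on|on] := boolP (odd n); first by rewrite heat_parity ?heat_ge0//= on (negPf px).
by rewrite -(odd_double_half n) (negPf on) add0n -addnn heat_double_le.
Qed.

End HeatKernel.

(** * Truncated Green function *)

(** Adaptedness, stated without sigma-algebras on functionals of whole trajectories; [walk s] is
    such a trajectory, constant after the last step of [s]. *)
Definition local_upto (V : Type) (m : nat) (F : (nat -> Z4) -> V) : Prop :=
  forall s s', (forall k, (k <= m)%N -> s k = s' k) -> F s = F s'.

Section GreenUpto.
Variable R : realType.
Implicit Types (x y z : Z4) (B : seq Z4) (f : Z4 -> R).
Local Notation heat := (@heat R).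

Lemma pathE_local n m (F : (nat -> Z4) -> R) : local_upto m F -> (m <= n)%N ->
  pathE n (fun s => F (walk s)) = pathE m (fun s => F (walk s)).
Proof.
move=> lF mn; rewrite -(subnKC mn) pathE_cat; apply: eq_pathE => s ss.
rewrite -[RHS](pathE_cst (n - m)); apply: eq_pathE => t _.
by apply: lF => k km; rewrite walk_catl// ss.
Qed.

(** Independence of the path up to time [a] and of the increments after it: cut the list of
    increments at [a]. *)
Lemma pathE_indep n a m (X F : (nat -> Z4) -> R) :
  local_upto a X -> local_upto m F -> (a + m <= n)%N ->
  pathE n (fun s => X (walk s) * F (fun k => walk s (a + k) - walk s a)) =
  pathE n (fun s => X (walk s)) * pathE m (fun s => F (walk s)).
Proof.
move=> lX lF amn; rewrite (pathE_local lX); last by lia.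
rewrite -(subnKC amn) -addnA pathE_cat -pathEZr; apply: eq_pathE => s ss.
rewrite -(@pathE_local (m + (n - (a + m))) m F)// ?leq_addr// -pathEZl.
apply: eq_pathE => t st; congr (_ * _).
  by apply: lX => k ka; rewrite walk_catl// ss.
congr F; apply/funext => k.
by rewrite -ss walk_catr walk_catl// walk_size addrC addKr.
Qed.

Lemma pathE_window n a m (F : (nat -> Z4) -> R) : local_upto m F -> (a + m <= n)%N ->
  pathE n (fun s => F (fun k => walk s (a + k) - walk s a)) = pathE m (fun s => F (walk s)).
Proof.
move=> lF amn; have := @pathE_indep n a m (fun=> 1) F (fun _ _ _ => erefl) lF amn.
by rewrite pathE_cst mul1r => <-; apply: eq_pathE => s _; rewrite mul1r.
Qed.

Definition green_upto (T : nat) x : R := \sum_(0 <= k < T) heat k x.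

Lemma green_upto_ge0 T x : 0 <= green_upto T x.
Proof. by apply: sumr_ge0 => k _; exact: heat_ge0. Qed.

Lemma green_uptoN T x : green_upto T (- x) = green_upto T x.
Proof. by apply: eq_bigr => k _; exact: heatN. Qed.

Lemma green_upto_ub T x : green_upto T x <= 4.
Proof.
have := @heat_sum_ub R T 0 (fun=> x); rewrite divr1 => /(le_trans _); apply.
by apply: ler_sum => k _; rewrite addn0.
Qed.

Lemma pathE_green T n x :
  pathE n (fun s => green_upto T (x + displacement s)) = \sum_(0 <= k < T) heat (k + n) x.
Proof.
by rewrite pathE_sum; apply: eq_bigr => k _; rewrite heatDr addnC.
Qed.

(** Replaces the law of the walk by its supremum times counting measure, which turns an expectation
    into a sum over the lattice where translation and convolution are available. *)
Lemma pathE_le_sum n f (L B : seq Z4) :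
  (forall B f, uniq B -> {subset L <= B} ->
    pathE n (fun s => f (displacement s)) = \sum_(x <- B) heat n x * f x) ->
  uniq B -> {subset L <= B} -> (forall x, 0 <= f x) ->
  pathE n (fun s => f (displacement s)) <= 4 / (n.+1 * n.+2)%:R * \sum_(x <- B) f x.
Proof.
move=> HL uB LB f0; rewrite (HL B)// mulr_sumr.
by apply: ler_sum => x _; rewrite ler_wpM2r// heat_ub.
Qed.

(** Once the law at time [n] is replaced by its supremum, the sum over the lattice convolves the two
    kernels into return probabilities at times from [t] on. *)
Lemma pathE_green_heat T n t :
  pathE n (fun s => green_upto T (displacement s) * heat t (displacement s)) <=
  4 / (n.+1 * n.+2)%:R * (4 / t.+1%:R).
Proof.
have [L _ HL] := heat_support R n; pose B := undup L.
have uB : uniq B by exact: undup_uniq.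
have LB : {subset L <= B} by move=> x; rewrite mem_undup.
have := @pathE_le_sum n (fun x => green_upto T x * heat t x) L B HL uB LB.
move=> /(_ (fun x => mulr_ge0 (green_upto_ge0 T x) (heat_ge0 R t x)))/le_trans; apply.
rewrite ler_wpM2l ?divr_ge0//; under eq_bigr do rewrite mulr_suml.
rewrite exchange_big; apply: le_trans (@heat_sum_ub R T t (fun=> 0)).
apply: ler_sum => k _; rewrite -[in leRHS](subrr 0).
by apply: le_trans (@heat_convolution_le R k t 0 0 _ uB); under [leRHS]eq_bigr do rewrite subr0.
Qed.

Definition harm (n : nat) : R := \sum_(0 <= k < n) k.+1%:R^-1.

Lemma harm_ge0 n : 0 <= harm n.
Proof. by apply: sumr_ge0 => k _; rewrite invr_ge0. Qed.

(** One of the two times is even; the bound is the one for the later time. *)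
Lemma heat_pair_lb u : (2 * (u.+2 * u.+3)%:R)^-1 <= heat u 0 + heat u.+1 0.
Proof.
have [ou|eu] := boolP (odd u).
  rewrite -[leLHS]add0r lerD ?heat_ge0//.
  have := heat_return_lb R u.+1./2; rewrite (_ : u.+1./2.*2 = u.+1)//; lia.
rewrite -[leLHS]addr0 lerD ?heat_ge0//.
have := heat_return_lb R u./2; rewrite (_ : u./2.*2 = u); last by lia.
apply: le_trans; rewrite lef_pV2 ?posrE ?mulr_gt0// ler_pM2l// ler_nat; nia.
Qed.

(** Times are paired to avoid parity, hence the even truncation. The pair bounds telescope, and
    [j + 2 <= T.*2] ensures that the truncation removes at most half of the resulting 1/(4(j+2)). *)
Lemma heat_sum_lb T j : (j + 2 <= T.*2)%N ->
  (8 * j.+2%:R)^-1 <= \sum_(0 <= k < T.*2) heat (k + j) 0.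
Proof.
move=> jT; rewrite sum_pairs.
pose u k : R := - (4 * (j + k.*2).+2%:R)^-1.
apply: (@le_trans _ _ (\sum_(0 <= k < T) (u k.+1 - u k))); last first.
  apply: ler_sum_nat => k _; rewrite addSn (addnC k.*2 j).
  apply: le_trans (heat_pair_lb _).
  rewrite /u (_ : (j + k.+1.*2).+2 = (j + k.*2).+4); last by lia.
  rewrite opprK; move: (j + k.*2)%N => a.
  rewrite natrM -[a.+4]addn4 -[a.+3]addn3 -[a.+2]addn2 !natrD.
  have a0 : 0 <= a%:R :> R by [].
  move: (a%:R : R) a0 => A A0.
  have -> : - (4 * (A + 4))^-1 + (4 * (A + 2))^-1 = (2 * ((A + 2) * (A + 4)))^-1 by field; lra.
  by rewrite lef_pV2 ?posrE; nra.
rewrite telescope_sumr// /u double0 addn0 opprK addrC.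
have j0 : 0 < j.+2%:R :> R by [].
have : 2 * j.+2%:R <= (j + T.*2).+2%:R :> R by rewrite -natrM ler_nat; lia.
move: (j.+2%:R : R) ((j + T.*2).+2%:R : R) j0 => A D A0 AD.
have -> : (8 * A)^-1 = (4 * A)^-1 - (4 * (2 * A))^-1 by field; lra.
rewrite lerD2l lerN2 lef_pV2 ?posrE; lra.
Qed.

End GreenUpto.

(** * Variance of the Green function along the walk *)

Section Variance.
Variable R : realType.
Local Notation heat := (@heat R).
Local Notation green := (@green_upto R).
Implicit Types T j k h : nat.

Definition green_mean T j : R := \sum_(0 <= k < T) heat (k + j) 0.

(** This is E[G_T(S_j) G_T(S_{j+M})] after averaging over the last [M] steps. *)
Definition green_corr T j M : R :=
  pathE j (fun s => green T (displacement s) * \sum_(0 <= t < T) heat (t + M) (displacement s)).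

Lemma green_meanE T j h : (j <= h)%N -> pathE h (fun s => green T (walk s j)) = green_mean T j.
Proof.
move=> jh; rewrite (pathE_walk (green T) jh) /green_mean -pathE_green; apply: eq_pathE => s _.
by rewrite add0r.
Qed.

Lemma green_mean_ge0 T j : 0 <= green_mean T j.
Proof. by apply: sumr_ge0 => k _; exact: heat_ge0. Qed.

Lemma green_mean_ub T j : green_mean T j <= 4 / j.+1%:R.
Proof. exact: heat_sum_ub. Qed.

Lemma green_corrE T j k h : (j <= k <= h)%N ->
  pathE h (fun s => green T (walk s j) * green T (walk s k)) = green_corr T j (k - j).
Proof.
move=> /andP[jk kh].
rewrite (@pathE_local _ h k (fun s => green T (s j) * green T (s k)))//; last first.
  by move=> s s' ss'; rewrite !ss'.
rewrite /green_corr -{1}(subnKC jk) pathE_cat; apply: eq_pathE => s ss.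
rewrite -pathE_green -pathEZl; apply: eq_pathE => t st.
rewrite walk_catl ?ss// -ss walk_size; congr (_ * green _ _).
have -> : k = (size s + size t)%N by rewrite ss st subnKC.
by rewrite walk_catr walk_size.
Qed.

(** The interval [a, a+T) lies in [a, b+T). For a heat kernel it says that delaying a Green function
    from [a] to [b] loses at most the terms in [a, b). *)
Lemma heat_window_le (f : nat -> R) (a b T : nat) : (a <= b)%N -> (forall t, 0 <= f t) ->
  \sum_(0 <= t < T) f (t + a)%N <= \sum_(a <= t < b) f t + \sum_(0 <= t < T) f (t + b)%N.
Proof.
move=> ab f0.
have sh c : \sum_(0 <= t < T) f (t + c)%N = \sum_(c <= t < T + c) f t.
  by rewrite -{2}(add0n c) big_addn addnK.
rewrite !sh.
have [Tb|Tb] := leqP (T + a) b.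
  rewrite [X in _ <= X + _](big_cat_nat (leq_addl T a) Tb)/= -addrA lerDl addr_ge0// sumr_ge0//.
rewrite (big_cat_nat ab (ltnW Tb))/= lerD2l [leRHS](@big_cat_nat _ _ _ (T + a))/=.
- by rewrite lerDl sumr_ge0.
- exact: ltnW.
- by rewrite leq_add2l.
Qed.

(* Parity and Cauchy-Schwarz give [sup_x G^(M)(x) <= G^(M-1)(0)], which lets the
   product of the means cancel the main term of the correlation. *)
Lemma green_corr_far T j M : (0 < M)%N ->
  green_corr T j M - green_mean T j * green_mean T (M + j) <= 16 / (M * (M + j).+1)%:R.
Proof.
case: M => // M _.
have E : \sum_(M <= t < M.+1 + j) heat t 0 <= 4 * (M.+1%:R^-1 - (M.+1 + j).+1%:R^-1).
  apply: (@le_trans _ _ (\sum_(M <= t < M.+1 + j) ((- 4 / t.+2%:R) - (- 4 / t.+1%:R)))).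
    apply: ler_sum_nat => t _; apply: le_trans (heat_ub _ _ _) _.
    rewrite le_eqVlt; apply/orP; left; apply/eqP; rewrite natrM; field.
    by rewrite -!natrD nat1r !pnatr_eq0.
  rewrite (telescope_sumr (fun t => - 4 / t.+1%:R)); last by lia.
  by rewrite !mulNr opprK mulrBr addrC.
(* By [heat_le_return] the left side is at most the sum of the return probabilities at times M, ...,
   M+T; what is not in [green_mean] lies at times M, ..., M+j and is controlled by [E]. *)
have H x : \sum_(0 <= t < T) heat (t + M.+1) x <=
    green_mean T (M.+1 + j) + 4 * (M.+1%:R^-1 - (M.+1 + j).+1%:R^-1).
  apply: le_trans (lerD (lexx _) E).
  apply: (@le_trans _ _ (\sum_(0 <= t < T.+1) heat (t + M) 0)).
    have [hx|hx] := heat_le_return R x.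
      rewrite big_nat_recl// -[leLHS]add0r lerD ?heat_ge0//.
      by apply: ler_sum => t _; rewrite addSnnS.
    rewrite big_nat_recr//= -[leLHS]addr0 lerD ?heat_ge0//.
    by apply: ler_sum => t _; rewrite addnS.
  rewrite addrC.
  have -> : \sum_(0 <= t < T.+1) heat (t + M) 0 = \sum_(M <= t < T + M.+1) heat t 0.
    by rewrite -{2}(add0n M) big_addn addnS -addSn addnK.
  have -> : green_mean T (M.+1 + j) = \sum_(M.+1 + j <= t < T + (M.+1 + j)) heat t 0.
    by rewrite -[in RHS](add0n (M.+1 + j)%N) big_addn addnK.
  rewrite -big_cat_nat ?leq_addl//=; last by lia.
  rewrite [leRHS](@big_cat_nat _ _ _ (T + M.+1))/= ?lerDl ?sumr_ge0//; try lia.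
  by move=> t _; exact: heat_ge0.
rewrite /green_corr.
apply: (@le_trans _ _ (green_mean T j * (4 * (M.+1%:R^-1 - (M.+1 + j).+1%:R^-1)))).
  rewrite lerBlDr -mulrDr -(@green_meanE T j j)// -pathEZr; apply: ler_pathE => s ss.
  have -> : walk s j = displacement s by rewrite -ss walk_size.
  by rewrite ler_wpM2l ?green_upto_ge0// addrC.
apply: le_trans (ler_wpM2r _ (green_mean_ub T j)) _.
  by rewrite mulr_ge0// subr_ge0 lef_pV2 ?posrE ?ltr0n// ler_nat; lia.
rewrite le_eqVlt; apply/orP; left; apply/eqP.
rewrite natrM -[(_ + j).+1]addnS natrD; field.
by rewrite !nat1r -natrD !pnatr_eq0.
Qed.

Lemma green_corr_ge0 T j M : 0 <= green_corr T j M.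
Proof.
apply: pathE_ge0 => s _; rewrite mulr_ge0 ?green_upto_ge0//.
by apply: sumr_ge0 => t _; exact: heat_ge0.
Qed.

(** Exchanging the sums counts the heat kernel at time t < j with weight t+1, which cancels the
    1/(t+1) of [pathE_green_heat]; the remaining times contribute j copies of a tail of order 1/j.
    Each part is at most 16/(j+1). *)
Lemma green_corr_near T j : \sum_(0 <= M < j) green_corr T j M <= 32 / j.+1%:R.
Proof.
have key (f : nat -> R) : (forall t, 0 <= f t) ->
    \sum_(0 <= M < j) \sum_(0 <= t < T) f (t + M)%N <=
    \sum_(0 <= t < j) t.+1%:R * f t + j%:R * \sum_(0 <= t < T) f (t + j)%N.
  move=> f0; apply: (@le_trans _ _ (\sum_(0 <= M < j)
      (\sum_(M <= t < j) f t + \sum_(0 <= t < T) f (t + j)%N))).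
    by apply: ler_sum_nat => M /andP[_ Mj]; apply: heat_window_le => //; exact: ltnW.
  rewrite big_split/= sumr_const_nat subn0 -[X in _ + X]mulr_natl lerD2r.
  have e k : (k <= j)%N -> \sum_(0 <= M < k) \sum_(M <= t < k) f t = \sum_(0 <= t < k) t.+1%:R * f t.
    elim: k => [|k IH] kj; first by rewrite !big_nil.
    rewrite [RHS]big_nat_recr//= -(IH (ltnW kj)) big_nat_recr//= big_nat1.
    under eq_big_nat => M /andP[_ Mk] do rewrite big_nat_recr ?(ltnW Mk)//=.
    rewrite big_split/= sumr_const_nat subn0 -addrA; congr (_ + _).
    by rewrite mulr_natl mulrSr.
  by rewrite e.
rewrite /green_corr -pathE_sum.
apply: (@le_trans _ _ (pathE j (fun s => \sum_(0 <= t < j)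
    t.+1%:R * (green T (displacement s) * heat t (displacement s)) +
    j%:R * (4 / j.+1%:R) * green T (displacement s)))).
  apply: ler_pathE => s _; rewrite -mulr_sumr.
  under [X in _ <= X + _]eq_bigr do rewrite mulrCA.
  rewrite -mulr_sumr [X in _ <= _ + X]mulrC -mulrDr ler_wpM2l ?green_upto_ge0//.
  apply: le_trans (key _ (fun t => heat_ge0 R t _)) _.
  by rewrite lerD2l ler_wpM2l//; exact: heat_sum_ub.
rewrite pathED pathE_sum pathEZl.
have -> : pathE j (fun s => green T (displacement s)) = green_mean T j.
  by rewrite -(@green_meanE T j j)//; apply: eq_pathE => s <-; rewrite walk_size.
have j0 : 0 < j.+1%:R :> R by [].
apply: (@le_trans _ _ (\sum_(0 <= t < j) (4 / (j.+1 * j.+2)%:R * 4) +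
   j%:R * (4 / j.+1%:R) * (4 / j.+1%:R))).
  apply: lerD; last first.
    by rewrite ler_wpM2l ?green_mean_ub// !mulr_ge0// divr_ge0.
  apply: ler_sum => t _; rewrite pathEZl.
  apply: le_trans (ler_wpM2l _ (@pathE_green_heat R T j t)) _ => //.
  by rewrite mulrCA [t.+1%:R * _]mulrC divfK ?pnatr_eq0.
rewrite sumr_const_nat subn0 -[X in X + _]mulr_natl natrM.
have : 0 <= j%:R :> R by [].
rewrite -[j.+2]addn2 -[j.+1]addn1 !natrD; move: (j%:R : R) => A A0.
have -> : 32 / (A + 1) = 16 / (A + 1) + 16 / (A + 1) by field; lra.
rewrite lerD// ler_pdivlMr; try lra.
  have -> : A * (4 / ((A + 1) * (A + 2)) * 4) * (A + 1) = 16 * A / (A + 2) by field; lra.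
  by rewrite ler_pdivrMr; lra.
have -> : A * (4 / (A + 1)) * (4 / (A + 1)) * (A + 1) = 16 * A / (A + 1) by field; lra.
by rewrite ler_pdivrMr; lra.
Qed.

Lemma ler_sum_window (f : nat -> R) (h a b : nat) : (a <= b)%N -> (forall k, 0 <= f k) ->
  (forall k, ~~ (a <= k < b)%N -> f k = 0) ->
  \sum_(1 <= k < h) f k <= \sum_(a <= k < b) f k.
Proof.
move=> ab f0 fz.
have -> : \sum_(a <= k < b) f k = \sum_(0 <= k < h + b) f k.
  rewrite [RHS](@big_cat_nat _ _ _ a)//=; last exact: leq_trans ab (leq_addl _ _).
  rewrite [X in _ + X](@big_cat_nat _ _ _ b a)//= ?leq_addl//.
  rewrite [X in _ = X + _]big_nat_cond [X in _ = X + _]big1 ?add0r => [|k /andP[/andP[_ ka] _]];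
    last first.
    by apply: fz; rewrite negb_and -ltnNge ka.
  rewrite [X in _ = _ + X]big_nat_cond [X in _ = _ + X]big1 ?addr0// => k /andP[/andP[bk _] _].
  by apply: fz; rewrite negb_and -leqNgt bk orbT.
case: h => [|h]; first by rewrite big_geq// sumr_ge0.
rewrite (@big_cat_nat _ _ _ h.+1 0 (h.+1 + b))//= ?leq_addr//.
by rewrite [X in X + _]big_nat_recl//= big_add1/= -addrA addrCA lerDl addr_ge0// sumr_ge0.
Qed.

Definition green_total T h (s : nat -> Z4) : R := \sum_(1 <= j < h.+1) green T (s j).

Definition green_total_mean T h : R := \sum_(1 <= j < h.+1) green_mean T j.

Lemma green_total_meanE T h :
  pathE h (fun s => green_total T h (walk s)) = green_total_mean T h.
Proof.
rewrite pathE_sum; apply: eq_big_nat => j /andP[_ jh].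
by rewrite (@green_meanE T j h).
Qed.

(** Bounds for the covariance at times j <= k. For k < 2j the product of the means is dropped; for k
    >= 2j, k-j >= k/2 turns the 16/((k-j)(k+1)) of [green_corr_far] into 32/(k(k+1)), summable in
    k. *)
Let near T j k : R := if (j <= k < j.*2)%N then green_corr T j (k - j) else 0.
Let far j k : R := if (j.*2 <= k)%N then 32 / (k * k.+1)%:R else 0.

Lemma cov_le T h j k : (0 < j <= k)%N -> (k <= h)%N ->
  pathE h (fun s => green T (walk s j) * green T (walk s k)) - green_mean T j * green_mean T k
  <= near T j k + far j k.
Proof.
move=> /andP[j0 jk] kh; rewrite (@green_corrE T j k h) ?jk//.
rewrite /near /far jk /=.
case: (ltnP k j.*2) => kj; rewrite ?addr0 ?add0r.
  by rewrite gerBl mulr_ge0 ?green_mean_ge0.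
have /(green_corr_far T j) : (0 < k - j)%N by lia.
rewrite subnK// => /le_trans; apply; rewrite -[32]/(32%:R) -[16]/(16%:R).
have kj0 : (0 < k - j)%N by lia.
have k0 : (0 < k)%N by lia.
rewrite ler_pdivrMr ?ltr0n ?muln_gt0 ?kj0// mulrAC ler_pdivlMr ?ltr0n ?muln_gt0 ?k0//.
by rewrite -!natrM ler_nat; nia.
Qed.

Lemma near_ge0 T j k : 0 <= near T j k.
Proof. by rewrite /near; case: ifP => // _; exact: green_corr_ge0. Qed.

Lemma far_ge0 j k : 0 <= far j k.
Proof. by rewrite /far; case: ifP => // _; rewrite divr_ge0. Qed.

Lemma near_far_sum T j h : (0 < j)%N ->
  \sum_(1 <= k < h.+1) (near T j k + far j k) <= 48 / j%:R.
Proof.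
move=> j0; rewrite big_split/=.
have -> : 48 / j%:R = 32 / j%:R + 16 / j%:R :> R by rewrite -mulrDl; congr (_ / _); ring.
apply: lerD.
  apply: (@le_trans _ _ (32 / j.+1%:R)); last first.
    by rewrite ler_pM2l// lef_pV2 ?posrE ?ltr0n// ler_nat.
  apply: le_trans (green_corr_near T j).
  apply: le_trans (@ler_sum_window (near T j) h.+1 j j.*2 _ _ _) _.
  - by lia.
  - exact: near_ge0.
  - by move=> k /negPf; rewrite /near => ->.
  rewrite -{1}(add0n j) big_addn -addnn addnK; apply: ler_sum_nat => k kj.
  by rewrite /near addnK ifT//; lia.
pose f k := if (k < j.*2 + h.+1)%N then far j k else 0.
have -> : \sum_(1 <= k < h.+1) far j k = \sum_(1 <= k < h.+1) f k.
  by apply: eq_big_nat => k /andP[_ kh]; rewrite /f ifT//; lia.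
apply: le_trans (@ler_sum_window f h.+1 j.*2 (j.*2 + h.+1) _ _ _) _.
- exact: leq_addr.
- by move=> k; rewrite /f; case: ifP => // _; exact: far_ge0.
- move=> k; rewrite negb_and -ltnNge /f /far => /orP[kj|/negPf -> //].
  by rewrite (leqNgt _ k) kj; case: ifP.
apply: (@le_trans _ _ (\sum_(j.*2 <= k < j.*2 + h.+1) (- 32 / k.+1%:R - (- 32 / k%:R)))).
  apply: ler_sum_nat => k /andP[jk kh]; rewrite /f kh /far jk.
  have k0 : k%:R != 0 :> R by rewrite pnatr_eq0; lia.
  rewrite le_eqVlt; apply/orP; left; apply/eqP; rewrite natrM; field.
  by rewrite k0 nat1r pnatr_eq0.
rewrite (telescope_sumr (fun k => - 32 / k%:R)) ?leq_addr//.
rewrite !mulNr opprK -muln2 natrM.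
have -> : 32 / (j%:R * 2) = 16 / j%:R :> R by field; rewrite pnatr_eq0 -lt0n.
by rewrite gerDr oppr_le0 divr_ge0.
Qed.

(** Time j has covariance at most 48/j with all later times together, and each pair is counted in
    both orders. The variance is thus of the order of the mean, not of its square. *)
Lemma green_variance T h :
  pathE h (fun s => (green_total T h (walk s) - green_total_mean T h) ^+ 2) <= 96 * harm R h.
Proof.
set mu := green_total_mean T h.
have -> : pathE h (fun s => (green_total T h (walk s) - mu) ^+ 2) =
    pathE h (fun s => green_total T h (walk s) ^+ 2) - mu ^+ 2.
  rewrite (_ : (fun s => (green_total T h (walk s) - mu) ^+ 2) =
     (fun s => green_total T h (walk s) ^+ 2 + (- 2 * mu) * green_total T h (walk s) + mu ^+ 2)).
    by rewrite !pathED pathE_cst pathEZl green_total_meanE -/mu; ring.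
  by apply/funext => s; ring.
pose b j k := near T j k + far j k.
have b0 j k : 0 <= b j k by rewrite addr_ge0 ?near_ge0 ?far_ge0.
have cov j k : (0 < j <= h)%N -> (0 < k <= h)%N ->
    pathE h (fun s => green T (walk s j) * green T (walk s k)) - green_mean T j * green_mean T k
    <= b j k + b k j.
  move=> /andP[j0 jh] /andP[k0 kh]; have [jk|/ltnW kj] := leqP j k.
    by apply: le_trans (@cov_le T h j k _ kh) _; rewrite ?j0// lerDl.
  under eq_pathE do rewrite mulrC.
  by rewrite mulrC; apply: le_trans (@cov_le T h k j _ jh) _; rewrite ?k0// lerDr.
have sqr (f : nat -> R) : (\sum_(1 <= j < h.+1) f j) ^+ 2 =
    \sum_(1 <= j < h.+1) \sum_(1 <= k < h.+1) f j * f k.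
  by rewrite expr2 mulr_suml; apply: eq_bigr => j _; rewrite mulr_sumr.
under eq_pathE do rewrite sqr.
rewrite sqr pathE_sum -sumrB.
under eq_bigr do rewrite pathE_sum -sumrB.
apply: (@le_trans _ _ (\sum_(1 <= j < h.+1) \sum_(1 <= k < h.+1) (b j k + b k j))).
  by apply: ler_sum_nat => j jh; apply: ler_sum_nat => k kh; apply: cov.
under eq_bigr do rewrite big_split/=.
rewrite big_split/= [X in _ + X]exchange_big/= -mulr2n -[leLHS]mulr_natl.
apply: (@le_trans _ _ (2 * \sum_(1 <= j < h.+1) 48 / j%:R)).
  by rewrite ler_wpM2l//; apply: ler_sum_nat => j /andP[j0 _]; exact: near_far_sum.
by rewrite -mulr_sumr mulrA -natrM big_add1 /harm.
Qed.

End Variance.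

(** * The mean local escape probability *)

Section EscapeMean.
Variable R : realType.
Local Notation green := (@green_upto R).
(** Abstract local escape probability, known only through its range [0,1], its dependence on the
    increments in the window and the last-exit inequality; the path estimates therefore do not
    mention the auxiliary walk that defines it. *)
Variable esc : nat -> (nat -> Z4) -> nat -> R.
Hypothesis esc_ge0 : forall r s i, 0 <= esc r s i.
Hypothesis esc_le1 : forall r s i, esc r s i <= 1.
Hypothesis esc_shift : forall r s s' z a,
  (forall k, (k <= r.*2)%N -> s (a + k)%N = z + s' k) -> esc r s (a + r) = esc r s' r.
Hypothesis esc_last_exit : forall r s c N T x, (N <= r <= c)%N ->
  \sum_(1 <= i < N.+1) esc r s (c + i) * green T (x - s (c + i)%N) <= 1.

Definition escape_mean r : R := pathE r.*2 (fun s => esc r (walk s) r).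

Lemma esc_local r : local_upto r.*2 (fun s => esc r s r).
Proof.
move=> s s' ss'; rewrite -{1}(add0n r).
by apply: (@esc_shift r s s' 0 0) => k kr; rewrite add0r ss'.
Qed.

Lemma esc_window r s a : esc r s (a + r) = esc r (fun k => s (a + k)%N - s a) r.
Proof. by apply: (@esc_shift r s _ (s a)) => k _; rewrite addrC subrK. Qed.

Lemma escape_mean_ge0 r : 0 <= escape_mean r.
Proof. exact: pathE_ge0. Qed.

Lemma escape_mean_le1 r : escape_mean r <= 1.
Proof. by rewrite -(@pathE_cst R r.*2 1); apply: ler_pathE. Qed.

Let fwd T r h (s : nat -> Z4) : R := \sum_(1 <= j < h.+1) green T (s (r + j)%N - s r).

(* The last-exit inequality on a window of length [r], averaged over the starting
   point in the window; stationarity of the increments recentres every term. *)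
Lemma escape_green_mean T r h : (h.*2 <= r)%N ->
  h%:R * pathE r.*2 (fun s => esc r (walk s) r * fwd T r h (walk s)) <= r%:R.
Proof.
move=> hr.
have Floc : local_upto r.*2 (fun s => esc r s r * fwd T r h s).
  move=> s s' ss'; rewrite (esc_local ss'); congr (_ * _).
  by apply: eq_big_nat => j jh; rewrite !ss'//; lia.
have -> : h%:R * pathE r.*2 (fun s => esc r (walk s) r * fwd T r h (walk s)) =
    pathE (3 * r) (fun s => \sum_(1 <= i < h.+1)
      esc r (walk s) (r + i) * fwd T (r + i) h (walk s)).
  rewrite pathE_sum mulr_natl -[X in _ *+ X](subn0) -sumr_const_nat big_add1.
  apply: eq_big_nat => i /andP[_ ih].
  rewrite -(@pathE_window R (3 * r) i.+1 r.*2 (fun s => esc r s r * fwd T r h s) Floc); last by lia.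
  apply: eq_pathE => s _; rewrite [(r + _)%N]addnC esc_window; congr (_ * _).
  apply: eq_bigr => j _; congr (green _ _).
  by rewrite opprB addrA subrK addnA.
apply: (@le_trans _ _ (pathE (3 * r) (fun s => \sum_(1 <= k < r.+1) 1))); last first.
  by rewrite pathE_cst sumr_const_nat subSS subn0.
apply: ler_pathE => s _; set w := walk s.
apply: (@le_trans _ _ (\sum_(1 <= k < r.+1) \sum_(1 <= i < r.+1)
    esc r w (r + i) * green T (w (r + k)%N - w (r + i)%N))); last first.
  by apply: ler_sum => k _; apply: esc_last_exit; rewrite leqnn.
rewrite exchange_big/=.
rewrite [leRHS](@big_cat_nat _ _ _ h.+1)//=; last by lia.
rewrite -[leLHS]addr0; apply: lerD; last first.
  by apply: sumr_ge0 => i _; apply: sumr_ge0 => j _; rewrite mulr_ge0// green_upto_ge0.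
apply: ler_sum_nat => i ih; rewrite -mulr_sumr ler_wpM2l//.
(* Of the points [k] only those with i < k <= i+h are kept; they lie in the window because i <= h
   and 2h <= r. *)
rewrite [leRHS](@big_cat_nat _ _ _ i.+1)//=; last by lia.
rewrite [X in _ <= _ + X](@big_cat_nat _ _ _ (i + h).+1)//=; [|lia|lia].
rewrite -[leLHS]add0r; apply: lerD; first by apply: sumr_ge0 => j _; exact: green_upto_ge0.
rewrite -[leLHS]addr0; apply: lerD; last by apply: sumr_ge0 => j _; exact: green_upto_ge0.
rewrite /fwd [leRHS](_ : _ = \sum_(1 <= j < h.+1) green T (w (r + i + j)%N - w (r + i)%N))//.
rewrite -[X in \sum_(X <= _ < _) _]add1n big_addn subSn ?leq_addr// addKn.
by apply: eq_bigr => j _; rewrite addnAC -addnA.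
Qed.

(** The 24 comes from 8(j+2) <= 24j for j >= 1. *)
Lemma green_total_mean_lb T h : (h + 2 <= T.*2)%N ->
  harm R h / 24 <= green_total_mean R T.*2 h.
Proof.
move=> hT; rewrite /harm /green_total_mean big_add1/= mulr_suml.
apply: ler_sum_nat => j /andP[_ jh].
apply: le_trans (@heat_sum_lb R T j.+1 _); last by lia.
by rewrite -invfM lef_pV2 ?posrE ?mulr_gt0// -!natrM ler_nat; lia.
Qed.

(** With mu >= H/24, the terms (2/mu) * 3 and (4/mu^2) * 96 H of [escape_mean_ub] are at most 144/H
    and 4 * 24^2 * 96/H. *)
Definition escape_const : R := 144 + 4 * 24 ^+ 2 * 96.

Lemma escape_mean_ub r : (2 <= r)%N -> escape_mean r <= escape_const / harm R r./2.
Proof.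
(* [h] is the largest length allowed in [escape_green_mean]; [T] is even and long enough for
   [green_total_mean_lb]. *)
move=> r2; pose h := r./2; pose T := h.+2.*2.
have h0 : (0 < h)%N by rewrite /h; lia.
pose mu := green_total_mean R T h; pose H := harm R h.
have H0 : 0 < H.
  rewrite /H /harm (bigD1_seq 0%N) ?iota_uniq//= ?mem_index_iota//.
  by rewrite ltr_pwDl// sumr_ge0.
have muH : H / 24 <= mu by apply: green_total_mean_lb; lia.
have mu0 : 0 < mu by apply: lt_le_trans muH; rewrite divr_gt0.
pose D s := fwd T r h (walk s).
have loc : local_upto h (@green_total R T h).
  by move=> s s' ss'; apply: eq_big_nat => j jh; rewrite ss'//; lia.
have var : pathE r.*2 (fun s => (D s - mu) ^+ 2) <= 96 * H.
  apply: le_trans (green_variance R T h).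
  have loc2 : local_upto h (fun s => (green_total R T h s - mu) ^+ 2).
    by move=> s s' ss'; rewrite (loc _ _ ss').
  by rewrite -(@pathE_window R r.*2 r h _ loc2)//; lia.
(* The 3 bounds r/h, since r <= 2h+1 and h >= 1. *)
have gD : pathE r.*2 (fun s => esc r (walk s) r * D s) <= 3.
  have := @escape_green_mean T r h ltac:(lia); set e := pathE _ _ => he.
  have hp : 0 < h%:R :> R by rewrite ltr0n.
  rewrite -(ler_pM2l hp) (le_trans he)// -natrM ler_nat; lia.
apply: (@le_trans _ _ (2 / mu * 3 + 4 / mu ^+ 2 * (96 * H))).
  apply: (@le_trans _ _ (pathE r.*2 (fun s => 2 / mu * (esc r (walk s) r * D s) +
      4 / mu ^+ 2 * (D s - mu) ^+ 2))); last first.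
    rewrite pathED !pathEZl; apply: lerD; rewrite ler_wpM2l//.
      by rewrite divr_ge0// ltW.
    by rewrite divr_ge0// sqr_ge0.
  (* [D s >= mu / 2] makes the first term at least [esc]; otherwise the second
     term is at least [1]. *)
  apply: ler_pathE => s _.
  have D0 : 0 <= D s by apply: sumr_ge0 => j _; exact: green_upto_ge0.
  have := esc_ge0 r (walk s) r; have := esc_le1 r (walk s) r.
  move: (esc _ _ _) (D s) D0 => g d d0 g1 g0.
  have -> : 2 / mu * (g * d) + 4 / mu ^+ 2 * (d - mu) ^+ 2 =
     g * (2 * (d / mu)) + 4 * (d / mu - 1) ^+ 2 by field; lra.
  have : 0 <= d / mu by rewrite divr_ge0// ltW.
  move: (d / mu) => q q0; have [hq|hq] := lerP 1 (2 * q).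
    by rewrite -[leLHS]mulr1 -[leLHS]addr0 lerD// ?ler_wpM2l// mulr_ge0// sqr_ge0.
  have : 0 <= g * (2 * q) by rewrite !mulr_ge0.
  have : 0 <= (1 - 2 * q) * (3 - 2 * q) by rewrite mulr_ge0//; lra.
  by move=> h1 h2; lra.
rewrite /escape_const [leRHS]mulrDl -/h -/H.
have i1 : mu^-1 <= 24 / H by rewrite -invf_div lef_pV2 ?posrE ?divr_gt0.
have i0 : 0 <= mu^-1 by rewrite invr_ge0 ltW.
apply: lerD; first by lra.
rewrite -exprVn [leRHS](_ : _ = 4 * (24 / H) ^+ 2 * (96 * H)); last by field; lra.
rewrite ler_pM2r ?mulr_gt0// ler_pM2l//.
by rewrite ler_pXn2r// nnegrE (le_trans i0).
Qed.

End EscapeMean.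

(** * Second moment of the fluctuations *)

(** The deficit is half the sum of w_i w_j (x_i - x_j)^2 over all pairs. *)
Lemma sqr_sum_weighted (R : realType) (I : Type) (r : seq I) (w x : I -> R) :
  (forall i, 0 <= w i) ->
  (\sum_(i <- r) w i * x i) ^+ 2 <= (\sum_(i <- r) w i) * (\sum_(i <- r) w i * x i ^+ 2).
Proof.
move=> w0; set W := \sum_(i <- r) w i; set X := \sum_(i <- r) w i * x i.
set Y := \sum_(i <- r) _.
suff : 0 <= 2 * (W * Y - X ^+ 2) by rewrite pmulr_rge0// subr_ge0.
have -> : 2 * (W * Y - X ^+ 2) =
    \sum_(i <- r) \sum_(j <- r) w i * w j * (x i - x j) ^+ 2.
  transitivity (\sum_(i <- r) (w i * x i ^+ 2 * W - 2 * (w i * x i * X) + w i * Y)).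
    rewrite big_split sumrB/= -!mulr_suml -mulr_sumr -mulr_suml -/W -/X -/Y; ring.
  apply: eq_bigr => i _; rewrite /W /X /Y !mulr_sumr -sumrB -big_split/=.
  by apply: eq_bigr => j _; ring.
by apply: sumr_ge0 => i _; apply: sumr_ge0 => j _; rewrite mulr_ge0 ?sqr_ge0 ?mulr_ge0.
Qed.

Lemma sum_sym_le (R : realType) (a b : nat) (f : nat -> nat -> R) :
  (forall i j, 0 <= f i j) -> (forall i j, f i j = f j i) ->
  \sum_(a <= i < b) \sum_(a <= j < b) f i j <=
  2 * \sum_(a <= i < b) \sum_(a <= j < b) (if (i <= j)%N then f i j else 0).
Proof.
move=> f0 fs; pose h i j := if (i <= j)%N then f i j else 0.
apply: (@le_trans _ _ (\sum_(a <= i < b) \sum_(a <= j < b) (h i j + h j i))).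
  apply: ler_sum => i _; apply: ler_sum => j _; rewrite /h (fs j i).
  by case: ltngtP => _; rewrite ?addr0 ?add0r// lerDl.
under eq_bigr do rewrite big_split/=.
by rewrite big_split/= [X in _ + X]exchange_big/= -mulr2n -[leLHS]mulr_natl.
Qed.

Section SecondMoment.
Variable R : realType.
Local Notation heat := (@heat R).
Local Notation green := (@green_upto R).
Local Notation harm := (harm R).

Lemma pathE_greenB T l x :
  pathE l (fun t => green T (x - displacement t)) = \sum_(0 <= k < T) heat (k + l) x.
Proof. by rewrite pathE_sum; apply: eq_bigr => k _; rewrite -heatD addnC. Qed.

(** By symmetry the difference of two independent walks at times [i] and [l] has the law of one walk
    at time [i + l]. *)
Lemma pathE_green_walks T n m i l : (i <= n)%N -> (l <= m)%N ->
  pathE n (fun s => pathE m (fun t => green T (walk s i - walk t l))) =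
  green_mean R T (i + l).
Proof.
move=> i_n lm.
under eq_pathE => s _ do rewrite (pathE_walk (fun z => green T (walk s i - z)) lm) pathE_greenB.
rewrite pathE_sum; apply: eq_bigr => k _.
rewrite (pathE_walk (fun z => heat (k + l) z) i_n).
have -> : (k + (i + l) = i + (k + l))%N by lia.
by rewrite -heatDr; apply: eq_pathE => s _; rewrite add0r.
Qed.

(** Given the walk up to time [l], averaging the second factor over the next l'-l steps leaves a
    tail of the Green function, bounded uniformly in the current point. *)
Lemma pathE_greenM_le T m l l' x : (l <= l' <= m)%N ->
  pathE m (fun t => green T (x - walk t l) * green T (x - walk t l')) <=
  4 / (l' - l).+1%:R * pathE m (fun t => green T (x - walk t l)).
Proof.
move=> /andP[ll lm].
rewrite (@pathE_local _ m l' (fun s => green T (x - s l) * green T (x - s l')))//; last first.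
  by move=> s s' ss'; rewrite !ss'.
rewrite (pathE_walk (fun z => green T (x - z)) (leq_trans ll lm)) -pathEZl.
rewrite -{1}(subnKC ll) pathE_cat; apply: ler_pathE => t st.
apply: (@le_trans _ _ (green T (x - displacement t) *
    pathE (l' - l) (fun u => green T (x - displacement t - displacement u)))).
  rewrite -pathEZl; apply: ler_pathE => u su.
  rewrite walk_catl ?st// -{1}st walk_size.
  have -> : l' = (size t + size u)%N by rewrite st su subnKC.
  by rewrite walk_catr walk_size opprD addrA.
by rewrite pathE_greenB mulrC ler_wpM2r ?green_upto_ge0// heat_sum_ub.
Qed.

Definition potential T m (c : nat -> R) (y : nat -> Z4) (x : Z4) : R :=
  \sum_(1 <= l < m.+1) c l * green T (x - y l).

Lemma potential_ge0 T m c y x : (forall l, 0 <= c l) -> 0 <= potential T m c y x.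
Proof. by move=> c0; apply: sumr_ge0 => l _; rewrite mulr_ge0// green_upto_ge0. Qed.

Lemma sum_inv_dist m l : (0 < l)%N ->
  \sum_(1 <= l' < m.+1) (if (l <= l')%N then (l' - l).+1%:R^-1 else 0) <= harm m.
Proof.
move=> l0; pose f k : R := if (l <= k < m.+1)%N then (k - l).+1%:R^-1 else 0.
have -> : \sum_(1 <= k < m.+1) (if (l <= k)%N then (k - l).+1%:R^-1 else 0) =
    \sum_(1 <= k < m.+1) f k.
  by apply: eq_big_nat => k /andP[_ km]; rewrite /f km andbT.
apply: le_trans (@ler_sum_window R f m.+1 l (m + l) _ _ _) _.
- exact: leq_addl.
- by move=> k; rewrite /f; case: ifP => // _; rewrite invr_ge0.
- by move=> k; rewrite /f; case: ifP => //; lia.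
rewrite -{1}(add0n l) big_addn addnK; apply: ler_sum => k _.
by rewrite /f addnK; case: ifP => // _; rewrite invr_ge0.
Qed.

(** The coefficients may depend on the whole second path, so they are bounded by 1 before averaging.
    A pair l <= l' then contributes 4/(l'-l+1) * 4/(i+l+1), and the sum over l' gives the harmonic
    number. *)
Lemma potential_sqr_mean T n m i (c : seq Z4 -> nat -> R) : (i <= n)%N ->
  (forall t l, 0 <= c t l <= 1) ->
  pathE n (fun s => pathE m (fun t => potential T m (c t) (walk t) (walk s i) ^+ 2)) <=
  32 * harm m * \sum_(1 <= l < m.+1) (i + l).+1%:R^-1.
Proof.
move=> i_n c01.
pose f l l' := 16 / (l' - l).+1%:R / (i + l).+1%:R : R.
apply: (@le_trans _ _ (2 * \sum_(1 <= l < m.+1) \sum_(1 <= l' < m.+1)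
    (if (l <= l')%N then pathE n (fun s => pathE m (fun t =>
       green T (walk s i - walk t l) * green T (walk s i - walk t l'))) else 0))).
  apply: (@le_trans _ _ (pathE n (fun s => pathE m (fun t =>
      2 * \sum_(1 <= l < m.+1) \sum_(1 <= l' < m.+1) (if (l <= l')%N then
       green T (walk s i - walk t l) * green T (walk s i - walk t l') else 0))))).
    apply: ler_pathE => s _; apply: ler_pathE => t _.
    pose a l := green T (walk s i - walk t l).
    apply: le_trans (@sum_sym_le _ _ _ (fun l l' => a l * a l') _ _); last 2 first.
    - by move=> *; rewrite mulr_ge0// green_upto_ge0.
    - by move=> *; rewrite mulrC.
    under [leRHS]eq_bigr do rewrite -mulr_sumr.
    rewrite -mulr_suml -expr2 ler_pXn2r ?nnegrE ?potential_ge0 ?sumr_ge0//.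
    - apply: ler_sum => l _; rewrite -[leRHS]mul1r ler_wpM2r ?green_upto_ge0//.
      by have /andP[] := c01 t l.
    - by move=> l; have /andP[] := c01 t l.
    - by move=> l _; exact: green_upto_ge0.
  under eq_pathE do rewrite pathEZl pathE_sum.
  rewrite pathEZl pathE_sum ler_pM2l//; apply: ler_sum => l _.
  under eq_pathE do rewrite pathE_sum.
  rewrite pathE_sum; apply: ler_sum => l' _; case: ifP => // _.
  by under eq_pathE do rewrite pathE_cst; rewrite pathE_cst.
apply: (@le_trans _ _ (2 * \sum_(1 <= l < m.+1) \sum_(1 <= l' < m.+1)
    (4 * (4 / (i + l).+1%:R)) * (if (l <= l')%N then (l' - l).+1%:R^-1 else 0))).
  rewrite ler_pM2l//; apply: ler_sum_nat => l /andP[_ lm]; apply: ler_sum_nat => l' /andP[_ lm'].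
  case: ifP => ll; last by rewrite mulr0.
  apply: (@le_trans _ _ (4 / (l' - l).+1%:R * green_mean R T (i + l))).
    rewrite -(@pathE_green_walks T n m i l)// -pathEZl; apply: ler_pathE => s _.
    by apply: pathE_greenM_le; rewrite ll.
  rewrite [leRHS](_ : _ = 4 / (i + l).+1%:R * (4 / (l' - l).+1%:R)); last by ring.
  by rewrite mulrC ler_wpM2r ?divr_ge0// green_mean_ub.
under eq_bigr do rewrite -mulr_sumr.
rewrite [32 * _]mulrC -mulrA mulr_sumr.
rewrite mulr_sumr [leRHS]mulr_sumr; apply: ler_sum_nat => l /andP[l0 _].
rewrite [leRHS](_ : _ = 2 * (4 * (4 / (i + l).+1%:R) * harm m)); last by ring.
by rewrite ler_pM2l// ler_wpM2l ?sum_inv_dist// mulr_ge0// divr_ge0.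
Qed.

End SecondMoment.

(** * Dirichlet energy of a potential *)

Section Dirichlet.
Variable R : realType.
Local Notation heat := (@heat R).
Local Notation green := (@green_upto R).
Local Notation harm := (harm R).
Local Notation potential := (@potential R).

(** [B] contains the support of [F], so translating can only move mass out of [B]. *)
Lemma ler_sum_shift (F : Z4 -> R) (B : seq Z4) z : uniq B ->
  (forall x, 0 <= F x) -> (forall x, x \notin B -> F x = 0) ->
  \sum_(x <- B) F (x + z) <= \sum_(x <- B) F x.
Proof.
move=> uB F0 FB.
have -> : \sum_(x <- B) F (x + z) = \sum_(y <- [seq x + z | x <- B]) F y by rewrite big_map.
rewrite (bigID (mem B))/= [X in _ + X]big1 ?addr0 => [|y /FB//].
rewrite [leRHS](bigID (mem [seq x + z | x <- B]))/= -[leLHS]addr0 lerD ?sumr_ge0//.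
rewrite -[leLHS]big_filter -[leRHS]big_filter le_eqVlt; apply/orP; left.
apply/eqP/perm_big/uniq_perm; rewrite ?filter_uniq ?map_inj_uniq//.
  exact: addIr.
by move=> x; rewrite !mem_filter andbC.
Qed.

(* [(I - P^r) G_T = (I + ... + P^(r-1)) - (P^T + ... + P^(T+r-1))]. Dropping the
   second group bounds the mean Dirichlet energy of a potential by a sum of
   heat kernels, so that no gradient estimate is needed. *)
Lemma green_shift_le T r x :
  green T x - \sum_(0 <= k < T) heat (k + r) x <= \sum_(0 <= j < r) heat j x.
Proof.
rewrite lerBlDr.
have -> : green T x = \sum_(0 <= t < T) heat (t + 0) x.
  by apply: eq_bigr => t _; rewrite addn0.
exact: (heat_window_le T (leq0n r) (fun t => heat_ge0 R t x)).
Qed.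

Lemma potential_support T m : forall y c, exists L : seq Z4,
  forall x, x \notin L -> potential T m c y x = 0.
Proof.
have [L HL] : exists L : seq Z4, forall x, x \notin L -> green T x = 0.
  elim: T => [|T [L IH]]; first by exists [::] => x _; rewrite /green_upto big_geq.
  have [L' HL' _] := heat_support R T; exists (L ++ L') => x.
  rewrite mem_cat negb_or => /andP[xL xL'].
  by rewrite /green_upto big_nat_recr//= [X in X + _]IH// HL'// addr0.
move=> y c; exists (flatten [seq [seq x + y l | x <- L] | l <- iota 1 m]) => x xL.
rewrite /potential big_nat_cond big1// => l /andP[l1 _]; rewrite HL ?mulr0//.
apply: contra xL => xL; apply/flatten_mapP; exists l; first by rewrite mem_iota; lia.
by apply/mapP; exists (x - y l) => //; rewrite subrK.
Qed.

Lemma potential_increment_le T m n N r c y : (N + r <= n)%N -> (forall l, 0 <= c l <= 1) ->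
  pathE n (fun s => (potential T m c y (walk s (N + r)) - potential T m c y (walk s N)) ^+ 2) <=
  8 / (N.+1 * N.+2)%:R * \sum_(1 <= l < m.+1) \sum_(1 <= l' < m.+1)
     \sum_(0 <= j < r) \sum_(0 <= k < T) heat (k + j) (y l - y l').
Proof.
move=> Nrn c01; pose F := potential T m c y.
have c0 l : 0 <= c l by have /andP[] := c01 l.
have F0 x : 0 <= F x by exact: potential_ge0.
have [L1 HL1] := potential_support T m y c.
have [L2 _ HL2] := heat_support R N.
(* [L1] carries the potential, as the translation inequality requires; [L2] carries the law at time
   [N]. *)
pose B := undup (L1 ++ L2).
have uB : uniq B by exact: undup_uniq.
have FB x : x \notin B -> F x = 0.
  by move=> xB; apply: HL1; apply: contra xB; rewrite mem_undup mem_cat => ->.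
have LB : {subset L2 <= B} by move=> x; rewrite mem_undup mem_cat orbC => ->.
rewrite (@pathE_local _ n (N + r) (fun s => (F (s (N + r)%N) - F (s N)) ^+ 2))//; last first.
  by move=> s s' ss'; rewrite !ss' ?leq_addr.
apply: (@le_trans _ _ (pathE N (fun s => pathE r (fun t =>
    (F (displacement s + displacement t) - F (displacement s)) ^+ 2)))).
  rewrite pathE_cat; apply: ler_pathE => s ss; apply: ler_pathE => t st.
  by rewrite -ss -st walk_catr walk_size walk_catl// walk_size.
have := @pathE_le_sum R N (fun x => pathE r (fun t => (F (x + displacement t) - F x) ^+ 2)) L2 B HL2 uB LB.
move=> /(_ (fun x => pathE_ge0 (fun t _ => sqr_ge0 _)))/le_trans; apply.
have -> : 8 / (N.+1 * N.+2)%:R = 4 / (N.+1 * N.+2)%:R * 2 :> R by ring.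
rewrite -[leRHS]mulrA ler_wpM2l ?divr_ge0//.
apply: (@le_trans _ _ (2 * \sum_(x <- B) F x * (F x - pathE r (fun t => F (x + displacement t))))).
  rewrite -pathE_sum.
  have -> : 2 * \sum_(x <- B) F x * (F x - pathE r (fun t => F (x + displacement t))) =
      pathE r (fun t => 2 * \sum_(x <- B) F x * (F x - F (x + displacement t))).
    rewrite pathEZl pathE_sum; congr (_ * _); apply: eq_bigr => x _.
    by rewrite pathEZl pathEB pathE_cst.
  apply: ler_pathE => t _.
  (* Expanding the square leaves a difference of two sums of [F ^+ 2], which is nonpositive by
     translation. *)
  have -> : \sum_(x <- B) (F (x + displacement t) - F x) ^+ 2 =
     \sum_(x <- B) F (x + displacement t) ^+ 2 - \sum_(x <- B) F x ^+ 2 +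
     2 * \sum_(x <- B) F x * (F x - F (x + displacement t)).
    by rewrite mulr_sumr -sumrB -big_split/=; apply: eq_bigr => x _; ring.
  rewrite gerDr subr_le0; apply: (@ler_sum_shift (fun x => F x ^+ 2)) => // x.
    exact: sqr_ge0.
  by move=> /FB ->; rewrite expr0n.
rewrite ler_pM2l//.
apply: (@le_trans _ _ (\sum_(x <- B) F x * \sum_(1 <= l < m.+1) \sum_(0 <= j < r) heat j (x - y l))).
  apply: ler_sum => x _; rewrite ler_wpM2l// pathE_sum -sumrB; apply: ler_sum => l _.
  rewrite pathEZl -mulrBr.
  have -> : pathE r (fun t => green T (x + displacement t - y l)) = \sum_(0 <= k < T) heat (k + r) (x - y l).
    rewrite -pathE_green; apply: eq_pathE => t _; congr (green _ _).
    by rewrite addrAC.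
  have h0 : 0 <= \sum_(0 <= j < r) heat j (x - y l) by apply: sumr_ge0 => j _; exact: heat_ge0.
  (* The coefficient is bounded by 1 only now: G_T - P^r G_T has no sign, while its upper bound is
     nonnegative. *)
  apply: (@le_trans _ _ (c l * \sum_(0 <= j < r) heat j (x - y l))).
    by rewrite ler_wpM2l// green_shift_le.
  by rewrite ler_piMl//; have /andP[] := c01 l.
apply: (@le_trans _ _ (\sum_(x <- B) (\sum_(1 <= l < m.+1) green T (x - y l)) *
    \sum_(1 <= l < m.+1) \sum_(0 <= j < r) heat j (x - y l))).
  apply: ler_sum => x _; rewrite ler_wpM2r//.
    by apply: sumr_ge0 => l _; apply: sumr_ge0 => j _; exact: heat_ge0.
  apply: ler_sum => l _; rewrite ler_piMl ?green_upto_ge0//.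
  by have /andP[] := c01 l.
under eq_bigr do rewrite mulr_suml; rewrite exchange_big/=; apply: ler_sum => l _.
under eq_bigr do rewrite mulr_sumr; rewrite exchange_big/=; apply: ler_sum => l' _.
under eq_bigr do rewrite mulr_sumr; rewrite exchange_big/=; apply: ler_sum => j _.
under eq_bigr do rewrite /green_upto mulr_suml; rewrite exchange_big/=; apply: ler_sum => k _.
exact: heat_convolution_le.
Qed.

Lemma heat_walkB m l l' n : (l <= l' <= m)%N ->
  pathE m (fun t => heat n (walk t l - walk t l')) = heat (n + (l' - l)) 0.
Proof.
move=> /andP[ll lm].
have -> : (n + (l' - l) = (l' - l) + n)%N by rewrite addnC.
rewrite -heatDr -(@pathE_increment R m l (l' - l) (fun x => heat n (0 + x))) ?subnKC//.
by apply: eq_pathE => t _; rewrite add0r -heatN opprB.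
Qed.

(** Averaging over the second walk turns the heat kernel at its increments into return
    probabilities. For each of the [r] values of j, summing over k gives at most 4/(|l-l'|+1), and
    summing over l' gives the harmonic number. *)
Lemma potential_increment_mean T m n N r (c : seq Z4 -> nat -> R) : (N + r <= n)%N ->
  (forall t l, 0 <= c t l <= 1) ->
  pathE n (fun s => pathE m (fun t =>
    (potential T m (c t) (walk t) (walk s (N + r)) - potential T m (c t) (walk t) (walk s N)) ^+ 2)) <=
  64 / (N.+1 * N.+2)%:R * (r%:R * m%:R * harm m).
Proof.
move=> Nrn c01; rewrite pathE_swap.
apply: le_trans (ler_pathE (fun t _ => potential_increment_le T m (walk t) Nrn (c01 t))) _.
rewrite pathEZl (_ : 64 / (N.+1 * N.+2)%:R = 8 / (N.+1 * N.+2)%:R * 8); last by ring.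
rewrite -[leRHS]mulrA ler_wpM2l ?divr_ge0//.
pose f l l' : R := pathE m (fun t => \sum_(0 <= j < r) \sum_(0 <= k < T) heat (k + j) (walk t l - walk t l')).
rewrite pathE_sum (eq_bigr (fun l => \sum_(1 <= l' < m.+1) f l l')) => [|l _];
  last by rewrite pathE_sum.
apply: le_trans (@sum_sym_le _ _ _ f _ _) _.
- move=> l l'; apply: pathE_ge0 => t _; apply: sumr_ge0 => j _; apply: sumr_ge0 => k _.
  exact: heat_ge0.
- move=> l l'; apply: eq_pathE => t _; apply: eq_bigr => j _; apply: eq_bigr => k _.
  by rewrite -heatN opprB.
apply: (@le_trans _ _ (2 * \sum_(1 <= l < m.+1) \sum_(1 <= l' < m.+1)
    (4 * r%:R) * (if (l <= l')%N then (l' - l).+1%:R^-1 else 0))).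
  rewrite ler_pM2l//; apply: ler_sum_nat => l /andP[_ lm]; apply: ler_sum_nat => l' /andP[_ lm'].
  case: ifP => ll; last by rewrite mulr0.
  rewrite /f pathE_sum.
  apply: (@le_trans _ _ (\sum_(0 <= j < r) 4 / (l' - l).+1%:R)); last first.
    by rewrite sumr_const_nat subn0 -[leLHS]mulr_natl mulrA [r%:R * _]mulrC.
  apply: ler_sum => j _; rewrite pathE_sum.
  apply: (@le_trans _ _ (4 / (j + (l' - l)).+1%:R)).
    apply: le_trans (@heat_sum_ub R T (j + (l' - l)) (fun=> 0)).
    by apply: ler_sum => k _; rewrite heat_walkB ?ll// addnA.
  by rewrite ler_pM2l// lef_pV2 ?posrE ?ltr0n// ler_nat ltnS leq_addl.
have -> : 8 * (r%:R * m%:R * harm m) = 2 * \sum_(1 <= l < m.+1) (4 * r%:R * harm m).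
  by rewrite sumr_const_nat subSS subn0 -[X in 2 * X]mulr_natl; ring.
rewrite ler_pM2l//; apply: ler_sum_nat => l /andP[l0 _].
by rewrite -mulr_sumr ler_wpM2l ?sum_inv_dist// mulr_ge0.
Qed.

End Dirichlet.

(** * Orthogonality and the weighted sums of fluctuations *)

Section Core.
Variable R : realType.
Local Notation green := (@green_upto R).
Local Notation harm := (harm R).
Local Notation potential := (@potential R).
Variable esc : nat -> (nat -> Z4) -> nat -> R.
Hypothesis esc_ge0 : forall r s i, 0 <= esc r s i.
Hypothesis esc_le1 : forall r s i, esc r s i <= 1.
Hypothesis esc_shift : forall r s s' z a,
  (forall k, (k <= r.*2)%N -> s (a + k)%N = z + s' k) -> esc r s (a + r) = esc r s' r.
Local Notation escape_mean := (escape_mean esc).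

Definition inner (n r i : nat) : bool := (r <= i)%N && (i + r <= n)%N.

Definition windowed (n r : nat) (s : nat -> Z4) (i : nat) : R :=
  if inner n r i then esc r s i else 1.

(** Centred at inner indices only: elsewhere [windowed] has the default value 1. *)
Definition fluct (n r : nat) (s : nat -> Z4) (i : nat) : R :=
  windowed n r s i - escape_mean r.

Lemma windowed01 n r s i : 0 <= windowed n r s i <= 1.
Proof. by rewrite /windowed; case: ifP => _; rewrite ?esc_ge0 ?esc_le1 ?ler01 ?lexx. Qed.

Lemma fluct_sqr_le1 n r s i : fluct n r s i ^+ 2 <= 1.
Proof.
have /andP[] := windowed01 n r s i.
have := escape_mean_ge0 esc_ge0 r; have := escape_mean_le1 esc_le1 r.
rewrite /fluct; move: (windowed _ _ _ _) (escape_mean _) => a b h1 h2 h3 h4.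
rewrite -[1](expr1n _ 2) -ler_sqrt ?exprn_gt0// !sqrtr_sqr normr1 ler_norml; lra.
Qed.

Lemma esc_window' r s i : (r <= i)%N ->
  esc r s i = esc r (fun k => s (i - r + k)%N - s (i - r)%N) r.
Proof. by move=> ri; rewrite -{1}(subnK ri) (esc_window esc_shift). Qed.

Lemma esc_local_upto n r i : (r <= i)%N -> (i + r <= n)%N -> local_upto n (fun s => esc r s i).
Proof.
move=> ri irn s s' ss'; rewrite !(esc_window' _ ri).
by apply: (esc_local esc_shift) => k kr; rewrite !ss'//; lia.
Qed.

(** Since i+r <= j-r, the factors of index i and the lagged potential at j are functions of the path
    up to time j-r, while [fluct] at j is centred and depends on later increments only. *)
Lemma fluct_orthogonal n r i j (F : Z4 -> R) : inner n r i -> inner n r j -> (i + r.*2 <= j)%N ->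
  pathE n (fun s => (fluct n r (walk s) i * F (walk s (i - r)%N)) *
                    (fluct n r (walk s) j * F (walk s (j - r)%N))) = 0.
Proof.
move=> ii ij irj; have /andP[ri irn] := ii; have /andP[rj jrn] := ij.
pose X s := (esc r s i - escape_mean r) * F (s (i - r)%N) * F (s (j - r)%N).
pose G s := esc r s r - escape_mean r.
have lX : local_upto (j - r) X.
  move=> s s' ss'; rewrite /X !ss' ?leqnn//; last by lia.
  by rewrite (@esc_local_upto (j - r) r i ri _ s s')//; lia.
have lG : local_upto r.*2 G by move=> s s' ss'; rewrite /G (esc_local esc_shift ss').
transitivity (pathE n (fun s => X (walk s) * G (fun k => walk s (j - r + k)%N - walk s (j - r)%N))).
  apply: eq_pathE => s _; rewrite /fluct /windowed ii ij /X /G -esc_window'//; ring.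
by rewrite (pathE_indep lX lG) ?pathEB ?pathE_cst ?subrr ?mulr0//; lia.
Qed.

Lemma card_outer n r : (0 < r)%N ->
  \sum_(1 <= i < n.+1) (~~ inner n r i)%:R <= r.*2%:R :> R.
Proof.
move=> r0; pose f i : R := (i < r)%:R; pose h i : R := ((n < i + r) && (i <= n))%N%:R.
apply: (@le_trans _ _ (\sum_(1 <= i < n.+1) (f i + h i))).
  apply: ler_sum_nat => i /andP[_ ni]; rewrite /f /h /inner -natrD ler_nat.
  by rewrite -[(i <= n)%N]ltnS ni andbT negb_and -!ltnNge; case: ltnP; case: ltnP.
rewrite big_split/= -addnn natrD; apply: lerD.
  apply: le_trans (@ler_sum_window R f n.+1 0 r _ _ _) _ => // [k|].
    by rewrite /f leq0n /= => /negPf ->.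
  apply: (@le_trans _ _ (\sum_(0 <= k < r) 1)); first by apply: ler_sum => k _;
    rewrite /f lern1 leq_b1.
  by rewrite sumr_const_nat subn0.
apply: le_trans (@ler_sum_window R h n.+1 (n.+1 - r) n.+1 _ _ _) _ => [||k kn|].
- exact: leq_subr.
- by move=> k; rewrite /h.
- by rewrite /h; case: andP => // -[]; lia.
apply: (@le_trans _ _ (\sum_(n.+1 - r <= k < n.+1) 1)).
  by apply: ler_sum => k _; rewrite /h lern1 leq_b1.
by rewrite sumr_const_nat ler_nat; lia.
Qed.

Lemma card_near n r i : (0 < r)%N ->
  \sum_(1 <= j < n.+1) ((j < i + r.*2) && (i < j + r.*2))%N%:R <= (4 * r)%:R :> R.
Proof.
move=> r0; pose h j : R := ((j < i + r.*2) && (i < j + r.*2))%N%:R.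
apply: le_trans (@ler_sum_window R h n.+1 (i.+1 - r.*2) (i + r.*2) _ _ _) _ => [||k kn|].
- lia.
- by move=> k; rewrite /h.
- by rewrite /h; case: andP => // -[]; lia.
apply: (@le_trans _ _ (\sum_(i.+1 - r.*2 <= k < i + r.*2) 1)).
  by apply: ler_sum => k _; rewrite /h lern1 leq_b1.
by rewrite sumr_const_nat ler_nat; lia.
Qed.

Lemma sum_inner_inv n r : (0 < r)%N ->
  \sum_(1 <= i < n.+1) (if inner n r i then (i - r).+1%:R^-1 else 0) <= harm n.
Proof.
move=> r0; apply: le_trans (sum_inv_dist R n r0); apply: ler_sum => i _.
by rewrite /inner; case: leqP => //= ri; case: ifP => // _; rewrite invr_ge0.
Qed.

Lemma sum_shift_inv m i : \sum_(1 <= l < m.+1) (i + l).+1%:R^-1 <= m%:R / i.+1%:R :> R.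
Proof.
apply: (@le_trans _ _ (\sum_(1 <= l < m.+1) i.+1%:R^-1)).
  by apply: ler_sum => l _; rewrite lef_pV2 ?posrE ?ltr0n// ler_nat ltnS leq_addr.
by rewrite sumr_const_nat subSS subn0 mulr_natl.
Qed.

Section Terms.
Variables (T n m r : nat) (c : seq Z4 -> nat -> R).
Hypothesis r0 : (0 < r)%N.
Hypothesis c01 : forall t l, 0 <= c t l <= 1.
Let F s t i := potential T m (c t) (walk t) (walk s i).
Let E2 (G : seq Z4 -> seq Z4 -> R) := pathE n (fun s => pathE m (G s)).
Let V i := E2 (fun s t => F s t i ^+ 2).

Let F0 s t i : 0 <= F s t i.
Proof. by apply: potential_ge0 => l; have /andP[] := c01 t l. Qed.

Let Vle i : (i <= n)%N -> V i <= 32 * harm m * (m%:R / i.+1%:R).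
Proof.
move=> i_n; apply: le_trans (potential_sqr_mean T m i_n c01) _.
by rewrite ler_wpM2l ?sum_shift_inv// mulr_ge0// harm_ge0.
Qed.

Let E2Zl a G : E2 (fun s t => a * G s t) = a * E2 G.
Proof. by rewrite /E2 -pathEZl; apply: eq_pathE => s _; rewrite pathEZl. Qed.

Let E2D G G' : E2 (fun s t => G s t + G' s t) = E2 G + E2 G'.
Proof. by rewrite /E2 -pathED; apply: eq_pathE => s _; rewrite pathED. Qed.

Let E2sum (I : Type) (l : seq I) (G : I -> seq Z4 -> seq Z4 -> R) :
  E2 (fun s t => \sum_(i <- l) G i s t) = \sum_(i <- l) E2 (G i).
Proof. by rewrite /E2 -pathE_sum; apply: eq_pathE => s _; rewrite pathE_sum. Qed.

Let E2le G G' : (forall s t, G s t <= G' s t) -> E2 G <= E2 G'.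
Proof. by move=> GG; apply: ler_pathE => s _; apply: ler_pathE => t _. Qed.

(* The sum of [fluct i * F i] is split into the boundary indices, the inner
   indices with [F i] replaced by [F (i - r)] (which makes distant terms
   orthogonal), and the error of this replacement. *)
Lemma outer_term_le :
  E2 (fun s t => (\sum_(1 <= i < n.+1) (~~ inner n r i)%:R * (fluct n r (walk s) i * F s t i)) ^+ 2)
  <= 64 * (r%:R * m%:R * harm m * harm n).
Proof.
apply: (@le_trans _ _ (E2 (fun s t => r.*2%:R * \sum_(1 <= i < n.+1) F s t i ^+ 2))).
  apply: E2le => s t.
  have := @sqr_sum_weighted R _ (index_iota 1 n.+1) (fun i => (~~ inner n r i)%:R)
    (fun i => fluct n r (walk s) i * F s t i) (fun i => ler0n _ _).
  move=> /le_trans; apply.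
  apply: ler_pM; rewrite ?sumr_ge0 ?card_outer//.
    by move=> i _; rewrite mulr_ge0 ?sqr_ge0.
  apply: ler_sum => i _; rewrite exprMn -[leRHS]mul1r mulrA ler_wpM2r ?sqr_ge0//.
  by case: inner; rewrite ?mul1r ?mul0r ?fluct_sqr_le1.
rewrite E2Zl E2sum -muln2 natrM.
apply: (@le_trans _ _ (r%:R * 2 * \sum_(1 <= i < n.+1) 32 * harm m * (m%:R * i%:R^-1))).
  rewrite ler_wpM2l ?mulr_ge0//; apply: ler_sum_nat => i /andP[i0 i_n].
  apply: le_trans (Vle i_n) _; rewrite ler_wpM2l ?mulr_ge0 ?harm_ge0//.
  by rewrite ler_wpM2l// lef_pV2 ?posrE ?ltr0n// ler_nat.
rewrite -mulr_sumr -mulr_sumr big_add1 -/(harm n) le_eqVlt; apply/orP; left; apply/eqP; ring.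
Qed.

Lemma inner_term_le :
  E2 (fun s t => (\sum_(1 <= i < n.+1) (inner n r i)%:R * (fluct n r (walk s) i * F s t (i - r))) ^+ 2)
  <= 128 * (r%:R * m%:R * harm m * harm n).
Proof.
pose x s t i := (inner n r i)%:R * (fluct n r (walk s) i * F s t (i - r)) : R.
pose N i j : R := ((j < i + r.*2) && (i < j + r.*2))%N%:R.
pose U i : R := (inner n r i)%:R * V (i - r).
(* Zero by orthogonality when |i-j| >= 2r; otherwise 2ab <= a^2 + b^2. *)
have xx i j : E2 (fun s t => x s t i * x s t j) <= N i j * (2^-1 * (U i + U j)).
  rewrite /N; case: (ltnP j) => ij; last first.
    rewrite mul0r; have [/andP[ii jj]|nij] := boolP (inner n r i && inner n r j).
      rewrite /E2 pathE_swap -(@pathE_cst R m 0) le_eqVlt; apply/orP; left; apply/eqP.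
      apply: eq_pathE => t _;
        rewrite -[RHS](fluct_orthogonal (potential T m (c t) (walk t)) ii jj ij).
      by apply: eq_pathE => s _; rewrite /x ii jj !mul1r.
    rewrite -(@pathE_cst R n 0); apply: ler_pathE => s _; rewrite -(@pathE_cst R m 0).
    by apply: ler_pathE => t _; rewrite /x; move: nij; case: inner; case: inner => //= _;
      rewrite ?mul0r ?mulr0.
  case: (ltnP i) => ji; last first.
    rewrite mul0r; have [/andP[ii jj]|nij] := boolP (inner n r i && inner n r j).
      rewrite /E2 pathE_swap -(@pathE_cst R m 0) le_eqVlt; apply/orP; left; apply/eqP.
      apply: eq_pathE => t _;
        rewrite -[RHS](fluct_orthogonal (potential T m (c t) (walk t)) jj ii ji).
      by apply: eq_pathE => s _; rewrite /x ii jj !mul1r mulrC.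
    rewrite -(@pathE_cst R n 0); apply: ler_pathE => s _; rewrite -(@pathE_cst R m 0).
    by apply: ler_pathE => t _; rewrite /x; move: nij; case: inner; case: inner => //= _;
      rewrite ?mul0r ?mulr0.
  rewrite mul1r.
  have -> : 2^-1 * (U i + U j) = E2 (fun s t => 2^-1 * ((inner n r i)%:R * F s t (i - r) ^+ 2 +
       (inner n r j)%:R * F s t (j - r) ^+ 2)).
    by rewrite E2Zl E2D !E2Zl.
  apply: E2le => s t.
  have sq k : x s t k ^+ 2 <= (inner n r k)%:R * F s t (k - r) ^+ 2.
    rewrite /x exprMn; case: inner; rewrite ?expr0n ?mul0r// expr1n !mul1r exprMn.
    by rewrite ler_piMl ?sqr_ge0 ?fluct_sqr_le1.
  have := sq i; have := sq j; have := sqr_ge0 (x s t i - x s t j).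
  move: (x s t i) (x s t j) (_ * F s t (i - r) ^+ 2) (_ * F s t (j - r) ^+ 2) => a b p q; nra.
have U0 i : 0 <= U i.
  by rewrite mulr_ge0//; apply: pathE_ge0 => s _; apply: pathE_ge0 => t _; exact: sqr_ge0.
apply: (@le_trans _ _ (\sum_(1 <= i < n.+1) \sum_(1 <= j < n.+1) N i j * (2^-1 * (U i + U j)))).
  apply: le_trans (ler_sum _ (fun i _ => ler_sum _ (fun j _ => xx i j))) => /=.
  under eq_bigr do rewrite -E2sum.
  rewrite -E2sum; apply: E2le => s t; rewrite expr2 mulr_suml; apply: ler_sum => i _.
  by rewrite mulr_sumr.
apply: (@le_trans _ _ ((4 * r)%:R * \sum_(1 <= i < n.+1) U i)).
  have -> : \sum_(1 <= i < n.+1) \sum_(1 <= j < n.+1) N i j * (2^-1 * (U i + U j)) =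
     2^-1 * (\sum_(1 <= i < n.+1) \sum_(1 <= j < n.+1) N i j * U i) +
     2^-1 * (\sum_(1 <= i < n.+1) \sum_(1 <= j < n.+1) N j i * U i).
    rewrite [in X in _ = _ + 2^-1 * X]exchange_big/= -mulrDr -big_split mulr_sumr.
    apply: eq_bigr => i _; rewrite -big_split mulr_sumr.
    by apply: eq_bigr => j _; rewrite mulrCA mulrDr.
  have N1 i : \sum_(1 <= j < n.+1) N i j * U i <= (4 * r)%:R * U i.
    by rewrite -mulr_suml ler_wpM2r ?card_near.
  have N2 i : \sum_(1 <= j < n.+1) N j i * U i <= (4 * r)%:R * U i.
    rewrite -mulr_suml ler_wpM2r// (eq_bigr (N i)) ?card_near// => j _.
    by rewrite /N andbC.
  have h1 := ler_sum (index_iota 1 n.+1) (P := xpredT) (fun i _ => N1 i).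
  have h2 := ler_sum (index_iota 1 n.+1) (P := xpredT) (fun i _ => N2 i).
  rewrite -!mulr_sumr in h1 h2; lra.
apply: (@le_trans _ _ ((4 * r)%:R * (32 * harm m * m%:R * harm n))); last first.
  by rewrite natrM le_eqVlt; apply/orP; left; apply/eqP; ring.
rewrite ler_wpM2l//.
apply: (@le_trans _ _ (32 * harm m * m%:R * \sum_(1 <= i < n.+1) (if inner n r i then (i - r).+1%:R^-1 else 0))).
  rewrite mulr_sumr; apply: ler_sum_nat => i /andP[_ i_n].
  rewrite /U; case: inner; rewrite ?mul0r ?mulr0// mul1r -mulrA.
  by apply: Vle; lia.
by rewrite ler_wpM2l ?sum_inner_inv// !mulr_ge0// harm_ge0.
Qed.

Lemma increment_term_le :
  E2 (fun s t => (\sum_(1 <= i < n.+1) (inner n r i)%:R *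
     (fluct n r (walk s) i * (F s t i - F s t (i - r)))) ^+ 2)
  <= 64 * (r%:R * m%:R * harm m * harm n ^+ 2).
Proof.
(* With N = i-r the energy is of order 1/((N+1)(N+2)); the weights 1/(N+1) balance it, so that both
   Cauchy-Schwarz factors sum to [harm n]. *)
pose w i : R := if inner n r i then (i - r).+1%:R^-1 else 0.
have w0 i : 0 <= w i by rewrite /w; case: ifP => // _; rewrite invr_ge0.
pose d s t i := F s t i - F s t (i - r).
pose G i : R := if inner n r i then (i - r).+1%:R * E2 (fun s t => d s t i ^+ 2) else 0.
apply: (@le_trans _ _ (harm n * \sum_(1 <= i < n.+1) G i)).
  apply: (@le_trans _ _ (E2 (fun s t => harm n * \sum_(1 <= i < n.+1)
      (if inner n r i then (i - r).+1%:R else 0) * d s t i ^+ 2))); last first.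
    rewrite E2Zl ler_wpM2l ?harm_ge0// E2sum; apply: ler_sum => i _.
    by rewrite E2Zl /G; case: inner; rewrite ?mul0r.
  apply: E2le => s t.
  rewrite (eq_bigr (fun i => w i * ((i - r).+1%:R * (fluct n r (walk s) i * d s t i)))) => [|i _]; last first.
    rewrite /w; case: inner; rewrite ?mul0r// mul1r mulrA mulVf ?mul1r ?pnatr_eq0//.
  apply: le_trans (sqr_sum_weighted _ _ w0) _.
  apply: ler_pM; rewrite ?sumr_ge0 ?sum_inner_inv//.
    by move=> i _; rewrite mulr_ge0 ?sqr_ge0.
  apply: ler_sum => i _; rewrite /w; case: inner; rewrite ?mul0r//.
  move: (i - r)%N (fluct_sqr_le1 n r (walk s) i) => N f1.
  have N0 : N.+1%:R != 0 :> R by rewrite pnatr_eq0.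
  rewrite [leLHS](_ : _ = fluct n r (walk s) i ^+ 2 * (N.+1%:R * d s t i ^+ 2)).
    by rewrite ler_piMl// mulr_ge0 ?sqr_ge0.
  by field; rewrite nat1r.
pose K : R := 64 * (r%:R * m%:R * harm m).
have K0 : 0 <= K by rewrite !mulr_ge0// harm_ge0.
apply: (@le_trans _ _ (harm n * (K * \sum_(1 <= i < n.+1) w i))).
  rewrite ler_wpM2l ?harm_ge0// mulr_sumr; apply: ler_sum_nat => i /andP[_ i_n].
  rewrite /G /w; case: ifP => [/andP[ri irn]|_]; last by rewrite mulr0.
  rewrite mulrC -ler_pdivlMr// /d -{1}(subnK ri).
  apply: le_trans (@potential_increment_mean R T m n (i - r) r c _ c01) _; first by lia.
  rewrite /K [leLHS](_ : _ = 64 * (r%:R * m%:R * harm m) / ((i - r).+1 * (i - r).+2)%:R);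
    last by ring.
  rewrite -[leRHS]mulrA -invfM ler_wpM2l ?mulr_ge0 ?harm_ge0// -natrM lef_pV2 ?posrE ?ltr0n// ler_nat.
  by rewrite leq_mul2l leqnSn.
rewrite [leRHS](_ : _ = harm n * (K * harm n)); last by rewrite /K; ring.
by rewrite ler_wpM2l ?harm_ge0// ler_wpM2l ?sum_inner_inv.
Qed.

(** The constant is 3(64 + 128 + 64), the 3 coming from the square of a sum of three terms;
    [harm n >= 1] absorbs the lower power of [harm n]. *)
Lemma fluct_sum_sqr_le : (0 < n)%N ->
  pathE n (fun s => pathE m (fun t =>
    (\sum_(1 <= i < n.+1) fluct n r (walk s) i * potential T m (c t) (walk t) (walk s i)) ^+ 2))
  <= 768 * (r%:R * m%:R * harm m * harm n ^+ 2).
Proof.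
move=> n0.
pose X s t := \sum_(1 <= i < n.+1) (~~ inner n r i)%:R * (fluct n r (walk s) i * F s t i).
pose Y s t := \sum_(1 <= i < n.+1) (inner n r i)%:R * (fluct n r (walk s) i * F s t (i - r)).
pose Z s t := \sum_(1 <= i < n.+1) (inner n r i)%:R *
     (fluct n r (walk s) i * (F s t i - F s t (i - r))).
have H1 : 1 <= harm n.
  by case: (n) n0 => // k _; rewrite /harm big_nat_recl// invr1 lerDl sumr_ge0.
have K0 : 0 <= r%:R * m%:R * harm m by rewrite !mulr_ge0// harm_ge0.
apply: (@le_trans _ _ (E2 (fun s t => 3 * (X s t ^+ 2 + Y s t ^+ 2 + Z s t ^+ 2)))).
  apply: E2le => s t.
  have -> : \sum_(1 <= i < n.+1) fluct n r (walk s) i * F s t i = X s t + Y s t + Z s t.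
    rewrite /X /Y /Z -!big_split/=; apply: eq_bigr => i _.
    by case: inner; rewrite /= ?mul0r ?mul1r; ring.
  move: (X s t) (Y s t) (Z s t) => x y z; rewrite -subr_ge0.
  rewrite [leRHS](_ : _ = (x - y) ^+ 2 + (y - z) ^+ 2 + (x - z) ^+ 2); last by ring.
  by rewrite !addr_ge0 ?sqr_ge0.
rewrite E2Zl !E2D.
have hX := outer_term_le; have hY := inner_term_le; have hZ := increment_term_le.
rewrite -/(E2 _) -/X -/Y -/Z in hX hY hZ.
move: K0 hX hY hZ; set K := _ * harm m; rewrite -/(X _ _).
move: (harm n) H1 (E2 _) (E2 _) (E2 _) => h h1 x y z K0 hx hy hz.
have : K * h <= K * h ^+ 2 by rewrite ler_wpM2l// expr2 ler_peMl//; lra.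
lra.
Qed.

End Terms.
End Core.

(** * From the probability space to path averages *)

Section Discrete.
Variables (T : Type) (M : set (set T)).
Hypothesis sM : sigma_algebra setT M.

Let M0 : M set0. Proof. by case: sM. Qed.
Let MC A : M A -> M (~` A). Proof. by case: sM => _ mc _ /mc; rewrite setTD. Qed.
Let Mbig (A : nat -> set T) : (forall k, M (A k)) -> M (\bigcup_k A k).
Proof. by case: sM => _ _; apply. Qed.

Lemma sigma_algebraI A B : M A -> M B -> M (A `&` B).
Proof.
move=> mA mB; rewrite -[A `&` B]setCK setCI.
have -> : ~` A `|` ~` B = \bigcup_k (if k == 0%N then ~` A else ~` B).
  apply/seteqP; split => [x [xA|xB]|x [[|k] _ /=]]; [by exists 0%N|by exists 1%N|by left|by right].
by apply/MC/Mbig => k; case: eqP => _; exact: MC.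
Qed.

(** [M] stands both for the measurable sets of the probability space and for the sigma-algebra
    generated by one walk, to which the independence of the two walks refers. *)
Definition discretely_measurable (U : Type) (X : T -> U) := forall A, M (X @^-1` A).

Lemma discretely_measurableP (U : countType) (X : T -> U) :
  (forall u, M (X @^-1` [set u])) -> discretely_measurable X.
Proof.
move=> Xu A.
have -> : X @^-1` A = \bigcup_k (if @choice.unpickle U k is Some u then
    if `[< A u >] then X @^-1` [set u] else set0 else set0).
  apply/seteqP; split => [x Ax|x [k _]].
    by exists (choice.pickle (X x)) => //; rewrite choice.pickleK; case: asboolP.
  by case: choice.unpickle => // u; case: asboolP => // Au /= ->.
by apply: Mbig => k; case: choice.unpickle => // u; case: asboolP.
Qed.

Lemma discretely_measurable_pair (U V : countType) (X : T -> U) (Y : T -> V) :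
  discretely_measurable X -> discretely_measurable Y ->
  discretely_measurable (fun w => (X w, Y w)).
Proof.
move=> mX mY; apply: discretely_measurableP => -[u v].
have -> : (fun w => (X w, Y w)) @^-1` [set (u, v)] = X @^-1` [set u] `&` Y @^-1` [set v].
  by apply/seteqP; split => x /= => [[-> ->]|[-> ->]].
exact: sigma_algebraI.
Qed.

Lemma discretely_measurable_comp (U V : Type) (g : U -> V) (X : T -> U) :
  discretely_measurable X -> discretely_measurable (g \o X).
Proof. by move=> mX A; rewrite comp_preimage; exact: mX. Qed.

Definition increments (S : nat -> T -> Z4) (n : nat) (w : T) : seq Z4 :=
  [seq increment S i w | i <- iota 0 n].

Lemma discretely_measurable_increments (S : nat -> T -> Z4) n :
  (forall i, discretely_measurable (S i)) -> discretely_measurable (increments S n).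
Proof.
move=> mS; rewrite /increments; elim: (iota 0 n) => [|i l IH] /=.
  by apply: discretely_measurableP => u; have [->|/eqP u0] := eqVneq u [::];
    [rewrite preimage_cst ifT ?inE//; have := MC M0; rewrite setC0|
     rewrite preimage_cst ifF//; apply/negbTE; rewrite notin_setE => /esym].
have mi : discretely_measurable (increment S i).
  exact: (discretely_measurable_comp (fun p : Z4 * Z4 => p.1 - p.2)
            (discretely_measurable_pair (mS i.+1) (mS i))).
exact: (discretely_measurable_comp (fun p : Z4 * seq Z4 => p.1 :: p.2)
            (discretely_measurable_pair mi IH)).
Qed.

End Discrete.

Section UniformLaw.
Context d (T : measurableType d) (R : realType) (P : probability T R).

(** The masses on [L] add up to 1, so [V] lies in [L] almost surely and [f] may be arbitrary outside
    [L]. *)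
Lemma integral_uniform_law (U : countType) (V : T -> U) (L : seq U) (c : R) (f : U -> R) :
  discretely_measurable measurable V -> uniq L -> 0 <= c -> c * (size L)%:R = 1 ->
  (forall u, u \in L -> P (V @^-1` [set u]) = c%:E) -> (forall u, 0 <= f u) ->
  (\int[P]_w (f (V w))%:E = (c * \sum_(u <- L) f u)%:E)%E.
Proof.
move=> mV uL c0 cL PL f0.
pose h (k : U -> R) w := (\sum_(u <- L) (k u * \1_(V @^-1` [set u]) w)%:E)%E.
have hE k : (forall u, 0 <= k u) -> (\int[P]_w h k w = (c * \sum_(u <- L) k u)%:E)%E.
  move=> k0; rewrite ge0_integral_sum//.
  - rewrite mulr_sumr -sumEFin !big_seq; apply: eq_bigr => u uL'.
    under eq_integral do rewrite EFinM.
    rewrite ge0_integralZl//; last by rewrite lee_fin.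
      by rewrite integral_indic// setIT [c * _]mulrC EFinM -(PL u uL').
    by apply/measurable_EFinP; apply: measurable_indic; exact: mV.
  - move=> u; apply/measurable_EFinP; apply: measurable_funM => //.
  - by move=> u w _; rewrite lee_fin mulr_ge0.
have hV k w : V w \in L -> h k w = (k (V w))%:E.
  move=> wL; rewrite /h sumEFin (bigD1_seq (V w))//= indicE mem_set//= mulr1.
  rewrite big1 ?addr0// => u uw; rewrite indicE memNset ?mulr0// => /= e.
  by rewrite e eqxx in uw.
have PV : P (V @^-1` [set` L]) = 1%E.
  rewrite -(@setIT _ (V @^-1` _)) -integral_indic//.
  transitivity (\int[P]_w h (fun=> 1%R) w)%E.
    apply: eq_integral => w _; rewrite indicE; have [wL|wL] := boolP (V w \in L).
      by rewrite hV// mem_set.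
    rewrite memNset /=; last by rewrite (negPf wL).
    rewrite /h big_seq big1// => u uL'; rewrite mul1r indicE memNset//= => e.
    by rewrite e uL' in wL.
  by rewrite hE// big_const_seq count_predT iter_addr_0 cL.
rewrite -hE//; apply: ae_eq_integral => //.
- by move=> _ B mB; rewrite setTI; exact: (mV ((fun u => (f u)%:E) @^-1` B)).
- rewrite /h; apply: emeasurable_sum => u; apply/measurable_EFinP.
  by apply: measurable_funM => //; apply: measurable_indic; exact: mV.
exists (~` (V @^-1` [set` L])); split.
- exact: measurableC.
- by apply: etrans (probability_setC P (mV _)) _; rewrite PV subee.
- by move=> w /= wN wL; apply: wN => _; rewrite hV.
Qed.

End UniformLaw.

Section Paths.
Variable R : realType.

Fixpoint paths (n : nat) : seq (seq Z4) :=
  if n is n'.+1 then [seq e :: s | e <- steps, s <- paths n'] else [:: [::]].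

Lemma pathEE n (f : seq Z4 -> R) : pathE n f = 8^-1 ^+ n * \sum_(s <- paths n) f s.
Proof.
elim: n f => [|n IH] f /=; first by rewrite big_seq1 mul1r.
rewrite exprS -mulrA; congr (_ * _); rewrite big_allpairs_dep/= mulr_sumr.
by apply: eq_bigr => e _; rewrite IH.
Qed.

Lemma size_paths n : size (paths n) = (8 ^ n)%N.
Proof. by elim: n => //= n IH; rewrite size_allpairs IH size_steps expnS. Qed.

Lemma uniq_steps : uniq steps.
Proof.
have uk k j : unit_vector k ord0 j = (j == k)%:R by rewrite mxE.
have inj : injective unit_vector.
  by move=> k k' /rowP/(_ k); rewrite !uk eqxx; case: eqP.
rewrite cat_uniq !map_inj_uniq ?enum_uniq//; last by move=> k k' /oppr_inj/inj.
rewrite -enumT enum_uniq andbT /=; apply/hasPn => _ /mapP[k _ ->].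
apply/negP => /mapP[k' _ /rowP/(_ k)].
by rewrite mxE !uk eqxx; case: eqP.
Qed.

Lemma uniq_paths n : uniq (paths n).
Proof.
elim: n => //= n IH; apply: allpairs_uniq; rewrite ?uniq_steps//.
by move=> [e s] [e' s'] _ _ /= [-> ->].
Qed.

Lemma mem_paths n s : s \in paths n -> size s = n /\ all (mem steps) s.
Proof.
elim: n s => [|n IH] s /=; first by rewrite inE => /eqP ->.
by move=> /allpairsP[[e t] /= [es /IH[<- st] ->]]; rewrite /= es.
Qed.

Lemma nearest_neighbor_steps e : e \in steps -> nearest_neighbor e.
Proof.
have h (c : int) k : `|c| = 1 -> nearest_neighbor (c *: unit_vector k).
  move=> c1; rewrite /nearest_neighbor (bigD1 k)//= !mxE eqxx mulr1 c1 big1 ?addr0// => j jk.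
  by rewrite !mxE (negPf jk) mulr0 normr0.
rewrite mem_cat => /orP[] /mapP[k _ ->].
  by rewrite -[unit_vector k]scale1r; apply: h.
by rewrite -scaleN1r; apply: h; rewrite normrN1.
Qed.

End Paths.

Lemma walk_increments (T : Type) (S : nat -> T -> Z4) n k w :
  S 0%N w = 0 -> (k <= n)%N -> walk (increments S n w) k = S k w.
Proof.
move=> S0 kn; rewrite /walk /increments /displacement -map_take take_iota (minn_idPl kn) big_map.
by rewrite -[iota 0 k](_ : index_iota 0 k = _) ?telescope_sumr ?S0 ?subr0// /index_iota subn0.
Qed.

(** * The law of finitely many steps of one walk or of two *)

Section WalkLaw.
Context d (T : measurableType d) (R : realType) (P : probability T R).
Implicit Types S : nat -> T -> Z4.

Lemma increments_measurable S n : simple_random_walk P 0 S ->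
  discretely_measurable measurable (increments S n).
Proof.
move=> hS; apply: discretely_measurable_increments; first exact: sigma_algebra_measurable.
by move=> i; exact: srw_measurable hS i.
Qed.

Lemma process_increments S n : discretely_measurable (process_sigma_algebra S) (increments S n).
Proof.
apply: discretely_measurable_increments; first exact: smallest_sigma_algebra.
by move=> i A; apply: sub_sigma_algebra; exists i, A.
Qed.

Lemma prob_increments S n s : simple_random_walk P 0 S -> s \in paths n ->
  P (increments S n @^-1` [set s]) = (8^-1 ^+ n)%:E.
Proof.
move=> hS /mem_paths[ss sE].
pose J := [fset j | j in iota 0 n]%fset.
have -> : increments S n @^-1` [set s] =
    \bigcap_(j in [set` J]) (increment S j @^-1` [set nth 0 s j]).
  apply/seteqP; split => [w /= sw j /=|w /= sw].
    rewrite !inE/= mem_iota /= add0n => jn.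
    by rewrite -sw (nth_map 0%N) ?size_iota// nth_iota.
  apply: (@eq_from_nth _ 0); rewrite size_map size_iota// => j jn.
  rewrite (nth_map 0%N) ?size_iota// nth_iota//; apply: sw.
  by rewrite /= !inE/= mem_iota.
rewrite (srw_independent hS) (perm_big (iota 0 n)); last first.
  by apply: uniq_perm; rewrite ?fset_uniq ?iota_uniq// => j; rewrite !inE.
rewrite (eq_big_seq (fun=> (8^-1)%:E)) => [|j]; last first.
  rewrite mem_iota /= add0n => jn; rewrite (srw_uniform hS) nearest_neighbor_steps//.
  by apply: (allP sE); rewrite mem_nth ?ss.
rewrite -[n in RHS](size_iota 0); elim: (iota 0 n) => [|j l IH]; first by rewrite big_nil.
by rewrite big_cons IH /= exprS EFinM.
Qed.

(** No measurability of [F] is assumed: it factors through the first [n] increments, which take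
    values in a countable type. *)
Lemma walk_integral S n (F : (nat -> Z4) -> R) : simple_random_walk P 0 S ->
  local_upto n F -> (forall s, 0 <= F s) ->
  (\int[P]_w (F (S ^~ w))%:E = (pathE n (fun s => F (walk s)))%:E)%E.
Proof.
move=> hS lF F0; rewrite pathEE.
rewrite -(@integral_uniform_law _ _ _ P _ (increments S n) (paths n) _ (fun s => F (walk s))).
- apply: eq_integral => w _; congr (_%:E); apply: lF => k kn.
  by rewrite walk_increments ?(srw_start hS).
- exact: increments_measurable.
- exact: uniq_paths.
- by rewrite exprn_ge0 ?invr_ge0.
- by rewrite size_paths natrX -exprMn mulVf ?expr1n ?pnatr_eq0.
- by move=> s sn; exact: prob_increments.
- by move=> s; exact: F0.
Qed.

Lemma walk_prob S n (B : (nat -> Z4) -> Prop) : simple_random_walk P 0 S ->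
  local_upto n B ->
  P [set w | B (S ^~ w)] = (pathE n (fun s => `[< B (walk s) >]%:R))%:E.
Proof.
move=> hS lB.
have lF : local_upto n (fun s => `[< B s >]%:R : R) by move=> s s' ss'; rewrite (lB s s').
rewrite -(walk_integral hS lF); last by move=> s.
have mB : measurable [set w | B (S ^~ w)].
  have -> : [set w | B (S ^~ w)] = increments S n @^-1` [set s | B (walk s)].
    apply/seteqP; split => w /=; rewrite (lB (walk (increments S n w)) (S ^~ w))// => k kn;
      by rewrite walk_increments ?(srw_start hS).
  exact: increments_measurable.
by rewrite -(setIT [set w | _]) -integral_indic.
Qed.

Lemma walks_integral S S' n m (F : (nat -> Z4) -> (nat -> Z4) -> R) :
  simple_random_walk P 0 S -> simple_random_walk P 0 S' -> independent_processes P S S' ->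
  (forall s, local_upto m (F s)) -> (forall t, local_upto n (F ^~ t)) ->
  (forall s t, 0 <= F s t) ->
  (\int[P]_w (F (S ^~ w) (S' ^~ w))%:E =
   (pathE n (fun s => pathE m (fun t => F (walk s) (walk t))))%:E)%E.
Proof.
move=> hS hS' ind lF lF' F0.
pose L := [seq (s, t) | s <- paths n, t <- paths m].
pose f (u : seq Z4 * seq Z4) := F (walk u.1) (walk u.2).
have -> : pathE n (fun s => pathE m (fun t => F (walk s) (walk t))) =
    8^-1 ^+ (n + m) * \sum_(u <- L) f u.
  rewrite pathEE exprD -mulrA big_allpairs_dep/=; congr (_ * _); rewrite mulr_sumr.
  by apply: eq_bigr => s _; rewrite pathEE.
rewrite -(@integral_uniform_law _ _ _ P _ (fun w => (increments S n w, increments S' m w)) L).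
- apply: eq_integral => w _; congr (_%:E); rewrite /f/=.
  rewrite (lF _ (S' ^~ w) (walk (increments S' m w))); last first.
    by move=> k km; rewrite walk_increments ?(srw_start hS').
  apply: lF' => k kn.
  by rewrite walk_increments ?(srw_start hS).
- apply: discretely_measurable_pair; first exact: sigma_algebra_measurable.
    exact: increments_measurable.
  exact: increments_measurable.
- by apply: allpairs_uniq; rewrite ?uniq_paths// => -[? ?] [? ?].
- by rewrite exprn_ge0 ?invr_ge0.
- by rewrite size_allpairs !size_paths -expnD natrX -exprMn mulVf ?expr1n ?pnatr_eq0.
- move=> _ /allpairsP[[s t] /= [sn tm ->]].
  have -> : (fun w => (increments S n w, increments S' m w)) @^-1` [set (s, t)] =
     increments S n @^-1` [set s] `&` increments S' m @^-1` [set t].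
    by apply/seteqP; split => w /= => [[-> ->]|[-> ->]].
  rewrite ind; [|exact: process_increments|exact: process_increments].
  by rewrite !prob_increments// -EFinM exprD.
- by move=> u; exact: F0.
Qed.

End WalkLaw.

(** * Escape probabilities and the Green function *)

Section Avoid.
Variable R : realType.
Local Notation heat := (@heat R).
Variable A : set Z4.

(** Probability that the walk from [x] is outside [A] at times 1, ..., K, the starting point not
    being tested. It is defined by its first step because the last-exit inequality is proved by
    induction on that step. *)
Fixpoint avoid (K : nat) (x : Z4) : R :=
  if K is K'.+1 then 8^-1 * \sum_(e <- steps) (if `[< A (x + e) >] then 0 else avoid K' (x + e))
  else 1.

Lemma avoidE K x : avoid K x =
  pathE K (fun s => `[< forall k, (1 <= k <= K)%N -> ~ A (x + walk s k) >]%:R).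
Proof.
elim: K x => [|K IH] x.
  by rewrite /= asboolT// => k; rewrite andbC; case: k.
rewrite /=; congr (_ * _); apply: eq_bigr => e _.
have wS s k : walk (e :: s) k.+1 = e + walk s k by rewrite /walk/= displacement_cons.
case: asboolP => Ae.
  rewrite -(@pathE_cst R K 0); apply: eq_pathE => s _; rewrite asboolF// => h.
  by apply: (h 1%N) => //; rewrite wS walk0 addr0.
rewrite IH; apply: eq_pathE => s _; congr (nat_of_bool _)%:R; apply: asbool_equiv_eq; split => h.
  move=> [|k] kK; first by lia.
  rewrite wS addrA; case: k kK => [|k] kK; first by rewrite walk0 addr0.
  by apply: h; lia.
by move=> k kK; have := h k.+1; rewrite wS addrA; apply; lia.
Qed.

(* [u_T(x) + P^x(no visit to A during [0, T]) <= 1], where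
   [u_T(x)] decomposes a visit according to the last one before time [T]. *)
Lemma last_exit_le (L : seq Z4) T x : uniq L -> (forall z, z \in L -> A z) ->
  \sum_(0 <= k < T.+1) \sum_(z <- L) heat k (z - x) * avoid (T - k) z +
  (if `[< A x >] then 0 else avoid T x) <= 1.
Proof.
move=> uL LA; elim: T x => [|T IH] x.
  rewrite big_nat1 /=; under eq_bigr do rewrite heat0 mulr1 subr_eq0.
  have [xL|xL] := boolP (x \in L).
    rewrite (bigD1_seq x)//= eqxx big1 ?addr0 => [|z /negPf ->//].
    by rewrite asboolT ?addr0//; exact: LA.
  rewrite big_seq big1 ?add0r => [|z zL]; first by case: asboolP.
  by case: eqP xL => // <-; rewrite zL.
rewrite big_nat_recl// subn0.
have -> : \sum_(0 <= k < T.+1) \sum_(z <- L) heat k.+1 (z - x) * avoid (T.+1 - k.+1) z =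
   8^-1 * \sum_(e <- steps) \sum_(0 <= k < T.+1) \sum_(z <- L) heat k (z - (x + e)) * avoid (T - k) z.
  rewrite [in RHS]exchange_big mulr_sumr; apply: eq_bigr => k _.
  rewrite [in RHS]exchange_big mulr_sumr; apply: eq_bigr => z _.
  rewrite subSS -mulr_suml mulrA; congr (_ * _).
  rewrite -add1n heatD/=; congr (_ * _); apply: eq_bigr => e _.
  by rewrite displacement_cons /displacement big_nil addr0 opprD addrA.
have h1 : 8^-1 * \sum_(e <- steps) \sum_(0 <= k < T.+1) \sum_(z <- L) heat k (z - (x + e)) * avoid (T - k) z
    <= 1 - avoid T.+1 x.
  rewrite lerBrDr /= -mulrDr -big_split/= mulrC ler_pdivrMr// mul1r.
  apply: le_trans (ler_sum _ (fun e _ => IH (x + e))) _.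
  by rewrite big_const_seq count_predT size_steps iter_addr_0.
(* The last visit at time 0: it occurs only if [x] is in [A], and then replaces the final term of
   the inequality. *)
have h2 : \sum_(z <- L) heat 0 (z - x) * avoid T.+1 z <= (if `[< A x >] then avoid T.+1 x else 0).
  under eq_bigr do rewrite heat0 subr_eq0.
  have [xL|xL] := boolP (x \in L).
    rewrite (bigD1_seq x)// eqxx big1 ?addr0 ?mul1r; last by move=> z /negPf ->; rewrite mul0r.
    by rewrite [leLHS]addr0 asboolT//; exact: LA.
  rewrite big_seq big1 => [|z zL]; last by case: eqP xL => [<-|]; rewrite ?zL// mul0r.
  by case: ifP => // _; rewrite -/(avoid T.+1 x) avoidE pathE_ge0.
move: h1 h2; rewrite -/(avoid T.+1 x); case: asboolP => _; lra.
Qed.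

Lemma avoid_ge0 K x : 0 <= avoid K x.
Proof. by rewrite avoidE pathE_ge0. Qed.

End Avoid.

(** * Escape probabilities, their last-exit inequality and the Green function *)

Section EscapeProb.
Context d (T : measurableType d) (R : realType) (Q : probability T R).
Variable W : nat -> T -> Z4.
Hypothesis hW : simple_random_walk Q 0 W.
Local Notation heat := (@heat R).
Local Notation green_upto := (@green_upto R).

Lemma hitting_time_infinite (s : nat -> Z4) (A : set Z4) :
  hitting_time R s A = +oo%E <-> forall k, (1 <= k)%N -> ~ A (s k).
Proof.
rewrite /hitting_time ereal_inf_pinfty; split => [h k k1 Ak|h _ [k [k1 Ak] <-]].
  by have := h k%:R%:E (ex_intro2 _ _ k (conj k1 Ak) erefl).
by have := h k k1.
Qed.

Lemma escapeE x A :
  [set w | hitting_time R (fun k => x + W k w) A = +oo%E] =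
  \bigcap_k [set w | (1 <= k)%N -> ~ A (x + W k w)].
Proof.
apply/seteqP; split => w /= h; last by apply/hitting_time_infinite => k; exact: h.
by move=> k _; move/hitting_time_infinite: h; apply.
Qed.

Lemma escape_measurable x A :
  measurable [set w | hitting_time R (fun k => x + W k w) A = +oo%E].
Proof.
rewrite escapeE; apply: bigcap_measurable; first by exists 0%N.
by move=> k _; exact: (srw_measurable hW k [set z | (1 <= k)%N -> ~ A (x + z)]).
Qed.

Lemma escape_le_avoid x A K : (escape Q W x A <= (avoid R A K x)%:E)%E.
Proof.
pose B (s : nat -> Z4) := forall k, (1 <= k <= K)%N -> ~ A (x + s k).
have lB : local_upto K B.
  by move=> s s' ss'; apply/propext; split => h k /andP[k1 kK];
    have := h k; rewrite k1 kK ss'// => /(_ isT).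
rewrite avoidE -(walk_prob hW lB); apply: le_measure; rewrite ?inE.
- exact: escape_measurable.
- have -> : [set w | B (W ^~ w)] = \bigcap_k [set w | (1 <= k <= K)%N -> ~ A (x + W k w)].
    by apply/seteqP; split => w h k; [move=> _; exact: h|exact: h].
  apply: bigcap_measurable; first by exists 0%N.
  by move=> k _; exact: (srw_measurable hW k [set z | (1 <= k <= K)%N -> ~ A (x + z)]).
- by move=> w /hitting_time_infinite h k /andP[k1 _]; exact: h.
Qed.

Lemma escape_ge0 x A : (0 <= escape Q W x A)%E. Proof. exact: measure_ge0. Qed.

Lemma escape_le1 x A : (escape Q W x A <= 1)%E.
Proof. by apply: probability_le1; exact: escape_measurable. Qed.

Lemma escape_shift x z A A' : (forall y, A (z + y) <-> A' y) ->
  escape Q W (z + x) A = escape Q W x A'.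
Proof.
move=> AA; congr (Q _); apply/seteqP; split => w /= /hitting_time_infinite h;
  apply/hitting_time_infinite => k k1; have := h k k1; rewrite -addrA => nA a; apply: nA;
  exact/AA.
Qed.

Definition local_escape_real r (s : nat -> Z4) i : R := fine (local_escape Q W r s i).

Lemma local_escape_ge0 r s i : (0 <= local_escape Q W r s i)%E.
Proof. by rewrite mule_ge0 ?escape_ge0// lee_fin. Qed.

Lemma local_escape_le1 r s i : (local_escape Q W r s i <= 1)%E.
Proof.
rewrite /local_escape indicE; case: (_ \in _); rewrite ?mul0e ?lee_fin ?ler01//.
by rewrite mul1e escape_le1.
Qed.

Lemma local_escapeE r s i : local_escape Q W r s i = (local_escape_real r s i)%:E.
Proof.
rewrite fineK// ge0_fin_numE ?local_escape_ge0//.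
by rewrite (le_lt_trans (local_escape_le1 r s i))// ltry.
Qed.

Lemma local_escape_real_ge0 r s i : 0 <= local_escape_real r s i.
Proof. by rewrite -lee_fin -local_escapeE local_escape_ge0. Qed.

Lemma local_escape_real_le1 r s i : local_escape_real r s i <= 1.
Proof. by rewrite -lee_fin -local_escapeE local_escape_le1. Qed.

Lemma local_escape_real_shift r s s' z a :
  (forall k, (k <= r.*2)%N -> s (a + k)%N = z + s' k) ->
  local_escape_real r s (a + r) = local_escape_real r s' r.
Proof.
move=> ss'; rewrite /local_escape_real /local_escape; congr fine.
have ran b c y : (c <= r.*2)%N ->
    walk_range s (a + b) (a + c) (z + y) <-> walk_range s' b c y.
  move=> cr; split => -[k /= /andP[k1 k2] sk].
    exists (k - a)%N => /=; first by lia.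
    apply: (@addrI _ z); rewrite -ss'; last by lia.
    by rewrite subnKC ?sk//; lia.
  by exists (a + k)%N => /=; [lia|rewrite ss' ?sk//; lia].
rewrite ss'; last by lia.
congr (_%:E * _)%E.
  rewrite !indicE; congr (nat_of_bool _)%:R; rewrite -addnA addnn.
  by apply/idP/idP; rewrite !inE /= => h hw; apply: h; apply/ran.
apply: escape_shift => y; rewrite addnK subnn -addnA addnn -(addn0 a) -addnA.
exact: ran.
Qed.

(** Since i <= N <= r, the window of radius [r] about c+i contains (c, c+N]. Escaping it implies
    avoiding the range over (c, c+N], and not returning within [r] steps implies that c+i is the
    last visit to its site in (c, c+N]; the last-exit inequality for that range applies. *)
Lemma local_escape_last_exit r s c N T' x : (N <= r <= c)%N ->
  \sum_(1 <= i < N.+1) local_escape_real r s (c + i) * green_upto T' (x - s (c + i)%N) <= 1.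
Proof.
move=> /andP[Nr rc].
pose A := walk_range s c (c + N).
pose last i := `[< ~ walk_range s (c + i) (c + N) (s (c + i)%N) >].
(* listing last visits only counts every point of the range once *)
pose L := [seq s (c + i)%N | i <- [seq i <- iota 1 N | last i]].
have uL : uniq L.
  rewrite map_inj_in_uniq ?filter_uniq ?iota_uniq// => i j.
  rewrite !mem_filter !mem_iota => /andP[/asboolP li iN] /andP[/asboolP lj jN] sij.
  have [ij|ji|//] := ltngtP i j.
    by exfalso; apply: li; exists (c + j)%N => //=; lia.
  by exfalso; apply: lj; exists (c + i)%N => //=; lia.
have LA z : z \in L -> A z.
  move=> /mapP[i]; rewrite mem_filter mem_iota => /andP[_ iN] ->.
  by exists (c + i)%N => //=; lia.
have key i : (1 <= i < N.+1)%N -> forall K,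
    local_escape_real r s (c + i) <= (last i)%:R * avoid R A K (s (c + i)%N).
  move=> iN K; rewrite -lee_fin -local_escapeE EFinM /local_escape.
  apply: lee_pmul; rewrite ?lee_fin ?escape_ge0//.
    rewrite indicE /last ler_nat; case: (asboolP (~ _)) => [_|]; first by rewrite leq_b1.
    move=> /contrapT [j /= jN sj]; rewrite memNset//= => nn.
    by apply: nn; exists j => //=; lia.
  apply: le_trans (escape_le_avoid _ A K).
  apply: le_measure; rewrite ?inE; [exact: escape_measurable|exact: escape_measurable|].
  move=> w /hitting_time_infinite h; apply/hitting_time_infinite => j j1 Aj.
  by apply: (h j j1); case: Aj => l /= lN <-; exists l => //=; lia.
have := @last_exit_le R A L T' x uL LA; apply: le_trans.
rewrite -[leLHS]addr0; apply: lerD; last by case: ifP => // _; rewrite avoid_ge0.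
apply: (@le_trans _ _ (\sum_(1 <= i < N.+1) \sum_(0 <= j < T'.+1)
   (last i)%:R * (heat j (s (c + i)%N - x) * avoid R A (T' - j) (s (c + i)%N)))).
  apply: ler_sum_nat => i iN; rewrite -green_uptoN opprB /green_upto mulr_sumr.
  rewrite [leRHS]big_nat_recr//= -[leLHS]addr0; apply: lerD; last first.
    by rewrite !mulr_ge0 ?heat_ge0 ?avoid_ge0.
  apply: ler_sum => j _; rewrite mulrC mulrCA ler_wpM2l ?heat_ge0//.
  exact: key.
rewrite exchange_big/=; apply: ler_sum => j _.
rewrite /L big_map big_filter /index_iota subn1/= [leRHS]big_mkcond/=; apply: ler_sum => i _.
by case: (last i); rewrite ?mul1r ?mul0r.
Qed.

Definition green_fun (x : Z4) : R := limn (fun N => green_upto N x).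

Lemma green_upto_cvg x : green_upto N x @[N --> \oo] --> green_fun x.
Proof.
apply: nondecreasing_is_cvgn.
  move=> N M NM; rewrite /green_upto (@big_cat_nat _ _ _ N 0 M)//= lerDl sumr_ge0// => k _.
  exact: heat_ge0.
by exists 4 => _ [N _ <-]; exact: green_upto_ub.
Qed.

Lemma greenE x y : green Q W x y = (green_fun (y - x))%:E.
Proof.
rewrite /green /green_fun -EFin_lim; last by apply/cvg_ex; exists (green_fun (y - x));
  exact: green_upto_cvg.
congr (limn _); apply/funext => N; rewrite /= /green_upto -sumEFin; apply: eq_bigr => i _.
have lB : local_upto i (fun s : nat -> Z4 => x + s i = y).
  by move=> s s' ss'; rewrite ss'.
rewrite (walk_prob hW lB); congr (_%:E); apply: eq_pathE => s ss.
rewrite -ss walk_size; congr (nat_of_bool _)%:R.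
by apply/asboolP/eqP => [<-|->]; rewrite addrC ?addKr ?subrK// addrAC subrr add0r.
Qed.

Lemma green_funN x : green_fun (- x) = green_fun x.
Proof. by congr (limn _); apply/funext => N; exact: green_uptoN. Qed.

Lemma green_fun_ge0 x : 0 <= green_fun x.
Proof.
have c := @green_upto_cvg x; rewrite -(cvg_lim _ c)//; apply: limr_ge.
  by apply/cvg_ex; exists (green_fun x).
by near=> N; exact: green_upto_ge0.
Unshelve. all: by end_near. Qed.

End EscapeProb.

(** * Weighted and averaged Green sums *)

Section Comparison.
Variable R : realType.
Local Notation green_upto := (@green_upto R).
Local Notation green_fun := (@green_fun R).
Local Notation harm := (harm R).

Lemma sum_inv_sqrt_le n : \sum_(1 <= i < n.+1) (Num.sqrt i%:R)^-1 <= 2 * Num.sqrt n%:R :> R.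
Proof.
elim: n => [|n IH]; first by rewrite big_geq// sqrtr0 mulr0.
rewrite big_nat_recr//=; apply: le_trans (lerD IH (lexx _)) _.
set a := Num.sqrt n%:R; set b := Num.sqrt n.+1%:R.
have a0 : 0 <= a by exact: sqrtr_ge0.
have b0 : 0 < b by rewrite sqrtr_gt0.
have ab : b ^+ 2 = a ^+ 2 + 1 by rewrite !sqr_sqrtr// -natr1.
have -> : b^-1 = (b ^+ 2 - a ^+ 2) / b by rewrite ab addrC addKr mul1r.
rewrite -(ler_pM2r b0) mulrDl divfK ?gt_eqF//.
by rewrite -subr_ge0 [leRHS](_ : _ = (a - b) ^+ 2) ?sqr_ge0//; ring.
Qed.

(** The variables separate by i + l >= 2 sqrt(i l). *)
Lemma sum_inv_add_le n m :
  \sum_(1 <= i < n.+1) \sum_(1 <= l < m.+1) (i + l).+1%:R^-1 <= 2 * Num.sqrt (n%:R * m%:R) :> R.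
Proof.
apply: (@le_trans _ _ (2^-1 * ((\sum_(1 <= i < n.+1) (Num.sqrt i%:R)^-1) *
    (\sum_(1 <= l < m.+1) (Num.sqrt l%:R)^-1)))).
  rewrite mulr_suml mulr_sumr; apply: ler_sum_nat => i /andP[i0 _].
  rewrite mulr_sumr mulr_sumr; apply: ler_sum_nat => l /andP[l0 _].
  have hi : 0 < i%:R :> R by rewrite ltr0n.
  have hl : 0 < l%:R :> R by rewrite ltr0n.
  rewrite -!invfM lef_pV2 ?posrE ?mulr_gt0 ?sqrtr_gt0//.
  have -> : (i + l).+1%:R = Num.sqrt i%:R ^+ 2 + Num.sqrt l%:R ^+ 2 + 1 :> R.
    by rewrite !sqr_sqrtr// -natr1 natrD.
  by have := sqr_ge0 (Num.sqrt i%:R - Num.sqrt l%:R : R); move: (Num.sqrt _) (Num.sqrt _) => a b;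
    nra.
have h k : 0 <= \sum_(1 <= i < k.+1) (Num.sqrt i%:R)^-1 :> R.
  by apply: sumr_ge0 => i _; rewrite invr_ge0 sqrtr_ge0.
rewrite sqrtrM//.
have := ler_pM (h n) (h m) (sum_inv_sqrt_le n) (sum_inv_sqrt_le m).
by rewrite mulrACA; lra.
Qed.

(** Removes the truncation of the Green function: a path average is a finite sum, so pointwise
    convergence suffices. *)
Lemma pathE2_cvg_le n m (F : nat -> seq Z4 -> seq Z4 -> R) (f : seq Z4 -> seq Z4 -> R) (C : R) :
  (forall s t, F k s t @[k --> \oo] --> f s t) ->
  (forall k, pathE n (fun s => pathE m (F k s)) <= C) ->
  pathE n (fun s => pathE m (f s)) <= C.
Proof.
move=> Ff FC.
have c : pathE n (fun s => pathE m (F k s)) @[k --> \oo] --> pathE n (fun s => pathE m (f s)).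
  by apply: cvg_pathE => s; apply: cvg_pathE => t; exact: Ff.
rewrite -(cvg_lim _ c)//; apply: limr_le; first by apply/cvg_ex; eexists; exact: c.
by near=> k; exact: FC.
Unshelve. all: by end_near. Qed.

Variable esc : nat -> (nat -> Z4) -> nat -> R.
Hypothesis esc_ge0 : forall r s i, 0 <= esc r s i.
Hypothesis esc_le1 : forall r s i, esc r s i <= 1.
Hypothesis esc_shift : forall r s s' z a,
  (forall k, (k <= r.*2)%N -> s (a + k)%N = z + s' k) -> esc r s (a + r) = esc r s' r.
Local Notation escape_mean := (escape_mean esc).
Local Notation windowed := (windowed esc).
Local Notation fluct := (fluct esc).

Definition green_sum (G : Z4 -> R) n m (a b : nat -> R) (s t : nat -> Z4) : R :=
  \sum_(1 <= i < n.+1) \sum_(1 <= l < m.+1) a i * G (s i - t l) * b l.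

Lemma green_sum_mean n m :
  pathE n (fun s => pathE m (fun t =>
    green_sum green_fun n m (fun=> 1) (fun=> 1) (walk s) (walk t))) <=
  8 * Num.sqrt (n%:R * m%:R).
Proof.
apply: (@pathE2_cvg_le _ _ (fun N s t => green_sum (green_upto N) n m (fun=> 1) (fun=> 1) (walk s) (walk t))).
  move=> s t; apply: cvg_sumr => i; apply: cvg_sumr => l.
  by apply: cvgMr_tmp; apply: cvgMl_tmp; exact: green_upto_cvg.
move=> N;
  apply: (@le_trans _ _ (4 * \sum_(1 <= i < n.+1) \sum_(1 <= l < m.+1) (i + l).+1%:R^-1));
    last first.
  by have := sum_inv_add_le n m; lra.
rewrite /green_sum; under eq_pathE do rewrite pathE_sum.
rewrite pathE_sum mulr_sumr; apply: ler_sum_nat => i /andP[_ i_n].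
under eq_pathE do rewrite pathE_sum.
rewrite pathE_sum mulr_sumr; apply: ler_sum_nat => l /andP[_ lm].
under eq_pathE do under eq_pathE do rewrite mul1r mulr1.
by rewrite pathE_green_walks// green_mean_ub.
Qed.

Section Pair.
Variables (n m rn rm : nat).
Hypotheses (n0 : (0 < n)%N) (m0 : (0 < m)%N) (rn0 : (0 < rn)%N) (rm0 : (0 < rm)%N).

Definition weighted_sum (G : Z4 -> R) (s t : nat -> Z4) : R :=
  green_sum G n m (windowed n rn s) (windowed m rm t) s t.

Definition averaged_sum (G : Z4 -> R) (s t : nat -> Z4) : R :=
  escape_mean rn * escape_mean rm * green_sum G n m (fun=> 1) (fun=> 1) s t.

Definition second_moment_bound : R :=
  1536 * (rn%:R * m%:R * harm m * harm n ^+ 2 + rm%:R * n%:R * harm n * harm m ^+ 2).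

(** The difference is split as g g' - e e' = (g - e) g' + e (g' - e'), with e, e' the means. In [A]
    the second walk carries the random coefficients g'; in [B] the walks exchange roles and the
    coefficients are the constant e. Each part is bounded by [fluct_sum_sqr_le]. *)
Lemma weighted_sum_sqr_upto N :
  pathE n (fun s => pathE m (fun t =>
    (weighted_sum (green_upto N) (walk s) (walk t) -
     averaged_sum (green_upto N) (walk s) (walk t)) ^+ 2)) <= second_moment_bound.
Proof.
pose A s t := \sum_(1 <= i < n.+1) fluct n rn (walk s) i *
  potential N m (windowed m rm (walk t)) (walk t) (walk s i).
pose B s t := \sum_(1 <= l < m.+1) fluct m rm (walk t) l *
  potential N n (fun=> escape_mean rn) (walk s) (walk t l).
have hA : pathE n (fun s => pathE m (fun t => A s t ^+ 2)) <=
    768 * (rn%:R * m%:R * harm m * harm n ^+ 2).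
  exact: (fluct_sum_sqr_le esc_ge0 esc_le1 esc_shift N m rn0
    (fun t l => windowed01 esc_ge0 esc_le1 m rm (walk t) l) n0).
have hB : pathE m (fun t => pathE n (fun s => B s t ^+ 2)) <=
    768 * (rm%:R * n%:R * harm n * harm m ^+ 2).
  have e01 : 0 <= escape_mean rn <= 1 by rewrite escape_mean_ge0 ?escape_mean_le1.
  exact: (fluct_sum_sqr_le esc_ge0 esc_le1 esc_shift N n rm0 (fun (_ : seq Z4) (_ : nat) => e01) m0).
rewrite pathE_swap in hB.
apply: (@le_trans _ _ (pathE n (fun s => pathE m (fun t => 2 * A s t ^+ 2 + 2 * B s t ^+ 2)))).
  apply: ler_pathE => s _; apply: ler_pathE => t _.
  have -> : weighted_sum (green_upto N) (walk s) (walk t) -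
     averaged_sum (green_upto N) (walk s) (walk t) = A s t + B s t.
    rewrite /weighted_sum /averaged_sum /green_sum /A /B /potential.
    under [X in _ = _ + X]eq_bigr do rewrite mulr_sumr.
    rewrite [X in _ = _ + X]exchange_big/= mulr_sumr -sumrB -big_split/=.
    apply: eq_bigr => i _; rewrite !mulr_sumr -sumrB -big_split/=.
    apply: eq_bigr => l _; rewrite -[walk t l - walk s i]opprB green_uptoN /fluct; ring.
  by rewrite -subr_ge0 [leRHS](_ : _ = (A s t - B s t) ^+ 2) ?sqr_ge0//; ring.
under eq_pathE do rewrite pathED !pathEZl.
rewrite pathED !pathEZl /second_moment_bound; lra.
Qed.

Lemma weighted_sum_sqr :
  pathE n (fun s => pathE m (fun t =>
    (weighted_sum green_fun (walk s) (walk t) -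
     averaged_sum green_fun (walk s) (walk t)) ^+ 2)) <= second_moment_bound.
Proof.
apply: pathE2_cvg_le weighted_sum_sqr_upto => s t.
have cv a b : green_sum (green_upto k) n m a b (walk s) (walk t) @[k --> \oo] -->
    green_sum green_fun n m a b (walk s) (walk t).
  apply: cvg_sumr => i; apply: cvg_sumr => l.
  by apply: cvgMr_tmp; apply: cvgMl_tmp; exact: green_upto_cvg.
have cd : weighted_sum (green_upto k) (walk s) (walk t) - averaged_sum (green_upto k) (walk s) (walk t)
    @[k --> \oo] --> weighted_sum green_fun (walk s) (walk t) - averaged_sum green_fun (walk s) (walk t).
  by apply: cvgB; [exact: cv|apply: cvgMl_tmp; exact: cv].
exact: (cvgM cd cd).
Qed.

Lemma weighted_sum_mean :
  pathE n (fun s => pathE m (fun t => weighted_sum green_fun (walk s) (walk t))) <=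
  escape_mean rn * escape_mean rm * (8 * Num.sqrt (n%:R * m%:R)) +
  Num.sqrt second_moment_bound.
Proof.
pose D s t := weighted_sum green_fun (walk s) (walk t) - averaged_sum green_fun (walk s) (walk t).
have -> : pathE n (fun s => pathE m (fun t => weighted_sum green_fun (walk s) (walk t))) =
  pathE n (fun s => pathE m (fun t => averaged_sum green_fun (walk s) (walk t))) +
  pathE n (fun s => pathE m (D s)).
  rewrite -pathED; apply: eq_pathE => s _; rewrite -pathED; apply: eq_pathE => t _.
  by rewrite /D addrC subrK.
apply: lerD.
  under eq_pathE do rewrite pathEZl.
  by rewrite pathEZl ler_wpM2l ?green_sum_mean// mulr_ge0// escape_mean_ge0.
apply: le_trans (ler_norm _) _; rewrite -sqrtr_sqr ler_wsqrtr//.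
apply: le_trans (pathE_sqr _ _) _.
by apply: le_trans weighted_sum_sqr; apply: ler_pathE => s _; exact: pathE_sqr.
Qed.

End Pair.
End Comparison.

(** * Asymptotics in log n *)

Section Asymptotics.
Variable R : realType.
Local Notation harm := (harm R).
Local Notation L n := (ln (n%:R : R)).

Lemma ln_nat_gt0 n : (2 <= n)%N -> 0 < L n.
Proof. by move=> n2; rewrite ln_gt0// ltr1n. Qed.

Lemma harm_ge_ln n : L n.+1 <= harm n.
Proof.
elim: n => [|n IH]; first by rewrite ln1 harm_ge0.
rewrite /harm big_nat_recr//= -/(harm n).
have -> : n.+2%:R = n.+1%:R * (1 + n.+1%:R^-1) :> R.
  by rewrite mulrDr mulr1 mulfV ?pnatr_eq0// natr1.
rewrite lnM ?posrE ?addr_gt0 ?invr_gt0//.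
by rewrite lerD// le_ln1Dx// (lt_trans (ltrN10 R)).
Qed.

Lemma harm_le_ln n : (0 < n)%N -> harm n <= 1 + L n.
Proof.
case: n => // n _; elim: n => [|n IH].
  by rewrite /harm big_nat1 invr1 ln1 addr0.
rewrite /harm big_nat_recr//= -/(harm n.+1).
have n2 : n.+2%:R != 0 :> R by rewrite pnatr_eq0.
have pos : 0 < 1 - n.+2%:R^-1 :> R by rewrite subr_gt0 invf_lt1// ltr1n.
have -> : L n.+2 = L n.+1 - ln (1 - n.+2%:R^-1).
  rewrite -ln_div ?posrE//; congr ln.
  have -> : n.+1%:R = n.+2%:R * (1 - n.+2%:R^-1) :> R.
    by rewrite mulrBr mulr1 mulfV// -[n.+2%:R]natr1 addrK.
  by rewrite mulfK// gt_eqF.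
have : ln (1 - n.+2%:R^-1) <= - n.+2%:R^-1 :> R by apply: le_ln1Dx; rewrite ltrN2 -subr_gt0.
by move=> h; rewrite addrA lerD// lerNr.
Qed.

Lemma harm_le_ln_mul n : (2 <= n)%N -> harm n <= (1 + (ln 2)^-1) * L n.
Proof.
move=> n2; apply: le_trans (harm_le_ln (ltnW n2)) _.
have l2 : 0 < ln 2 :> R by rewrite ln_gt0// ltr1n.
have : ln 2 <= L n by rewrite ler_ln ?posrE ?ltr0n ?ler_nat// ltnW.
rewrite mulrDl mul1r addrC lerD2l mulrC ler_pdivlMr// mul1r //.
Qed.

(** Apply ln y <= y to y = x^(c/b) and raise to the power b. *)
Lemma ln_powR_le (x b c : R) : 1 <= x -> 0 < b -> 0 < c ->
  ln x `^ b <= (b / c) `^ b * x `^ c.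
Proof.
move=> x1 b0 c0; have x0 : 0 < x by lra.
have bc : 0 < b / c by rewrite divr_gt0.
have -> : x `^ c = (x `^ (c / b)) `^ b by rewrite -powRrM divfK ?gt_eqF.
rewrite -powRM ?powR_ge0 ?(ltW bc)//; apply: ge0_ler_powR; rewrite ?nnegrE ?(ltW b0)//.
- by rewrite ln_ge0.
- by rewrite mulr_ge0 ?powR_ge0 ?(ltW bc).
have -> : ln x = b / c * ln (x `^ (c / b)) by rewrite ln_powR mulrA; field; lra.
by rewrite ler_pM2l//; apply/ltW/ln_sublinear; rewrite powR_gt0.
Qed.

(** Trades an exponent for a larger one at the cost of a constant; used for x = log n and x0 = log
    2. *)
Lemma powR_exponent_le (x0 x u v : R) : 0 < x0 -> x0 <= x -> u <= v ->
  x `^ u <= x0 `^ (u - v) * x `^ v.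
Proof.
move=> x00 x0x uv; have xp : 0 < x by lra.
have -> : x `^ u = x `^ (u - v) * x `^ v.
  by rewrite -powRD ?subrK// (gt_eqF xp) implybT.
rewrite ler_pM2r ?powR_gt0// -[u - v]opprB !powRN lef_pV2 ?posrE ?powR_gt0//.
by apply: ge0_ler_powR; rewrite ?nnegrE ?subr_ge0 ?(ltW xp) ?(ltW x00).
Qed.

Section Cutoff.
Variables (b : R) (n : nat).
Hypotheses (b0 : 0 < b) (n2 : (2 <= n)%N).

Let v : R := n%:R * L n `^ (- b).

Let v0 : 0 < v.
Proof. by rewrite mulr_gt0 ?ltr0n ?powR_gt0 ?ln_nat_gt0// ltnW. Qed.

Let cutoffE : (cutoff b n)%:R = (Num.ceil v)%:~R :> R.
Proof.
by rewrite /cutoff -/v natr_absz ger0_norm// ceil_ge0 (lt_trans _ v0)// ltrN10.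
Qed.

Lemma cutoff_gt0 : (0 < cutoff b n)%N.
Proof. by rewrite -(@ltr0n R) cutoffE ltr0z ceil_gt0. Qed.

Lemma cutoff_lb : v <= (cutoff b n)%:R.
Proof. by rewrite cutoffE ceil_ge. Qed.

Let Lv : L n `^ b * v = n%:R.
Proof.
rewrite /v mulrCA -powRD ?subrr ?powRr0 ?mulr1//.
by rewrite (gt_eqF (ln_nat_gt0 n2)) implybT.
Qed.

Let n1 : 1 <= n%:R :> R. Proof. by rewrite ler1n ltnW. Qed.

(** Rounding up adds at most 1, and 1 <= b^b v because (log n)^b <= b^b n. *)
Lemma cutoff_ub : (cutoff b n)%:R <= (1 + b `^ b) * v.
Proof.
apply: (@le_trans _ _ (v + 1)).
  by rewrite cutoffE; have := ceilB1_lt v; rewrite intrB => h; lra.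
rewrite mulrDl mul1r lerD2l.
have := @ln_powR_le n%:R b 1 n1 b0 ltr01; rewrite divr1 powRr1// => h.
have Lb : 0 < L n `^ b by rewrite powR_gt0// ln_nat_gt0.
by rewrite -(ler_pM2l Lb) mulr1 mulrCA Lv.
Qed.

(** (log n)^b <= (2b)^b sqrt n, so the cutoff is at least a constant times sqrt n; the inner factor
    2 pays for halving the cutoff. *)
Lemma cutoff_ln : L n / 2 - ln (2 * (b * 2) `^ b) <= L (cutoff b n)./2.+1.
Proof.
have := @ln_powR_le n%:R b 2^-1 n1 b0; rewrite invrK => /(_ ltac:(by rewrite invr_gt0)) h.
set k := (b * 2) `^ b in h *.
have k0 : 0 < k by rewrite powR_gt0// mulr_gt0.
have nn : n%:R = n%:R `^ 2^-1 * n%:R `^ 2^-1 :> R by rewrite powR12_sqrt// -expr2 sqr_sqrtr.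
have np : 0 < n%:R `^ 2^-1 :> R by rewrite powR_gt0// (lt_le_trans ltr01).
have vlb : n%:R `^ 2^-1 <= k * v.
  rewrite -(ler_pM2l np) -[leLHS]nn -[leLHS]Lv.
  by rewrite [leRHS](_ : _ = k * n%:R `^ 2^-1 * v) ?ler_pM2r//; ring.
have -> : L n / 2 - ln (2 * k) = ln (n%:R `^ 2^-1 / (2 * k)).
  by rewrite ln_div ?posrE ?mulr_gt0// ln_powR mulrC.
rewrite ler_ln ?posrE ?divr_gt0 ?mulr_gt0//.
rewrite ler_pdivrMr ?mulr_gt0//; apply: le_trans vlb _.
apply: (@le_trans _ _ (k * (cutoff b n)%:R)); first by rewrite ler_pM2l// cutoff_lb.
rewrite [leRHS]mulrC -mulrA [leRHS]mulrCA ler_pM2l// -natrM ler_nat; lia.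
Qed.

End Cutoff.

Lemma escape_mean_cutoff (esc : nat -> (nat -> Z4) -> nat -> R) (b : R) :
  (forall r s i, 0 <= esc r s i) -> (forall r s i, esc r s i <= 1) ->
  (forall r s s' z a,
    (forall k, (k <= r.*2)%N -> s (a + k)%N = z + s' k) -> esc r s (a + r) = esc r s' r) ->
  (forall r s c N T x, (N <= r <= c)%N ->
    \sum_(1 <= i < N.+1) esc r s (c + i) * green_upto R T (x - s (c + i)%N) <= 1) ->
  0 < b ->
  exists2 C : R, 0 <= C &
    forall n, (2 <= n)%N -> escape_mean esc (cutoff b n) <= C / L n.
Proof.
move=> le0 le1 lesh lelast b0; pose K := `|ln (2 * (b * 2) `^ b)|.
have K0 : 0 <= K by exact: normr_ge0.
have c0 : 0 <= escape_const R by rewrite /escape_const addr_ge0.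
exists (4 * escape_const R + 4 * K); first by lra.
move=> n n2; have Ln0 := ln_nat_gt0 n2.
have hl : L n / 2 - K <= harm (cutoff b n)./2.
  apply: le_trans (harm_ge_ln _); apply: le_trans (cutoff_ln b0 n2).
  by rewrite lerD2l lerN2 ler_norm.
(* When log n < 4K the trivial bound 1 suffices, because the constant is at least 4K; otherwise log
   n / 2 - K >= log n / 4. *)
have [LK|LK] := lerP (4 * K) (L n); last first.
  apply: le_trans (escape_mean_le1 le1 _) _.
  by rewrite ler_pdivlMr// mul1r; lra.
have h4 : L n / 4 <= harm (cutoff b n)./2 by lra.
have r2 : (2 <= cutoff b n)%N.
  rewrite leqNgt; apply/negP => r1; move: h4.
  by rewrite (_ : (cutoff b n)./2 = 0)%N ?/harm ?big_geq//; [lra|lia].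
apply: le_trans (escape_mean_ub le0 le1 lesh lelast r2) _.
have hp : 0 < harm (cutoff b n)./2 by lra.
rewrite ler_pdivrMr// mulrAC ler_pdivlMr//.
have := ler_wpM2l c0 h4; have := mulr_ge0 K0 (ltW hp); nra.
Qed.

End Asymptotics.

Section Rates.
Variable R : realType.
Local Notation L n := (ln (n%:R : R)).

(** Three harmonic factors give (log n)^3, using m <= n. The factor (log m)^(-b) in the cutoff of m
    becomes eps^(-b) (log n)^(-b) through log m >= eps log n. *)
Lemma second_moment_bound_le (eps b : R) : 0 < eps -> 0 < b ->
  exists2 C : R, 0 <= C & forall n m, (2 <= n)%N -> (m <= n)%N -> n%:R `^ eps <= m%:R ->
    second_moment_bound R n m (cutoff b n) (cutoff b m) <=
    C * (n%:R * m%:R) * L n `^ (3 - b).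
Proof.
have : 0 < 1536 :> R by rewrite ltr0n.
rewrite /second_moment_bound; move: (1536 : R) => K K0 e0 b0.
pose c := 1 + b `^ b; pose c1 : R := 1 + (ln 2)^-1.
have l2 : 0 < ln 2 :> R by rewrite ln_gt0// ltr1n.
have c0 : 0 <= c by rewrite addr_ge0 ?powR_ge0.
have c10 : 0 <= c1 by rewrite addr_ge0 ?invr_ge0 ?(ltW l2).
have ce : 0 <= 1 + eps `^ (- b) by rewrite addr_ge0 ?powR_ge0.
exists (K * (c * c1 ^+ 3 * (1 + eps `^ (- b)))); first by rewrite !mulr_ge0 ?exprn_ge0 ?(ltW K0).
move=> n m n2 mn nm.
have n1 : 1 < n%:R :> R by rewrite ltr1n.
have nR : 0 < n%:R :> R by rewrite ltr0n ltnW.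
have m2 : (2 <= m)%N.
  by rewrite -(@ltr1n R); apply: lt_le_trans nm;
    rewrite /powR (gt_eqF nR) expR_gt1 mulr_gt0 ?ln_gt0.
have mR : 0 < m%:R :> R by rewrite ltr0n ltnW.
have Ln := ln_nat_gt0 R n2; have Lm := ln_nat_gt0 R m2.
have Lmn : L m <= L n by rewrite ler_ln ?posrE// ler_nat.
have Lem : eps * L n <= L m.
  by rewrite -ln_powR ler_ln ?posrE ?powR_gt0.
have hn : harm R n <= c1 * L n by exact: harm_le_ln_mul.
have hm : harm R m <= c1 * L n.
  by apply: le_trans (harm_le_ln_mul R m2) _; rewrite ler_wpM2l.
have hn0 := harm_ge0 R n; have hm0 := harm_ge0 R m.
have cL0 : 0 <= c1 * L n by rewrite mulr_ge0 ?(ltW Ln).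
have h1 : harm R m * harm R n ^+ 2 <= (c1 * L n) ^+ 3.
  rewrite [leRHS]exprS; apply: ler_pM; rewrite ?sqr_ge0//.
  by rewrite ler_pXn2r ?nnegrE.
have h2 : harm R n * harm R m ^+ 2 <= (c1 * L n) ^+ 3.
  rewrite [leRHS]exprS; apply: ler_pM; rewrite ?sqr_ge0//.
  by rewrite ler_pXn2r ?nnegrE.
have rn := cutoff_ub b0 n2; have rm := cutoff_ub b0 m2.
have rm' : (cutoff b m)%:R <= c * (m%:R * (eps `^ (- b) * L n `^ (- b))).
  apply: le_trans rm _; rewrite ler_wpM2l// ler_wpM2l// -powRM ?(ltW e0) ?(ltW Ln)//.
  have eL : 0 < eps * L n by rewrite mulr_gt0.
  rewrite !powRN lef_pV2 ?posrE ?powR_gt0//.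
  by apply: ge0_ler_powR; rewrite ?nnegrE ?(ltW eL) ?(ltW Lm) ?(ltW b0).
have -> : L n `^ (3 - b) = L n ^+ 3 * L n `^ (- b).
  by rewrite powRD ?(gt_eqF Ln) ?implybT// powR_mulrn// ltW.
rewrite -[leRHS]mulrA -[leRHS]mulrA ler_pM2l//.
set p := L n `^ (- b) in rn rm' *; set q := eps `^ (- b) in rm' *.
have p0 : 0 <= p by exact: powR_ge0.
have q0 : 0 <= q by exact: powR_ge0.
rewrite [leRHS](_ : _ = c * (n%:R * p) * m%:R * (c1 * L n) ^+ 3 +
   c * (m%:R * (q * p)) * n%:R * (c1 * L n) ^+ 3); last by rewrite exprMn; ring.
apply: lerD; rewrite -mulrA; apply: ler_pM; rewrite ?mulr_ge0 ?sqr_ge0//.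
  by rewrite ler_pM2r.
by rewrite ler_pM2r.
Qed.

End Rates.

(** * The random sums as path averages *)

Section Assembly.
Variables (R : realType) (d' : measure_display) (T' : measurableType d') (Q : probability T' R).
Variable W : nat -> T' -> Z4.
Hypothesis hW : simple_random_walk Q 0 W.
Local Notation esc := (local_escape_real Q W).
Local Notation green_fun := (@green_fun R).

Definition g_real (alpha : R) n (s : nat -> Z4) i : R :=
  if (2 <= n)%N then windowed esc n (cutoff (2 * alpha) n) s i else 1.

Lemma gE alpha n s i : g Q W alpha n s i = (g_real alpha n s i)%:E.
Proof.
rewrite /g /g_real /windowed /inner; case: (2 <= n)%N => //=.
by case: ifP => // _; rewrite (local_escapeE hW).
Qed.

Lemma g_real01 alpha n s i : 0 <= g_real alpha n s i <= 1.
Proof.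
rewrite /g_real; case: ifP => _; last by rewrite ler01 lexx.
by apply: windowed01 => *; [exact: local_escape_real_ge0|exact: local_escape_real_le1].
Qed.

Lemma g_real_local alpha n i : local_upto n (fun s => g_real alpha n s i).
Proof.
move=> s s' ss'; rewrite /g_real; case: ifP => // _; rewrite /windowed;
  case: ifP => // /andP[ri irn].
by apply: (esc_local_upto (local_escape_real_shift Q W) ri irn).
Qed.

Definition Y_real (alpha : R) n m (s t : nat -> Z4) : R :=
  green_sum green_fun n m (g_real alpha n s) (g_real alpha m t) s t.

Lemma YsumE alpha n m s t : Ysum Q W alpha n m s t = (Y_real alpha n m s t)%:E.
Proof.
rewrite /Ysum /Y_real /green_sum -sumEFin; apply: eq_bigr => i _.
rewrite -sumEFin; apply: eq_bigr => l _.
by rewrite !gE (greenE hW) -green_funN opprB !EFinM.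
Qed.

Lemma green_sum_local_right G n m a (b : (nat -> Z4) -> nat -> R) s :
  (forall l, local_upto m (fun t => b t l)) ->
  local_upto m (fun t => green_sum G n m a (b t) s t).
Proof.
move=> lb t t' tt'; apply: eq_bigr => i _; apply: eq_big_nat => l /andP[_ lm].
by rewrite tt'// (lb l _ _ tt').
Qed.

Lemma green_sum_local_left G n m (a : (nat -> Z4) -> nat -> R) b t :
  (forall i, local_upto n (fun s => a s i)) ->
  local_upto n (fun s => green_sum G n m (a s) b s t).
Proof.
move=> la s s' ss'; apply: eq_big_nat => i /andP[_ i_n]; apply: eq_bigr => l _.
by rewrite ss'// (la i _ _ ss').
Qed.

Lemma green_sum_ge0 n m a b s t : (forall i, 0 <= a i) -> (forall l, 0 <= b l) ->
  0 <= green_sum green_fun n m a b s t.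
Proof.
move=> a0 b0; apply: sumr_ge0 => i _; apply: sumr_ge0 => l _.
by rewrite !mulr_ge0 ?green_fun_ge0.
Qed.

Context d (T : measurableType d) (P : probability T R) (S S' : nat -> T -> Z4).
Hypotheses (hS : simple_random_walk P 0 S) (hS' : simple_random_walk P 0 S').
Hypothesis hSS' : independent_processes P S S'.

Lemma ghatE (alpha : R) n :
  ghat P S Q W alpha n = (escape_mean esc (cutoff (2 * alpha) n))%:E.
Proof.
rewrite /ghat; under eq_integral do rewrite (local_escapeE hW).
apply: (walk_integral (F := fun s => esc (cutoff (2 * alpha) n) s (cutoff (2 * alpha) n)) hS).
  exact: (esc_local (local_escape_real_shift Q W)).
by move=> s; exact: local_escape_real_ge0.
Qed.

Definition Ybar_real (alpha : R) n m (s t : nat -> Z4) : R :=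
  averaged_sum esc n m (cutoff (2 * alpha) n) (cutoff (2 * alpha) m) green_fun s t.

Lemma YbarE (alpha : R) n m s t : Ybar P S Q W alpha n m s t = (Ybar_real alpha n m s t)%:E.
Proof.
rewrite /Ybar !ghatE /Ybar_real /averaged_sum EFinM EFinM; congr (_ * _)%E.
rewrite -sumEFin; apply: eq_bigr => i _; rewrite -sumEFin; apply: eq_bigr => l _.
by rewrite (greenE hW) -green_funN opprB mul1r mulr1.
Qed.

Lemma Ysum_integral (alpha : R) n m :
  (\int[P]_w Ysum Q W alpha n m (S ^~ w) (S' ^~ w) =
   (pathE n (fun s => pathE m (fun t => Y_real alpha n m (walk s) (walk t))))%:E)%E.
Proof.
under eq_integral do rewrite YsumE.
apply: (walks_integral hS hS' hSS') => [s|t|s t].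
- by apply: green_sum_local_right => l; exact: g_real_local.
- by apply: green_sum_local_left => i; exact: g_real_local.
- apply: green_sum_ge0 => i; first by have /andP[] := g_real01 alpha n s i.
  by have /andP[] := g_real01 alpha m t i.
Qed.

Lemma Ysum_diff_integral (alpha : R) n m :
  (\int[P]_w (Ysum Q W alpha n m (S ^~ w) (S' ^~ w) - Ybar P S Q W alpha n m (S ^~ w) (S' ^~ w)) ^+ 2 =
   (pathE n (fun s => pathE m (fun t =>
     (Y_real alpha n m (walk s) (walk t) - Ybar_real alpha n m (walk s) (walk t)) ^+ 2)))%:E)%E.
Proof.
under eq_integral do rewrite YsumE YbarE -EFinB -EFin_expe.
apply: (walks_integral (F := fun s t => (Y_real alpha n m s t - Ybar_real alpha n m s t) ^+ 2)
  hS hS' hSS') => [s t t' tt'|t s s' ss'|s t].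
- rewrite (_ : Y_real alpha n m s t = Y_real alpha n m s t'); last first.
    by apply: green_sum_local_right tt' => l; exact: g_real_local.
  rewrite /Ybar_real /averaged_sum.
  by rewrite (@green_sum_local_right green_fun n m (fun=> 1) (fun _ _ => 1) s _ t t' tt').
- rewrite (_ : Y_real alpha n m s t = Y_real alpha n m s' t); last first.
    by apply: (@green_sum_local_left _ _ _ (g_real alpha n)) ss' => l; exact: g_real_local.
  rewrite /Ybar_real /averaged_sum.
  by rewrite (@green_sum_local_left green_fun n m (fun _ _ => 1) (fun=> 1) t _ s s' ss').
- exact: sqr_ge0.
Qed.

Lemma Y_real_weighted (alpha : R) n m s t : (2 <= n)%N -> (2 <= m)%N ->
  Y_real alpha n m s t =
  weighted_sum esc n m (cutoff (2 * alpha) n) (cutoff (2 * alpha) m) green_fun s t.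
Proof.
move=> n2 m2; rewrite /Y_real /weighted_sum; congr green_sum.
  by apply/funext => i; rewrite /g_real n2.
by apply/funext => i; rewrite /g_real m2.
Qed.

Lemma Y_real_le (alpha : R) n m s t :
  Y_real alpha n m s t <= green_sum green_fun n m (fun=> 1) (fun=> 1) s t.
Proof.
apply: ler_sum => i _; apply: ler_sum => l _.
have /andP[g0 g1] := g_real01 alpha n s i; have /andP[h0 h1] := g_real01 alpha m t l.
by rewrite !ler_pM ?mulr_ge0 ?green_fun_ge0.
Qed.

End Assembly.

Local Open Scope ereal_scope.

Theorem lemma4p3 (R : realType)
  (d : measure_display) (T : measurableType d) (P : probability T R)
  (S S' : nat -> T -> Z4)
  (d' : measure_display) (T' : measurableType d') (Q : probability T' R)
  (W : nat -> T' -> Z4)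
  (hS : simple_random_walk P 0%R S)
  (hS' : simple_random_walk P 0%R S')
  (hSS' : independent_processes P S S')
  (hW : simple_random_walk Q 0%R W) :
  (exists C : R, forall alpha : R, (0 < alpha)%R -> forall n m : nat,
     \int[P]_w Ysum Q W alpha n m (S ^~ w) (S' ^~ w)
     <= (C * Num.sqrt (n%:R * m%:R))%:E)
  /\
  (forall eps alpha : R, (0 < eps)%R -> (4 < alpha)%R ->
   exists C : R, forall n m : nat, (2 <= n)%N ->
     (n%:R `^ eps <= m%:R)%R -> (m <= n)%N ->
     \int[P]_w Ysum Q W alpha n m (S ^~ w) (S' ^~ w)
     <= (C * Num.sqrt (n%:R * m%:R) * (ln n%:R) ^- 2)%:E
     /\
     \int[P]_w (Ysum Q W alpha n m (S ^~ w) (S' ^~ w)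
                - Ybar P S Q W alpha n m (S ^~ w) (S' ^~ w)) ^+ 2
     <= (C * (n%:R * m%:R) * (ln n%:R) `^ (- (alpha / 2)))%:E).
Proof.
have le0 := local_escape_real_ge0 hW; have le1 := local_escape_real_le1 hW.
have lesh := local_escape_real_shift Q W; have lelast := local_escape_last_exit hW.
split.
  (* Here g <= 1 suffices; the 8 is the 4 of the heat kernel times the 2 of [sum_inv_add_le]. *)
  exists 8%R => alpha _ n m; rewrite (Ysum_integral hW hS hS' hSS') lee_fin.
  apply: le_trans (green_sum_mean R n m); apply: ler_pathE => s _; apply: ler_pathE => t _.
  exact: Y_real_le.
move=> eps alpha e0 a4.
have b0 : (0 < 2 * alpha)%R by lra.
have [C1 C10 hC1] := second_moment_bound_le e0 b0.
have [C2 C20 hC2] := escape_mean_cutoff le0 le1 lesh lelast b0.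
pose l : R := ln 2; have l0 : (0 < l)%R by rewrite ln_gt0// ltr1n.
(* Powers of l = log 2 raise the exponent 3 - 2 alpha to -alpha/2 in [K1] and, under the square
   root, to -4 in [K2]. The factor [C2 / eps] expresses the escape mean of the walk of length m
   through log n. *)
pose K1 := (C1 * l `^ (3 - 2 * alpha - - (alpha / 2)))%R.
pose K2 := (Num.sqrt (C1 * l `^ (3 - 2 * alpha - - 4%:R)) + 8 * (C2 * (C2 / eps)))%R.
have K10 : (0 <= K1)%R by rewrite mulr_ge0 ?powR_ge0.
have K20 : (0 <= K2)%R by rewrite addr_ge0 ?sqrtr_ge0// !mulr_ge0 ?invr_ge0 ?(ltW e0).
exists (K1 + K2)%R => n m n2 nm mn.
have n1 : (1 < n%:R :> R)%R by rewrite ltr1n.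
have nR : (0 < n%:R :> R)%R by rewrite ltr0n ltnW.
(* n^eps > 1 excludes m = 1, where g has the default value 1 and log m vanishes. *)
have m2 : (2 <= m)%N.
  by rewrite -(@ltr1n R); apply: lt_le_trans nm;
    rewrite /powR (gt_eqF nR) expR_gt1 mulr_gt0 ?ln_gt0.
have mR : (0 < m%:R :> R)%R by rewrite ltr0n ltnW.
have n0 : (0 < n)%N := ltnW n2.
have m0 : (0 < m)%N := ltnW m2.
have rn0 := cutoff_gt0 (2 * alpha)%R n2; have rm0 := cutoff_gt0 (2 * alpha)%R m2.
have Ln := ln_nat_gt0 R n2; have Lm := ln_nat_gt0 R m2.
have lL : (l <= ln n%:R)%R by rewrite ler_ln ?posrE ?ltr0n ?ler_nat.
have bound := hC1 n m n2 mn nm.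
have nm0 : (0 <= n%:R * m%:R :> R)%R by rewrite mulr_ge0.
rewrite (Ysum_integral hW hS hS' hSS') (Ysum_diff_integral hW hS hS' hSS') !lee_fin; split.
  have -> : pathE n (fun s => pathE m (fun t => Y_real Q W alpha n m (walk s) (walk t))) =
      pathE n (fun s => pathE m (fun t => weighted_sum (local_escape_real Q W) n m
        (cutoff (2 * alpha)%R n) (cutoff (2 * alpha)%R m) (@green_fun R) (walk s) (walk t))).
    by apply: eq_pathE => s _; apply: eq_pathE => t _; rewrite Y_real_weighted.
  apply: le_trans (weighted_sum_mean le0 le1 lesh n0 m0 rn0 rm0) _.
  set M := (n%:R * m%:R)%R in nm0 bound *; set sM := Num.sqrt M.
  have sM0 : (0 <= sM)%R by exact: sqrtr_ge0.
  pose u : R := ((ln n%:R) ^- 2)%R.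
  have u0 : (0 <= u)%R by rewrite invr_ge0 sqr_ge0.
  have hg : (escape_mean (local_escape_real Q W) (cutoff (2 * alpha)%R n) *
      escape_mean (local_escape_real Q W) (cutoff (2 * alpha)%R m) <= C2 * (C2 / eps) * u)%R.
    have -> : (C2 * (C2 / eps) * u = C2 / ln n%:R * (C2 / (eps * ln n%:R)))%R.
      by rewrite /u; field; rewrite !gt_eqF.
    apply: ler_pM; rewrite ?escape_mean_ge0 ?hC2//.
    apply: le_trans (hC2 m m2) _; rewrite ler_wpM2l// lef_pV2 ?posrE ?mulr_gt0//.
    by rewrite -ln_powR ler_ln ?posrE ?powR_gt0.
  have hs : (Num.sqrt (second_moment_bound R n m (cutoff (2 * alpha)%R n) (cutoff (2 * alpha)%R m))
      <= Num.sqrt (C1 * l `^ (3 - 2 * alpha - - 4%:R)) * sM * u)%R.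
    have -> : (Num.sqrt (C1 * l `^ (3 - 2 * alpha - - 4%:R)) * sM * u =
        Num.sqrt (C1 * l `^ (3 - 2 * alpha - - 4%:R) * M * u ^+ 2))%R.
      by rewrite [RHS]sqrtrM ?mulr_ge0 ?powR_ge0// sqrtr_sqr (ger0_norm u0) [in RHS]sqrtrM ?mulr_ge0 ?powR_ge0.
    apply: ler_wsqrtr; apply: le_trans bound _.
    have := powR_exponent_le l0 lL (u := (3 - 2 * alpha)%R) (v := (- 4%:R)%R) ltac:(lra).
    rewrite [X in (_ <= _ * X)%R](_ : _ = u ^+ 2)%R; last first.
      by rewrite powRN powR_mulrn ?(ltW Ln)// /u exprVn -exprM.
    move=> /(ler_wpM2l (mulr_ge0 C10 nm0)) /le_trans; apply.
    by rewrite le_eqVlt; apply/orP; left; apply/eqP; ring.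
  apply: le_trans (lerD (ler_wpM2r _ hg) hs) _; first by rewrite mulr_ge0.
  rewrite -/u; apply: (@le_trans _ _ (K2 * sM * u)%R).
    by rewrite le_eqVlt; apply/orP; left; apply/eqP; rewrite /K2; ring.
  by rewrite ler_wpM2r// ler_wpM2r// lerDr.
apply: (@le_trans _ _ (second_moment_bound R n m (cutoff (2 * alpha)%R n) (cutoff (2 * alpha)%R m))).
  apply: le_trans (weighted_sum_sqr le0 le1 lesh n0 m0 rn0 rm0).
  by apply: ler_pathE => s _; apply: ler_pathE => t _; rewrite Y_real_weighted.
apply: le_trans bound _.
have := powR_exponent_le l0 lL (u := (3 - 2 * alpha)%R) (v := (- (alpha / 2))%R) ltac:(lra).
set x := (ln n%:R `^ _)%R; set y := (ln n%:R `^ _)%R => xy.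
have y0 : (0 <= y)%R by exact: powR_ge0.
apply: (@le_trans _ _ (K1 * (n%:R * m%:R) * y)%R).
  have := ler_wpM2l (mulr_ge0 C10 nm0) xy; move=> /le_trans; apply.
  by rewrite le_eqVlt; apply/orP; left; apply/eqP; rewrite /K1; ring.
by rewrite ler_wpM2r// ler_wpM2r// lerDl.
Qed.
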